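(* Let $M>1$. For generic $a\in\mathrm{LP}^+_M$ (i.e. for all $a$ in a dense $G_\delta$ subset of $\mathrm{LP}^+_M$ with the sup-norm metric), $\sigma(J_a)$ is a Cantor set of zero Lebesgue measure, and the spectral type of $J_a$ is purely singular continuous.
   Context: For a bounded sequence $a=(a_n)_{n\in\mathbb{Z}}$ with $a_n>0$, $J_a$ is the off-diagonal Jacobi matrix on $\ell^2(\mathbb{Z})$, $[J_a u]_n = a_{n-1}u_{n-1} + a_n u_{n+1}$. A sequence is limit-periodic if it is a uniform (sup-norm) limit of periodic sequences. For $M>1$, $\mathrm{LP}^+_M$ is the set of positive limit-periodic sequences $a$ with $M^{-1}\le a_n\le M$ for all $n$, with the metric $\|a-a'\|_\infty$. A Cantor set is a compact subset of $\mathbb{R}$ with empty interior and no isolated points. The spectral type is purely singular continuous if every spectral measure $\mu_\psi$, $\psi\in\ell^2(\mathbb{Z})$, is supported on a Lebesgue-null set and has no atoms. *)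

(* Defs.v *)
From HB Require Import structures.
From mathcomp Require Import all_boot all_order all_algebra.
From mathcomp Require Import all_classical all_reals all_analysis.
Set Implicit Arguments. Unset Strict Implicit. Unset Printing Implicit Defensive.
Import Order.TTheory GRing.Theory Num.Theory.
Import numFieldNormedType.Exports.
Local Open Scope classical_set_scope.
Local Open Scope ring_scope.

Section Defs.
Variable R : realType.

Definition zseq := int -> R.

Definition zpart (f : zseq) : R ^nat :=
  fun N => \sum_(0 <= k < N) (f (k%:Z) + f (- (k%:Z) - 1)).
Definition zsum (f : zseq) : R := limn (zpart f).

Definition in_l2 (u : zseq) : Prop :=
  cvgn (zpart (fun n => u n ^+ 2)).

Definition l2norm2 (u : zseq) : R := zsum (fun n => u n ^+ 2).
Definition l2dot (u v : zseq) : R := zsum (fun n => u n * v n).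

Definition Jop (a : zseq) (u : zseq) : zseq :=
  fun n => a (n - 1) * u (n - 1) + a n * u (n + 1).

Definition in_resolvent (a : zseq) (E : R) : Prop :=
  (forall f, in_l2 f -> exists u, in_l2 u /\ (forall n, Jop a u n - E * u n = f n))
  /\ (forall u, in_l2 u -> (forall n, Jop a u n - E * u n = 0) -> forall n, u n = 0)
  /\ (exists C : R, forall u, in_l2 u ->
        l2norm2 u <= C * l2norm2 (fun n => Jop a u n - E * u n)).

(* Spectrum (J_a is self-adjoint, so its spectrum is real). *)
Definition spectrum (a : zseq) : set R := [set E | ~ in_resolvent a E].

Definition cantor_set (S : set R) : Prop :=
  compact S /\ interior S = set0 /\
  (forall x, S x -> forall e : R, 0 < e -> exists2 y, S y & y != x /\ `|y - x| < e).

(* mu is the spectral measure of J_a for psi = psi1 + i psi2 (psi1, psi2 real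
   l^2 sequences): the finite Borel measure whose moments are
   <psi, J^n psi> = <psi1, J^n psi1> + <psi2, J^n psi2>. *)
Definition is_spectral_measure (a : zseq) (psi1 psi2 : zseq)
    (mu : {measure set (measurableTypeR R) -> \bar R}) : Prop :=
  (mu setT < +oo)%E /\
  forall n : nat,
    mu.-integrable setT (fun x => ((x : R) ^+ n)%:E) /\
    (\int[mu]_x ((x : R) ^+ n)%:E =
       (l2dot psi1 (iter n (Jop a) psi1) + l2dot psi2 (iter n (Jop a) psi2))%:E)%E.

Definition purely_sc (a : zseq) : Prop :=
  forall psi1 psi2, in_l2 psi1 -> in_l2 psi2 ->
  forall mu, is_spectral_measure a psi1 psi2 mu ->
    (forall x : R, mu [set x] = 0%E) /\
    (exists S : set R, measurable S /\ (lebesgue_measure S = 0)%E /\ mu (~` S) = 0%E).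

Definition periodic (b : zseq) : Prop :=
  exists p : nat, (0 < p)%N /\ forall n, b (n + p%:Z) = b n.
Definition limit_periodic (a : zseq) : Prop :=
  forall e : R, 0 < e -> exists b, periodic b /\ forall n, `|a n - b n| <= e.

Definition LPplus (M : R) : set zseq :=
  [set a | limit_periodic a /\ forall n, M^-1 <= a n <= M].

Definition rel_open (X U : set zseq) : Prop :=
  U `<=` X /\
  forall a, U a -> exists2 r : R, 0 < r &
    forall b, X b -> (forall n, `|a n - b n| <= r) -> U b.
Definition rel_dense (X G : set zseq) : Prop :=
  G `<=` X /\
  forall a, X a -> forall e : R, 0 < e -> exists2 b, G b & forall n, `|a n - b n| <= e.
Definition rel_Gdelta (X G : set zseq) : Prop :=
  exists U : nat -> set zseq, (forall k, rel_open X (U k)) /\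
    G = X `&` \bigcap_k U k.

End Defs.

(* Main.v *)
(* Periodic sequences are dense, so by Baire it suffices to perturb a periodic [a] slightly to
   a periodic [b] whose spectrum is covered by few very short intervals, and to approximate
   generic sequences so fast by periodic ones that Gordon's three-block argument excludes
   eigenvalues.  For the first point: every energy can be put in a spectral gap of a small
   periodic perturbation of [a], so by compactness finitely many perturbations [w_t] together
   leave no spectrum.  Let one period of [b] be the concatenation of long blocks of the [w_t].
   An energy in a gap of [w_t] has solutions exponentially small in the middle of the [t]-th
   block; cutting [J_b] there into finite matrices of size [P] shows that such an energy lies
   exponentially close to one of [P] numbers, while [P] only grows linearly with the block length.
   The spectral statements are derived without the spectral theorem, from the powers of
   [1 - (J - E)^2 / K]: they tend strongly to zero when [E] is not an eigenvalue, and in norm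
   when [E] is in the resolvent set. *)

(* The moments are all that [is_spectral_measure] provides, so only polynomials can be integrated
   against [mu], and nothing is known beforehand about its support. The even powers of
   [1 - (x - E)^2 / K] are nonnegative on the whole line and equal 1 at [E]; their integrals are
   sums of squared norms, so Chebyshev's inequality bounds [mu] near [E]. An isolated point of the
   spectrum would be an eigenvalue, so Gordon's argument also yields the Cantor property, empty
   interior coming from measure zero.

   A cut can spoil a lower bound only through the values of [u] near the cut. If [E] is in a gap of
   [w_t], a Combes-Thomas weight centred at the cut bounds these values by [(J_b - E) u] plus an
   exponentially small multiple of [u]; hence each energy is treated with the cut in a block that
   has it in a gap. The decay rate depends only on the common constant [C] of the finite family,
   which is fixed before the block length is chosen.

   Resolvent statements are carried as lower bounds with explicit constants: these survive small
   uniform changes of the coefficients, and so produce the open sets of the Baire argument. *)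
Require Import Defs.
From HB Require Import structures.
From mathcomp Require Import all_boot all_order all_algebra.
From mathcomp Require Import all_classical all_reals all_analysis.
From mathcomp Require Import measurable_realfun ring lra zify.
Import Order.TTheory GRing.Theory Num.Theory.
Import numFieldNormedType.Exports.
Local Open Scope classical_set_scope.
Local Open Scope ring_scope.

(** * Two-sided sums *)

Section ZSums.
Variable R : realType.
Implicit Types (f g u v : zseq R) (c : R).

Lemma zpart0 f : zpart f 0 = 0.
Proof. by rewrite /zpart big_nat big1. Qed.

Lemma zpartS f N : zpart f N.+1 = zpart f N + (f N%:Z + f (- N%:Z - 1)).
Proof. by rewrite /zpart big_nat_recr. Qed.

Lemma eq_zpart f g : f =1 g -> zpart f =1 zpart g.
Proof. by move=> /funext->. Qed.

Lemma zpartD f g N : zpart (fun n => f n + g n) N = zpart f N + zpart g N.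
Proof. by rewrite /zpart -big_split; apply: eq_bigr => i _ /=; ring. Qed.

Lemma zpartZ c f N : zpart (fun n => c * f n) N = c * zpart f N.
Proof. by rewrite /zpart mulr_sumr; apply: eq_bigr => i _ /=; ring. Qed.

Lemma le_zpart f g N : (forall n, f n <= g n) -> zpart f N <= zpart g N.
Proof. by move=> fg; apply: ler_sum => i _; apply: lerD. Qed.

Lemma zpart_ge0 f N : (forall n, 0 <= f n) -> 0 <= zpart f N.
Proof. by move=> f0; apply: sumr_ge0 => i _; apply: addr_ge0. Qed.

Lemma zpart_nd f : (forall n, 0 <= f n) -> {homo zpart f : m n / (m <= n)%N >-> m <= n}.
Proof.
move=> f0; apply/nondecreasing_seqP => n.
by rewrite zpartS lerDl addr_ge0.
Qed.

(** [zpart f N] covers the indices from [-N] to [N - 1], so [n] has surely appeared once [N] is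
    [|n| + 1]. *)
Lemma zpart_mem f n : (forall n, 0 <= f n) -> f n <= zpart f `|n|.+1.
Proof.
move=> f0; case: n => n.
  by rewrite zpartS absz_nat; move: (zpart_ge0 f n f0) (f0 (- n%:Z - 1)); lra.
rewrite (_ : `|Negz n|%N = n.+1) // zpartS zpartS.
have -> : Negz n = - n%:Z - 1 by lia.
by move: (zpart_ge0 f n f0) (f0 n%:Z) (f0 n.+1%:Z) (f0 (- n.+1%:Z - 1)); lra.
Qed.

(** Shifting moves the summation range [[-N, N - 1]] to [[-N + 1, N]]: one term is gained and one is
    lost. *)
Lemma zpart_shift f N : zpart (fun n => f (n + 1)) N = zpart f N + (f N%:Z - f (- N%:Z)).
Proof.
elim: N => [|N IH]; first by rewrite !zpart0 oppr0 subrr addr0.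
rewrite !zpartS IH.
have -> : - N%:Z - 1 + 1 = - N%:Z by lia.
have -> : - N.+1%:Z = - N%:Z - 1 by lia.
have -> : N%:Z + 1 = N.+1%:Z by lia.
by ring.
Qed.

(* For [f >= 0] this says that the two-sided series is summable with sum at most [c]. *)
Definition zbnd f c := forall N, zpart f N <= c.

Lemma zbnd_le f g c d : (forall n, f n <= g n) -> c <= d -> zbnd g c -> zbnd f d.
Proof. by move=> fg cd H N; rewrite (le_trans _ cd)// (le_trans _ (H N))// le_zpart. Qed.

Lemma zbndD f g c d : zbnd f c -> zbnd g d -> zbnd (fun n => f n + g n) (c + d).
Proof. by move=> fc gd N; rewrite zpartD lerD. Qed.

Lemma zbndZ f c k : 0 <= k -> zbnd f c -> zbnd (fun n => k * f n) (k * c).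
Proof. by move=> k0 fc N; rewrite zpartZ ler_wpM2l. Qed.

Lemma zbnd_cst0 : zbnd (fun=> 0) 0.
Proof. by move=> N; rewrite /zpart big1 // => i _; rewrite addr0. Qed.

Lemma zbnd_ge0 f c : zbnd f c -> 0 <= c.
Proof. by move=> /(_ 0%N); rewrite zpart0. Qed.

Lemma zbnd_mem f c n : (forall n, 0 <= f n) -> zbnd f c -> f n <= c.
Proof. by move=> f0 /(_ `|n|.+1); apply: le_trans; exact: zpart_mem. Qed.

Lemma zbnd_shift1 f c : (forall n, 0 <= f n) -> zbnd f c -> zbnd (fun n => f (n + 1)) c.
Proof.
move=> f0 fc N; rewrite zpart_shift.
move: (fc N.+1) (f0 (- N%:Z - 1)) (f0 (- N%:Z)); rewrite zpartS; lra.
Qed.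

Lemma zbnd_shiftN1 f c : (forall n, 0 <= f n) -> zbnd f c -> zbnd (fun n => f (n - 1)) c.
Proof.
move=> f0 fc N.
have := zpart_shift (fun n => f (n - 1)) N.
under eq_zpart do rewrite addrK.
move: (fc N.+1) (f0 (N%:Z - 1)) (f0 (N%:Z)); rewrite zpartS; lra.
Qed.

Lemma zbnd_shift f c m : (forall n, 0 <= f n) -> zbnd f c -> zbnd (fun n => f (n + m)) c.
Proof.
move=> f0 fc; elim/int_ind: m => [|m IH|m IH].
- by under [X in zbnd X]eq_fun do rewrite addr0.
- have := @zbnd_shift1 (fun n => f (n + m%:Z)) c (fun n => f0 _) IH.
  congr zbnd; apply: funext => n; congr f; lia.
- have := @zbnd_shiftN1 (fun n => f (n - m%:Z)) c (fun n => f0 _) IH.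
  congr zbnd; apply: funext => n; congr f; lia.
Qed.

Lemma cvg_zpart f c : (forall n, 0 <= f n) -> zbnd f c -> cvgn (zpart f).
Proof.
move=> f0 fc; apply: nondecreasing_is_cvgn; first exact: zpart_nd.
by exists c => _ [n _ <-]; apply: fc.
Qed.

Lemma zsum_le f c : (forall n, 0 <= f n) -> zbnd f c -> zsum f <= c.
Proof.
move=> f0 fc; apply: limr_le; first exact: (@cvg_zpart _ c).
by apply: nearW => n; apply: fc.
Qed.

Lemma zbnd_zsum f : (forall n, 0 <= f n) -> cvgn (zpart f) -> zbnd f (zsum f).
Proof. by move=> f0 cf n; apply: nondecreasing_cvgn_le => //; apply: zpart_nd. Qed.

Lemma zsumD f g : cvgn (zpart f) -> cvgn (zpart g) ->
  zsum (fun n => f n + g n) = zsum f + zsum g.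
Proof.
move=> cf cg; rewrite /zsum; have -> : zpart (fun n => f n + g n) = (zpart f \+ zpart g)%R.
  by apply: funext => N; rewrite zpartD.
exact: limD.
Qed.

Lemma cvg_zpartD f g : cvgn (zpart f) -> cvgn (zpart g) ->
  cvgn (zpart (fun n => f n + g n)).
Proof.
move=> cf cg; have -> : zpart (fun n => f n + g n) = (zpart f \+ zpart g)%R.
  by apply: funext => N; rewrite zpartD.
exact: is_cvgD.
Qed.

Lemma cvg_zpartZ c f : cvgn (zpart f) -> cvgn (zpart (fun n => c * f n)).
Proof.
move=> cf; have -> : zpart (fun n => c * f n) = (cst c \* zpart f)%R.
  by apply: funext => N; rewrite zpartZ.
by apply: is_cvgM => //; apply: is_cvg_cst.
Qed.

Lemma zsumZ c f : cvgn (zpart f) -> zsum (fun n => c * f n) = c * zsum f.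
Proof.
move=> cf; rewrite /zsum; have -> : zpart (fun n => c * f n) = (cst c \* zpart f)%R.
  by apply: funext => N; rewrite zpartZ.
rewrite limM//; last exact: is_cvg_cst.
by rewrite lim_cst.
Qed.

(** A term outside the range of [zpart f N] is at most the remainder of the nonnegative series. *)
Lemma zpart_tail f : (forall n, 0 <= f n) -> cvgn (zpart f) ->
  forall e, 0 < e -> exists N, forall n, (N <= `|n|)%N -> f n < e.
Proof.
move=> f0 cf e e0.
have /cvgrPdist_lt/(_ _ e0)[N _ HN] : zpart f @ \oo --> zsum f := cf.
exists N.+1 => n Nn.
have bd := zbnd_zsum f f0 cf.
have : `|zsum f - zpart f N| < e by apply: HN => /=.
rewrite ger0_norm ?subr_ge0//.
have : zpart f N + f n <= zpart f `|n|.+1.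
  have H k : (N <= k)%N -> zpart f N <= zpart f k by exact: zpart_nd.
  case: n Nn => n Nn.
    rewrite absz_nat zpartS.
    by move: (H n) (f0 (- n%:Z - 1)) => /(_ ltac:(lia)); lra.
  rewrite (_ : `|Negz n|%N = n.+1) // zpartS zpartS.
  have -> : Negz n = - n%:Z - 1 by lia.
  by move: (H n ltac:(lia)) (f0 n%:Z) (f0 n.+1%:Z) (f0 (- n.+1%:Z - 1)); lra.
by move: (bd `|n|.+1); lra.
Qed.

Lemma in_l2P u : in_l2 u <-> exists c, zbnd (fun n => u n ^+ 2) c.
Proof.
split=> [cu|[c uc]]; last by apply: (@cvg_zpart _ c) => // n; exact: sqr_ge0.
by exists (zsum (fun n => u n ^+ 2)); apply: zbnd_zsum => // n; exact: sqr_ge0.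
Qed.

Lemma l2norm2_le u c : zbnd (fun n => u n ^+ 2) c -> l2norm2 u <= c.
Proof. by apply: zsum_le => n; exact: sqr_ge0. Qed.

Lemma zbnd_l2norm2 u : in_l2 u -> zbnd (fun n => u n ^+ 2) (l2norm2 u).
Proof. by apply: zbnd_zsum => n; exact: sqr_ge0. Qed.

Lemma zbnd_in_l2 u c : zbnd (fun n => u n ^+ 2) c -> in_l2 u.
Proof. by move=> H; apply/in_l2P; exists c. Qed.

Lemma in_l2D u v : in_l2 u -> in_l2 v -> in_l2 (fun n => u n + v n).
Proof.
move=> /in_l2P[c uc] /in_l2P[d vd]; apply/in_l2P; exists (2 * c + 2 * d).
apply: zbnd_le (lexx _) (zbndD _ _ _ _ (zbndZ _ _ 2 _ uc) (zbndZ _ _ 2 _ vd)) => //.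
by move=> n /=; rewrite -subr_ge0; have := sqr_ge0 (u n - v n); lra.
Qed.

Lemma in_l2Z c u : in_l2 u -> in_l2 (fun n => c * u n).
Proof.
move=> /in_l2P[d ud]; apply/in_l2P; exists (c ^+ 2 * d).
apply: zbnd_le (lexx _) (zbndZ _ _ (c ^+ 2) (sqr_ge0 _) ud) => n /=.
by rewrite exprMn.
Qed.

Lemma in_l20 : in_l2 (fun=> 0 : R).
Proof. by apply/in_l2P; exists 0 => N; rewrite expr0n /=; apply: zbnd_cst0. Qed.

Lemma in_l2_shift u m : in_l2 u -> in_l2 (fun n => u (n + m)).
Proof.
move=> /in_l2P[c uc]; apply/in_l2P; exists c.
by apply: (@zbnd_shift (fun n => u n ^+ 2)) => // n; exact: sqr_ge0.
Qed.

Lemma in_l2M K (w : zseq R) u : (forall n, `|w n| <= K) -> in_l2 u ->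
  in_l2 (fun n => w n * u n).
Proof.
move=> wK /in_l2P[d ud]; apply/in_l2P; exists (K ^+ 2 * d).
apply: zbnd_le (lexx _) (zbndZ _ _ (K ^+ 2) (sqr_ge0 _) ud) => n /=.
rewrite exprMn ler_wpM2r ?sqr_ge0// -[_ ^+ 2]real_normK ?num_real//.
by rewrite lerXn2r ?nnegrE// (le_trans _ (wK n)).
Qed.

(** Polarization: [u v = ((u + v)^2 - (u^2 + v^2)) / 2], and all squares are summable. *)
Lemma cvg_l2dot u v : in_l2 u -> in_l2 v -> cvgn (zpart (fun n => u n * v n)).
Proof.
move=> lu lv.
have := cvg_zpartZ (2^-1) _ (cvg_zpartD _ _ (in_l2D _ _ lu lv)
  (cvg_zpartZ (-1) _ (cvg_zpartD _ _ lu lv))).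
by congr (cvgn (zpart _)); apply: funext => n /=; field.
Qed.

End ZSums.

(** * Bounded self-adjoint operators *)

Section SelfAdjoint.
Variables (R : realType) (V : lmodType R) (dot : V -> V -> R).
Hypothesis dotC : forall u v, dot u v = dot v u.
Hypothesis dotDl : forall u v w, dot (u + v) w = dot u w + dot v w.
Hypothesis dotZl : forall c u v, dot (c *: u) v = c * dot u v.
Hypothesis dot_ge0 : forall u, 0 <= dot u u.
Hypothesis dot_eq0 : forall u, dot u u = 0 -> u = 0.

Local Notation n2 u := (dot u u).

Let dotDr u v w : dot u (v + w) = dot u v + dot u w.
Proof. by rewrite dotC dotDl !(dotC u). Qed.
Let dotZr c u v : dot u (c *: v) = c * dot u v.
Proof. by rewrite dotC dotZl dotC. Qed.
Let dotNl u v : dot (- u) v = - dot u v.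
Proof. by rewrite -scaleN1r dotZl mulN1r. Qed.
Let dotNr u v : dot u (- v) = - dot u v.
Proof. by rewrite dotC dotNl dotC. Qed.
Let dot0l v : dot 0 v = 0.
Proof. by rewrite -(scale0r (0 : V)) dotZl mul0r. Qed.
Let dotE := (dotDl, dotDr, dotNl, dotNr, dotZl, dotZr).

Definition l2lim (x : nat -> V) (l : V) := forall e : R, 0 < e ->
  exists N, forall n, (N <= n)%N -> n2 (x n - l) <= e.

Definition l2cauchy (x : nat -> V) := forall e : R, 0 < e ->
  exists N, forall m n, (N <= m)%N -> (N <= n)%N -> n2 (x m - x n) <= e.

Hypothesis complete : forall x, l2cauchy x -> exists l, l2lim x l.

Lemma n2D_le u v : n2 (u + v) <= 2 * n2 u + 2 * n2 v.
Proof.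
have := dot_ge0 (u - v); rewrite !dotE (dotC v u); lra.
Qed.

Lemma n2B_le u v : n2 (u - v) <= 2 * n2 u + 2 * n2 v.
Proof. by have := n2D_le u (- v); rewrite !dotE opprK. Qed.

Lemma n2BC u v : n2 (u - v) = n2 (v - u).
Proof. by rewrite -(opprB v u) !dotE; ring. Qed.

Lemma n2_eps0 u : (forall e, 0 < e -> n2 u <= e) -> u = 0.
Proof.
move=> H; apply: dot_eq0; apply/eqP; rewrite eq_le dot_ge0 andbT.
by apply/ler_addgt0Pr => e e0; rewrite add0r H.
Qed.

Variables (B : {linear V -> V}) (K : R).
Hypothesis K_gt0 : 0 < K.
Hypothesis Bsym : forall u v, dot (B u) v = dot u (B v).
Hypothesis Bbnd : forall u, n2 (B u) <= K * n2 u.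

(* A contraction because [|B|^2 <= K], and the identity exactly on [ker B]. *)
Definition richardson (u : V) : V := u - K^-1 *: B (B u).
Local Notation Q := richardson.

Lemma richardsonD u v : Q (u + v) = Q u + Q v.
Proof. by rewrite /Q !linearD /= addrACA. Qed.

Lemma richardsonN u : Q (- u) = - Q u.
Proof. by rewrite /Q !linearN /= opprD. Qed.

Lemma richardsonZ c u : Q (c *: u) = c *: Q u.
Proof. by rewrite /Q !linearZ /= scalerDr !scalerA mulrC. Qed.

Lemma richardson_sym u v : dot (Q u) v = dot u (Q v).
Proof. by rewrite /Q !dotE !Bsym. Qed.

(** By symmetry [n2 (Q u) = n2 u - 2 K^-1 n2 (B u) + K^-2 n2 (B (B u))], and the last term is at
    most [K^-1 n2 (B u)]. *)
Lemma richardson_le u : n2 (Q u) <= n2 u - K^-1 * n2 (B u).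
Proof.
rewrite /Q !dotE (dotC (B (B u)) u) -(Bsym u).
have K0 : 0 < K^-1 by rewrite invr_gt0.
have : K^-1 * (K^-1 * n2 (B (B u))) <= K^-1 * n2 (B u).
  by rewrite ler_pM2l// mulrC ler_pdivrMr// mulrC Bbnd.
lra.
Qed.

Lemma richardson_contr u : n2 (Q u) <= n2 u.
Proof.
apply: le_trans (richardson_le u) _; rewrite lerBlDr lerDl.
by rewrite mulr_ge0// invr_ge0 ltW.
Qed.

Lemma iter_richardsonD n u v : iter n Q (u + v) = iter n Q u + iter n Q v.
Proof. by elim: n => //= n ->; rewrite richardsonD. Qed.

Lemma iter_richardson_sym n u v : dot (iter n Q u) v = dot u (iter n Q v).
Proof. by elim: n u v => //= n IH u v; rewrite richardson_sym IH -iterSr. Qed.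

Lemma iter_richardson_contr n m u : (n <= m)%N -> n2 (iter m Q u) <= n2 (iter n Q u).
Proof.
elim: m => [|m IH]; first by rewrite leqn0 => /eqP->.
rewrite leq_eqVlt => /orP[/eqP-> //|/IH]; apply: le_trans.
exact: richardson_contr.
Qed.

(** The decrement [K^-1 * n2 (B v)] of one step is at least [n2 v / (C * K)]. *)
Lemma iter_richardson_geom C u n : 0 < C -> (forall v, n2 v <= C * n2 (B v)) ->
  n2 (iter n Q u) <= (1 - (C * K)^-1) ^+ n * n2 u.
Proof.
move=> C0 HC.
have step v : n2 (Q v) <= (1 - (C * K)^-1) * n2 v.
  apply: le_trans (richardson_le v) _.
  rewrite mulrBl mul1r lerD2l lerN2 invfM mulrAC mulrC ler_pM2l ?invr_gt0//.
  by rewrite ler_pdivrMl.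
have [q0|q0] := leP 0 (1 - (C * K)^-1); last first.
  (* A negative factor is only possible in the trivial space. *)
  have z v : n2 v = 0.
    apply/eqP; rewrite eq_le dot_ge0 andbT leNgt; apply/negP => v0.
    have := le_trans (dot_ge0 _) (step v).
    by rewrite leNgt nmulr_rlt0// v0.
  by rewrite !z mulr0.
elim: n => [|n IH]; first by rewrite expr0 mul1r.
rewrite iterS exprS -mulrA; apply: le_trans (step _) _.
exact: ler_wpM2l.
Qed.

Lemma bounded_below_ker C u : (forall v, n2 v <= C * n2 (B v)) -> B u = 0 -> u = 0.
Proof.
move=> HC Bu; apply: dot_eq0; apply/eqP; rewrite eq_le dot_ge0 andbT.
by apply: le_trans (HC u) _; rewrite Bu dot0l mulr0.
Qed.

Lemma l2lim_uniq x l l' : l2lim x l -> l2lim x l' -> l = l'.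
Proof.
move=> xl xl'; apply/eqP; rewrite -subr_eq0; apply/eqP; apply: n2_eps0 => e e0.
have e4 : 0 < e / 4 by rewrite divr_gt0.
have [N HN] := xl _ e4; have [N' HN'] := xl' _ e4.
have := HN (maxn N N') (leq_maxl _ _); have := HN' (maxn N N') (leq_maxr _ _).
set y := x _; rewrite (n2BC y l) => h1 h2.
rewrite (_ : l - l' = (l - y) + (y - l')); last by rewrite addrA subrK.
apply: le_trans (n2D_le _ _) _; lra.
Qed.

Lemma l2limB x l : l2lim x l -> l2lim (B \o x) (B l).
Proof.
move=> xl e e0; have [N HN] := xl (e / K) (divr_gt0 e0 K_gt0).
exists N => n /HN h; rewrite /= -linearB; apply: le_trans (Bbnd _) _.
by rewrite mulrC -ler_pdivlMr.
Qed.

Lemma l2limQ x l : l2lim x l -> l2lim (Q \o x) (Q l).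
Proof.
move=> xl e e0; have [N HN] := xl e e0.
exists N => n /HN h; rewrite /= -richardsonN -richardsonD.
exact: le_trans (richardson_contr _) h.
Qed.


(** The squared norms [t j] decrease, hence converge. Symmetry turns the inner product of two even
    iterates into [t (n + m)], so the even iterates are Cauchy; for an odd total exponent there is
    no such formula. Their limit [l] satisfies [Q (Q l) = l], and [n2 l <= n2 (Q l) <= n2 l - K^-1 *
    n2 (B l)] forces [B l = 0]. Monotonicity of [t] carries the limit back to all iterates. *)
Lemma iter_richardson_lim0 u : (forall v, B v = 0 -> v = 0) -> l2lim (fun n => iter n Q u) 0.
Proof.
move=> ker0.
pose t j := n2 (iter j Q u).
have tc : cvgn t.
  apply: nonincreasing_is_cvgn.
    by move=> m n mn; apply: iter_richardson_contr.
  by exists 0 => _ [n _ <-]; apply: dot_ge0.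
have txy n m : n2 (iter n.*2 Q u - iter m.*2 Q u) = t n.*2 - 2 * t (n + m)%N + t m.*2.
  have -> : t (n + m)%N = dot (iter n.*2 Q u) (iter m.*2 Q u).
    by rewrite /t !iter_richardson_sym -!iterD; congr (dot u (iter _ Q u)); lia.
  by rewrite !dotE (dotC (iter m.*2 Q u)) /t; ring.
have xc : l2cauchy (fun n => iter n.*2 Q u).
  move=> e e0.
  have /cvgrPdist_lt/(_ (e / 4)) : t @ \oo --> limn t := tc.
  rewrite divr_gt0// => /(_ isT)[N _ HN]; exists N => m n Nm Nn.
  rewrite txy.
  move: (HN m.*2 ltac:(move=> /=; lia)) (HN n.*2 ltac:(move=> /=; lia)).
  move: (HN (m + n)%N ltac:(move=> /=; lia)).
  by rewrite !ltr_norml => /andP[? ?] /andP[? ?] /andP[? ?]; lra.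
have [l xl] := complete _ xc.
have QQl : Q (Q l) = l.
  apply: l2lim_uniq (l2limQ _ _ (l2limQ _ _ xl)) _ => e /xl[N HN].
  by exists N => n Nn; apply: (HN n.+1); apply: leqW.
have Bl : B l = 0.
  apply: dot_eq0; apply/eqP; rewrite eq_le dot_ge0 andbT.
  have := richardson_contr (Q l); rewrite QQl => h1.
  have := le_trans h1 (richardson_le l).
  have K0 : 0 < K^-1 by rewrite invr_gt0.
  by rewrite lerBrDl gerDr pmulr_rle0.
move: xl; rewrite (ker0 _ Bl) => xl e /xl[N HN]; exists N.*2 => n Nn.
apply: le_trans (HN N (leqnn _)); rewrite !subr0.
exact: iter_richardson_contr.
Qed.

(* The partial sums of [sum_n K^-1 B Q^n f], i.e. of [B^-1 f] expanded along [B^2 = K (1 - Q)]. *)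
Fixpoint richardson_sum f n : V :=
  if n is m.+1 then richardson_sum f m + K^-1 *: B (iter m Q f) else 0.

Lemma B_richardson_sum f n : B (richardson_sum f n) = f - iter n Q f.
Proof.
elim: n => [|n IH] /=; first by rewrite linear0 subrr.
by rewrite linearD IH linearZ /= {3}/Q opprB addrA addrAC.
Qed.

(** The lower bound makes the kernel trivial, so [B] maps the partial sums to [f - Q^n f], which
    tends to [f]. The lower bound again makes the partial sums Cauchy, and [B] is continuous. *)
Lemma bounded_below_surj C f : 0 < C -> (forall v, n2 v <= C * n2 (B v)) ->
  exists u, B u = f.
Proof.
move=> C0 HC.
have Q0 := iter_richardson_lim0 f (fun v => @bounded_below_ker C v HC).
have [u ul] : exists u, l2lim (richardson_sum f) u.
  apply: complete => e e0.
  have [|N HN] := Q0 (e / (4 * C)); first by rewrite divr_gt0// mulr_gt0.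
  exists N => m n /HN + /HN; rewrite !subr0 => hm hn.
  apply: le_trans (HC _) _; rewrite linearB !B_richardson_sum opprB addrC addrA subrK.
  rewrite mulrC -ler_pdivlMr//; apply: le_trans (n2B_le _ _) _.
  rewrite [leRHS](_ : _ = 2 * (e / (4 * C)) + 2 * (e / (4 * C))); first lra.
  by field; rewrite gt_eqF.
exists u; apply: l2lim_uniq (l2limB _ _ ul) _ => e /Q0[N HN]; exists N => n /HN.
by rewrite /= B_richardson_sum subr0 addrAC subrr sub0r !dotE opprK.
Qed.

(** For [Y >= 0] one has [|Y v|^2 <= |Y| <v, Y v>]; the constant [(1 + L) / 2] replaces the operator
    norm, bounding [<w, Y w>] by the arithmetic mean of [n2 w] and [n2 (Y w)]. The inequality is
    nonnegativity of the form at [v - l^-1 Y v]. *)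
Lemma nonneg_form_bound (Y : {linear V -> V}) L v : 0 <= L ->
  (forall u w, dot (Y u) w = dot u (Y w)) -> (forall u, 0 <= dot u (Y u)) ->
  (forall u, n2 (Y u) <= L * n2 u) -> n2 (Y v) <= ((1 + L) / 2) * dot v (Y v).
Proof.
move=> L0 Ysym Y0 YL; set l := (1 + L) / 2.
have l0 : 0 < l by rewrite /l; lra.
have hw w : dot w (Y w) <= l * n2 w.
  have := dot_ge0 (w - Y w); rewrite !dotE (dotC (Y w) w) /l.
  by have := YL w; nra.
have hq := hw (Y v).
have h := Y0 (v - l^-1 *: Y v).
have e1 : dot v (Y (Y v)) = n2 (Y v) by rewrite Ysym.
have e2 : Y (v - l^-1 *: Y v) = Y v - l^-1 *: Y (Y v) by rewrite linearB linearZ.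
move: h; rewrite e2 !dotE e1.
move: hq; set q := n2 (Y v); set r := dot _ (Y (Y v)); set p := dot v (Y v).
have li : 0 < l^-1 by rewrite invr_gt0.
move=> hq h.
have h1 : l^-1 * (l^-1 * r) <= l^-1 * q by rewrite ler_pM2l// ler_pdivrMl.
have : l^-1 * q <= p by lra.
by rewrite ler_pdivrMl.
Qed.

(** Real induction: at the supremum of the points up to which [P] holds, closedness gives [P] and
    openness goes beyond. *)
Lemma segment_ind (P : R -> Prop) a b : a <= b -> P a ->
  (forall s, a <= s <= b -> P s -> exists2 h, 0 < h & forall t, s <= t <= s + h -> P t) ->
  (forall s, a < s <= b -> (forall t, a <= t < s -> P t) -> P s) -> P b.
Proof.
move=> ab Pa Popen Pclosed.
pose S : set R := [set s | a <= s <= b /\ forall t, a <= t <= s -> P t].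
have Sa : S a by split; [rewrite lexx | move=> t /le_anti <-].
have hS : has_sup S by split; [exists a | exists b => s [/andP[]]].
set s := sup S.
have as_ : a <= s by apply: ub_le_sup => //; case: hS.
have sb : s <= b by apply: ge_sup; [exists a | move=> t [/andP[]]].
have Plt t : a <= t < s -> P t.
  move=> /andP[at_ ts]; have [u Su tu] := sup_gt (proj1 hS) ts.
  by case: Su => _; apply; rewrite at_ ltW.
have Ps : P s.
  move: as_; rewrite le_eqVlt => /orP[/eqP<- //|as_].
  by apply: Pclosed => //; rewrite as_ sb.
have [h h0 Ph] := Popen s ltac:(by rewrite as_ sb) Ps.
have [bh|hb] := leP b (s + h); first by apply: Ph; rewrite sb.
suff : s + h <= s by rewrite gerDl leNgt h0.
apply: ub_le_sup; first by case: hS.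
split; first by rewrite (le_trans as_) ?lerDl ?ltW.
move=> t /andP[at_ th]; have [ts|st] := ltP t s; first by apply: Plt; rewrite at_.
by apply: Ph; rewrite st.
Qed.

(** For [B = J - E] and [z = s^2] this is [(J - E - s)(J - E + s)], so its invertibility speaks of
    the two energies [E + s] and [E - s]. *)
Definition shifted_square (z : R) (v : V) : V := B (B v) - z *: v.
Local Notation A := shifted_square.

Fact shifted_square_is_linear z : linear (A z).
Proof.
move=> c u v; rewrite /A.
have -> : B (B (c *: u + v)) = c *: B (B u) + B (B v) by rewrite !linearP.
by rewrite scalerDr scalerBr !scalerA (mulrC z) opprD addrACA.
Qed.
HB.instance Definition _ z := GRing.isLinear.Build R V V _ (A z) (shifted_square_is_linear z).

Lemma shifted_square_sym z u v : dot (A z u) v = dot u (A z v).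
Proof. by rewrite /A !dotE !Bsym. Qed.

Lemma shifted_squareC y z v : A y (A z v) = A z (A y v).
Proof.
have E t w : B (B (A t w)) = B (B (B (B w))) - t *: B (B w).
  by rewrite /A !linearB !linearZ.
rewrite {1 3}/A !E /A !scalerBr !scalerA (mulrC y) !opprB -!addrA; congr (_ + _).
by rewrite addrC -addrA [RHS]addrCA.
Qed.

Lemma shifted_square_bnd z v : n2 (A z v) <= (2 * K ^+ 2 + 2 * z ^+ 2) * n2 v.
Proof.
apply: le_trans (n2B_le _ _) _; rewrite !dotE.
have := Bbnd (B v); have := Bbnd v; have := K_gt0; nra.
Qed.

(* [(A - y)(A - z) >= 0] holds at [z = y]; being nonnegative and invertible forces it to be
   strictly positive, so it persists as [z] moves through the resolvent set. *)
Lemma shifted_square_pos b : (forall z, 0 < z <= b ->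
    exists2 C, 0 < C & forall v, n2 v <= C * n2 (A z v)) ->
  forall y v, 0 < y <= b -> 0 <= dot (A y v) (A b v).
Proof.
move=> bb y + /andP[y0 yb].
pose P z := forall v, 0 <= dot (A y v) (A z v).
have AE z t v : dot (A y v) (A t v) = dot (A y v) (A z v) - (t - z) * dot (A y v) v.
  by rewrite {2 4}/A !dotE; ring.
apply: (@segment_ind P y b) => //.
- move=> s /andP[ys sb] Ps.
  have [C C0 HC] := bb s ltac:(by rewrite (lt_le_trans y0)).
  have [D D0 HD] := bb y ltac:(by rewrite y0).
  pose L := (2 * K ^+ 2 + 2 * y ^+ 2) * (2 * K ^+ 2 + 2 * s ^+ 2).
  have L0 : 0 <= L by apply: mulr_ge0; apply: addr_ge0; apply: mulr_ge0 => //; exact: sqr_ge0.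
  (* The lower bounds at [s] and [y] bound [v] by [A y (A s v)]; as that product is nonnegative,
     [nonneg_form_bound] replaces its norm by its form. *)
  have key v : n2 v <= C * D * ((1 + L) / 2) * dot (A y v) (A s v).
    have := @nonneg_form_bound (A y \o A s) L v L0; rewrite /= => H.
    have {H}H : n2 (A y (A s v)) <= (1 + L) / 2 * dot (A y v) (A s v).
      rewrite (shifted_square_sym y v); apply: H.
      - by move=> u w; rewrite !shifted_square_sym shifted_squareC.
      - by move=> u; rewrite -shifted_square_sym; apply: Ps.
      - move=> u; apply: le_trans (shifted_square_bnd _ _) _.
        rewrite /L -mulrA ler_wpM2l//; last exact: shifted_square_bnd.
        by apply: addr_ge0; apply: mulr_ge0 => //; exact: sqr_ge0.
    apply: le_trans (HC v) _; rewrite -!mulrA ler_pM2l//.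
    by apply: le_trans (HD _) _; rewrite ler_pM2l// mulrA.
  set E := C * D * ((1 + L) / 2) in key.
  have E0 : 0 < E by rewrite /E mulr_gt0 ?mulr_gt0//; lra.
  pose F := 1 + (2 * K ^+ 2 + 2 * y ^+ 2).
  have F0 : 0 < F.
    by rewrite /F; have := sqr_ge0 K; have := sqr_ge0 y; lra.
  exists (E * F)^-1 => [|t /andP[st th] v]; first by rewrite invr_gt0 mulr_gt0.
  rewrite (AE s) subr_ge0.
  have hF : dot (A y v) v <= F * n2 v.
    have := shifted_square_bnd y v; move: (A y v) => w hw.
    have := dot_ge0 (w - v); rewrite !dotE (dotC v w) /F.
    by have := dot_ge0 v; have := dot_ge0 w; lra.
  have h1 : (t - s) * dot (A y v) v <= (E * F)^-1 * (F * n2 v).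
    have [neg|pos] := leP (dot (A y v) v) 0.
      apply: (@le_trans _ _ 0); first by rewrite mulr_ge0_le0// subr_ge0.
      apply: mulr_ge0; last by apply: mulr_ge0; [exact: ltW | exact: dot_ge0].
      by rewrite invr_ge0; apply/ltW/mulr_gt0.
    by apply: ler_pM => //; [rewrite subr_ge0 | exact: ltW | rewrite lerBlDl].
  apply: le_trans h1 _; rewrite invfM -mulrA mulKf ?gt_eqF//.
  by rewrite mulrC ler_pdivrMr// mulrC.
- move=> s /andP[ys sb] H v; rewrite leNgt; apply/negP => neg.
  set p := dot (A y v) (A s v) in neg; set d := dot (A y v) v.
  (* The first entry keeps [s - h] at or above [y]. The second makes [h * |d| <= - p / 2], so the
     form at [s - h], which is [p + h * d], would still be negative. *)
  pose h := Num.min (s - y) (- p / (2 * (1 + `|d|))).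
  have d0 : 0 < 1 + `|d| by have := normr_ge0 d; lra.
  have h0 : 0 < h by rewrite lt_min subr_gt0 ys divr_gt0 ?mulr_gt0// oppr_gt0.
  have hs : h <= s - y by rewrite /h ge_min lexx.
  have := H (s - h) ltac:(apply/andP; split; lra) v; rewrite (AE s) -/p -/d.
  have : h * (2 * (1 + `|d|)) <= - p by rewrite -ler_pdivlMr ?mulr_gt0// ge_min lexx orbT.
  have := ler_norm d; have := normr_ge0 d; nra.
Qed.

(** Letting [y] tend to 0 in [shifted_square_pos] gives [b * n2 x <= n2 (B x)] for [x] in the range
    of [B]. With trivial kernel the range is dense: [v - Q^N v] lies in it and [Q^N v] tends to 0.
    The factor 4 comes from splitting a squared norm twice, and [4 * K + 2 * b] collects the
    resulting error terms. *)
Lemma gap_bounded_below b : 0 < b -> (forall v, B v = 0 -> v = 0) ->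
  (forall z, 0 < z <= b -> exists2 C, 0 < C & forall v, n2 v <= C * n2 (A z v)) ->
  forall v, b * n2 v <= 4 * n2 (B v).
Proof.
move=> b0 ker0 bb v.
have range w : b * n2 (B w) <= n2 (B (B w)).
  rewrite -subr_ge0.
  have -> : n2 (B (B w)) - b * n2 (B w) = dot (B (B w)) (A b w).
    by rewrite /A !dotE (Bsym (B w)) (dotC (B (B w)) w) -(Bsym w).
  rewrite leNgt; apply/negP; set p := dot _ _ => neg.
  set d := dot w (A b w).
  pose y := Num.min b (- p / (2 * (1 + `|d|))).
  have d0 : 0 < 1 + `|d| by have := normr_ge0 d; lra.
  have y0 : 0 < y by rewrite lt_min b0 divr_gt0 ?mulr_gt0// oppr_gt0.
  have yb : y <= b by rewrite ge_min lexx.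
  have := shifted_square_pos b bb y w; rewrite y0 yb => /(_ isT).
  have -> : dot (A y w) (A b w) = p - y * d by rewrite /p /d {1}/A dotDl dotNl dotZl.
  have : y * (2 * (1 + `|d|)) <= - p by rewrite -ler_pdivlMr ?mulr_gt0// ge_min lexx orbT.
  have := ler_norm (- d); rewrite normrN; have := normr_ge0 d; nra.
have Q0 := iter_richardson_lim0 v ker0.
apply/ler_addgt0Pr => e e0.
have D0 : 0 < 4 * K + 2 * b by have := K_gt0; lra.
have [N /(_ N (leqnn _))] := Q0 (e / (4 * K + 2 * b)) (divr_gt0 e0 D0).
rewrite subr0 => h.
have := range (richardson_sum v N); rewrite B_richardson_sum.
set q := iter N Q v in h *; set d := e / _ in h.
have dE : (4 * K + 2 * b) * d = e by rewrite mulrC divfK ?gt_eqF.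
have h1 := n2D_le (v - q) q; rewrite subrK in h1.
have h2 : n2 (B (v - q)) <= 2 * n2 (B v) + 2 * n2 (B q) by rewrite linearB; apply: n2B_le.
have h3 := Bbnd q.
move=> h4; have := K_gt0; nra.
Qed.

End SelfAdjoint.

(** * The Hilbert space of square summable sequences *)

Section L2Space.
Variable R : realType.

Record l2 := L2 { l2val :> int -> R ; l2P : in_l2 l2val }.

Lemma l2_ext (u v : l2) : u =1 v -> u = v.
Proof.
case: u v => [u up] [v vp] /= /funext E.
by case: _ / E in vp *; congr L2; apply: Prop_irrelevance.
Qed.

HB.instance Definition _ := gen_eqMixin l2.
HB.instance Definition _ := gen_choiceMixin l2.

Definition l2_zero : l2 := L2 _ (in_l20 R).
Definition l2_add (u v : l2) : l2 := L2 _ (in_l2D _ _ _ (l2P u) (l2P v)).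
Definition l2_scale (c : R) (u : l2) : l2 := L2 _ (in_l2Z _ c _ (l2P u)).
Definition l2_opp (u : l2) : l2 := l2_scale (-1) u.

Fact l2_addA : associative l2_add.
Proof. by move=> u v w; apply: l2_ext => n /=; ring. Qed.
Fact l2_addC : commutative l2_add.
Proof. by move=> u v; apply: l2_ext => n /=; ring. Qed.
Fact l2_add0 : left_id l2_zero l2_add.
Proof. by move=> u; apply: l2_ext => n /=; ring. Qed.
Fact l2_addN : left_inverse l2_zero l2_opp l2_add.
Proof. by move=> u; apply: l2_ext => n /=; ring. Qed.
HB.instance Definition _ := GRing.isZmodule.Build l2 l2_addA l2_addC l2_add0 l2_addN.

Fact l2_scaleA a b v : l2_scale a (l2_scale b v) = l2_scale (a * b) v.
Proof. by apply: l2_ext => n /=; ring. Qed.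
Fact l2_scale1 : left_id 1 l2_scale.
Proof. by move=> u; apply: l2_ext => n /=; ring. Qed.
Fact l2_scaleDr : right_distributive l2_scale +%R.
Proof. by move=> c u v; apply: l2_ext => n /=; ring. Qed.
Fact l2_scaleDl v : {morph l2_scale^~ v : a b / a + b}.
Proof. by move=> a b; apply: l2_ext => n /=; ring. Qed.
HB.instance Definition _ := GRing.Zmodule_isLmodule.Build R l2
  l2_scaleA l2_scale1 l2_scaleDr l2_scaleDl.

Implicit Types (u v w : l2) (c : R).

Lemma l2DE (u v : l2) n : (u + v) n = u n + v n. Proof. by []. Qed.
Lemma l2ZE c (u : l2) n : (c *: u) n = c * u n. Proof. by []. Qed.
Lemma l2NE (u : l2) n : (- u) n = - u n. Proof. by rewrite -mulN1r. Qed.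
Lemma l2BE (u v : l2) n : (u - v) n = u n - v n. Proof. by rewrite l2DE l2NE. Qed.

Definition ldot (u v : l2) : R := l2dot u v.

Lemma ldotC u v : ldot u v = ldot v u.
Proof. by congr zsum; apply: funext => n; rewrite mulrC. Qed.

Lemma ldotDl u v w : ldot (u + v) w = ldot u w + ldot v w.
Proof.
rewrite /ldot /l2dot -zsumD; last 2 first.
- exact: cvg_l2dot (l2P u) (l2P w).
- exact: cvg_l2dot (l2P v) (l2P w).
by congr zsum; apply: funext => n; rewrite mulrDl.
Qed.

Lemma ldotZl c u v : ldot (c *: u) v = c * ldot u v.
Proof.
rewrite /ldot /l2dot -zsumZ; last exact: cvg_l2dot (l2P u) (l2P v).
by congr zsum; apply: funext => n; rewrite mulrA.
Qed.

Lemma l2norm2E (u : zseq R) : l2norm2 u = l2dot u u.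
Proof. by congr zsum; apply: funext => n; rewrite expr2. Qed.

Lemma ldot_ge0 u : 0 <= ldot u u.
Proof.
rewrite /ldot -l2norm2E; have := zbnd_ge0 _ _ _ (zbnd_l2norm2 _ _ (l2P u)); exact.
Qed.

Lemma ldot_coord u n : u n ^+ 2 <= ldot u u.
Proof.
rewrite /ldot -l2norm2E.
by apply: (@zbnd_mem R (fun n => u n ^+ 2)) (zbnd_l2norm2 _ _ (l2P u)) => k; exact: sqr_ge0.
Qed.

Lemma ldot_eq0 u : ldot u u = 0 -> u = 0.
Proof.
move=> u0; apply: l2_ext => n; apply/eqP.
have := ldot_coord u n; rewrite u0 => h.
by rewrite -sqrf_eq0 eq_le h sqr_ge0.
Qed.

Lemma ldot_le (u : l2) c : zbnd R (fun n => u n ^+ 2) c -> ldot u u <= c.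
Proof. by rewrite /ldot -l2norm2E; exact: l2norm2_le. Qed.

Lemma cvg_zpart_ptw (F : nat -> zseq R) (f : zseq R) N :
  (forall n, F ^~ n @ \oo --> f n) -> (fun j => zpart (F j) N) @ \oo --> zpart f N.
Proof.
move=> Ff; elim: N => [|N IH].
  by under eq_fun do rewrite zpart0; rewrite zpart0; apply: cvg_cst.
under eq_fun do rewrite zpartS; rewrite zpartS.
by apply: cvgD => //; apply: cvgD.
Qed.

(** Coordinates converge, and the Cauchy bound passes to the coordinatewise limit on each finite
    partial sum, hence to the series. *)
Lemma l2_complete x : l2cauchy _ _ ldot x -> exists l, l2lim _ _ ldot x l.
Proof.
move=> xc.
have cx n : cvgn (fun m => x m n).
  apply/cauchy_cvgP/cauchy_exP => e e0.
  have [N HN] := xc ((e / 2) ^+ 2) (exprn_gt0 _ (divr_gt0 e0 (ltr0n _ 2))).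
  exists (x N n); exists N => // m /= Nm.
  rewrite /ball /= /ball_ /=.
  have := le_trans (ldot_coord _ n) (HN N m (leqnn _) Nm); rewrite l2BE.
  move=> h; have : `|x N n - x m n| <= e / 2.
    rewrite -(ler_pXn2r (isT : (0 < 2)%N)) ?nnegrE//; last by lra.
    by rewrite real_normK ?num_real.
  by lra.
pose l n := limn (fun m => x m n).
have bd e : 0 < e -> exists N, forall m, (N <= m)%N -> zbnd R (fun n => (x m n - l n) ^+ 2) e.
  move=> /xc[N HN]; exists N => m Nm k.
  have cv : (fun j => zpart (fun n => (x m n - x j n) ^+ 2) k) @ \oo -->
            zpart (fun n => (x m n - l n) ^+ 2) k.
    apply: cvg_zpart_ptw => n; rewrite expr2.
    under eq_fun do rewrite expr2.
    by apply: cvgM; apply: cvgB; [exact: cvg_cst | exact: cx | exact: cvg_cst | exact: cx].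
  rewrite -(cvg_lim _ cv)//; apply: limr_le; first by apply/cvg_ex; eexists; exact: cv.
  exists N => // j /= Nj.
  apply: le_trans _ (HN m j Nm Nj); rewrite /ldot -l2norm2E.
  apply: le_trans _ (zbnd_l2norm2 _ _ (l2P _) k).
  by apply: le_zpart => n; rewrite l2BE.
have lP : in_l2 l.
  have [N /(_ N (leqnn _)) HN] := bd 1 ltr01.
  have h := zbnd_in_l2 _ _ _ HN.
  have := in_l2D _ _ _ (l2P (x N)) (in_l2Z _ (-1) _ h).
  by congr in_l2; apply: funext => n; ring.
exists (L2 l lP) => e /bd[N HN]; exists N => m /HN h.
by apply: ldot_le; move: h; congr zbnd; apply: funext => n; rewrite l2BE.
Qed.

(** The summable majorant makes the boundary terms of [zpart_shift] tend to 0. *)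
Lemma zsum_shift1 (f g : zseq R) : (forall n, `|f n| <= g n) -> cvgn (zpart g) ->
  cvgn (zpart f) -> zsum (fun n => f (n + 1)) = zsum f.
Proof.
move=> fg cg cf.
have tail := zpart_tail R g (fun n => le_trans (normr_ge0 _) (fg n)) cg.
have c0 : (fun N : nat => f N%:Z - f (- N%:Z)) @ \oo --> (0 : R).
  apply/cvgrPdist_lt => e e0; have [N HN] := tail (e / 2) ltac:(lra).
  exists N => // n /= Nn; rewrite sub0r normrN.
  apply: le_lt_trans (ler_normB _ _) _.
  have := fg n%:Z; have := fg (- n%:Z); have := HN n%:Z ltac:(lia); have := HN (- n%:Z) ltac:(lia).
  lra.
apply: cvg_lim => //.
have -> : zpart (fun n => f (n + 1)) = (fun N => zpart f N + (f N%:Z - f (- N%:Z))).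
  by apply: funext => N; rewrite zpart_shift.
by rewrite -[X in _ --> X]addr0; apply: cvgD.
Qed.

Lemma l2dot_shift (u v : zseq R) : in_l2 u -> in_l2 v ->
  l2dot (fun n => u (n - 1)) v = l2dot u (fun n => v (n + 1)).
Proof.
move=> lu lv; rewrite /l2dot.
have := @zsum_shift1 (fun n => u (n - 1) * v n) (fun n => u (n - 1) ^+ 2 + v n ^+ 2).
have lu1 := in_l2_shift _ _ (-1) lu.
move=> <-; first by congr zsum; apply: funext => n; rewrite addrK.
- move=> n; rewrite ler_norml.
  have := sqr_ge0 (u (n - 1) + v n); have := sqr_ge0 (u (n - 1) - v n).
  have := sqr_ge0 (u (n - 1)); have := sqr_ge0 (v n).
  by nra.
- by apply: cvg_zpartD => //; exact: lu1.
- exact: cvg_l2dot.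
Qed.

Lemma zbnd_Jop (a u : zseq R) K c : (forall n, `|a n| <= K) ->
  zbnd R (fun n => u n ^+ 2) c -> zbnd R (fun n => Jop a u n ^+ 2) (4 * K ^+ 2 * c).
Proof.
move=> aK uc.
have u0 n : 0 <= u n ^+ 2 by exact: sqr_ge0.
have := zbndZ _ _ _ (2 * K ^+ 2) _ (zbndD _ _ _ _ _
   (zbnd_shift _ _ _ (-1) u0 uc) (zbnd_shift _ _ _ 1 u0 uc)).
have K0 : 0 <= 2 * K ^+ 2 by rewrite mulr_ge0// sqr_ge0.
move=> /(_ K0); apply: zbnd_le; last by lra.
move=> n; rewrite /Jop.
have sq m : a m ^+ 2 <= K ^+ 2.
  by rewrite -[a m ^+ 2]real_normK ?num_real// lerXn2r ?nnegrE// (le_trans _ (aK m)).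
have h x m : (a m * x) ^+ 2 <= K ^+ 2 * x ^+ 2 by rewrite exprMn ler_wpM2r ?sqr_ge0.
have := h (u (n - 1)) (n - 1); have := h (u (n + 1)) n.
have := sqr_ge0 (a (n - 1) * u (n - 1) - a n * u (n + 1)).
lra.
Qed.

Definition zbounded (a : zseq R) := exists K, forall n, `|a n| <= K.

Lemma in_l2_Jop (a u : zseq R) : zbounded a -> in_l2 u -> in_l2 (Jop a u).
Proof.
move=> [K aK] /in_l2P[c uc]; apply/in_l2P.
by exists (4 * K ^+ 2 * c); apply: zbnd_Jop.
Qed.

Lemma l2dot_Jop_sym (a u v : zseq R) : zbounded a -> in_l2 u -> in_l2 v ->
  l2dot (Jop a u) v = l2dot u (Jop a v).
Proof.
move=> [K aK] lu lv.
have lau := in_l2M _ _ _ _ aK lu; have lav := in_l2M _ _ _ _ aK lv.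
have lu1 := in_l2_shift _ _ 1 lu; have lv1 := in_l2_shift _ _ 1 lv.
have e1 : l2dot (Jop a u) v = l2dot (fun n => a n * u n) (fun n => v (n + 1)) +
   l2dot (fun n => a n * v n) (fun n => u (n + 1)).
  rewrite -(l2dot_shift (fun n => a n * u n))// /l2dot -zsumD.
  - by congr zsum; apply: funext => n; rewrite /Jop; ring.
  - by apply: cvg_l2dot => //; exact: (in_l2_shift _ _ (-1) lau).
  - exact: cvg_l2dot.
have e2 : l2dot u (Jop a v) = l2dot (fun n => a n * v n) (fun n => u (n + 1)) +
   l2dot (fun n => a n * u n) (fun n => v (n + 1)).
  rewrite -(l2dot_shift (fun n => a n * v n))// /l2dot -zsumD.
  - by congr zsum; apply: funext => n; rewrite /Jop; ring.
  - by apply: cvg_l2dot => //; exact: (in_l2_shift _ _ (-1) lav).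
  - exact: cvg_l2dot.
by rewrite e1 e2 addrC.
Qed.

Lemma JopB (a b u : zseq R) n : Jop a u n - Jop b u n = Jop (fun n => a n - b n) u n.
Proof. by rewrite /Jop; ring. Qed.

Section Operator.
Variables (a : zseq R) (a_bnd : zbounded a) (E : R).

Fact in_l2_Jshift (u : zseq R) : in_l2 u -> in_l2 (fun n => Jop a u n - E * u n).
Proof.
move=> lu; have := in_l2D _ _ _ (in_l2_Jop _ _ a_bnd lu) (in_l2Z _ (- E) _ lu).
by congr in_l2; apply: funext => n; ring.
Qed.

Definition Jshift (u : l2) : l2 := L2 _ (in_l2_Jshift u (l2P u)).

Fact Jshift_is_linear : linear Jshift.
Proof. by move=> c u v; apply: l2_ext => n /=; rewrite /Jop /=; ring. Qed.
HB.instance Definition _ := GRing.isLinear.Build R l2 l2 _ Jshift Jshift_is_linear.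

Lemma Jshift_sym u v : ldot (Jshift u) v = ldot u (Jshift v).
Proof.
have dr c w : ldot u (w + c *: u) = ldot u w + c * ldot u u.
  by rewrite ldotC ldotDl ldotZl !(ldotC _ u).
have dr2 c w z : ldot w (z + c *: v) = ldot w z + c * ldot w v.
  by rewrite ldotC ldotDl ldotZl !(ldotC _ w).
pose J w : l2 := L2 _ (in_l2_Jop _ _ a_bnd (l2P w)).
have JE w : Jshift w = J w + (- E) *: w.
  by apply: l2_ext => n; rewrite l2DE l2ZE /= mulNr.
rewrite !JE dr2 ldotDl ldotZl; congr (_ + _).
exact: l2dot_Jop_sym (l2P u) (l2P v).
Qed.

Lemma Jshift_bnd : exists2 K, 0 < K & forall u, ldot (Jshift u) (Jshift u) <= K * ldot u u.
Proof.
have [K aK] := a_bnd.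
exists (2 * (4 * K ^+ 2) + 2 * E ^+ 2 + 1).
  by have := sqr_ge0 K; have := sqr_ge0 E; lra.
move=> u; apply: ldot_le.
have ub := zbnd_l2norm2 _ _ (l2P u); rewrite l2norm2E in ub.
have := zbndD _ _ _ _ _ (zbndZ _ _ _ 2 _ (zbnd_Jop _ _ _ _ aK ub))
   (zbndZ _ _ _ (2 * E ^+ 2) _ ub).
have E0 := sqr_ge0 E; have u0 := ldot_ge0 u.
move=> /(_ ltac:(lra) ltac:(lra)); apply: zbnd_le; last first.
  by rewrite /ldot in u0 *; nra.
move=> n /=; have := sqr_ge0 (Jop a u n + E * u n); rewrite -subr_ge0 => h.
by rewrite -subr_ge0; apply: le_trans h _; lra.
Qed.

End Operator.

End L2Space.

(** * Resolvent set and spectrum *)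

Section Resolvent.
Variable R : realType.
Implicit Types (a u v : zseq R) (E C K e : R).

(** The bound is on squared norms, and [C] stays a parameter so that it can be made uniform over
    many energies and followed under perturbation. *)
Definition bounded_below a E C := forall u, in_l2 u ->
  l2norm2 u <= C * l2norm2 (fun n => Jop a u n - E * u n).

Definition no_eigenvalue a E := forall u, in_l2 u ->
  (forall n, Jop a u n - E * u n = 0) -> forall n, u n = 0.

Lemma l2norm2_ge0 u : in_l2 u -> 0 <= l2norm2 u.
Proof. by move=> /zbnd_l2norm2/zbnd_ge0. Qed.

Lemma bounded_below_leC a E C C' : zbounded R a -> C <= C' ->
  bounded_below a E C -> bounded_below a E C'.
Proof.
move=> aK CC H u lu; apply: le_trans (H u lu) _.
by rewrite ler_wpM2r// l2norm2_ge0//; apply: in_l2_Jshift.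
Qed.

(** Self-adjointness makes a lower bound imply surjectivity, so from here on the resolvent set is
    handled through lower bounds only. *)
Lemma in_resolventP a E : zbounded R a ->
  in_resolvent a E <-> exists2 C, 0 < C & bounded_below a E C.
Proof.
move=> aK; split=> [[_ [_ [C HC]]]|[C C0 HC]].
  exists (`|C| + 1); first by have := normr_ge0 C; lra.
  apply: (@bounded_below_leC _ _ C) => //.
  by have := ler_norm C; lra.
pose B : {linear l2 R -> l2 R} := Jshift R a aK E.
have HB (v : l2 R) : ldot R v v <= C * ldot R (B v) (B v).
  by have := HC v (l2P _ v); rewrite !l2norm2E.
have [K K0 HK] := Jshift_bnd R a aK E.
split=> [f lf|].
  have [u uf] := @bounded_below_surj R (l2 R) (ldot R) (@ldotC R) (@ldotDl R) (@ldotZl R)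
    (@ldot_ge0 R) (@ldot_eq0 R) (@l2_complete R) B K K0 (@Jshift_sym R a aK E) HK C (L2 R f lf) C0 HB.
  by exists u; split; [exact: l2P | move=> n; rewrite -[f]/(l2val R (L2 R f lf)) -uf].
split=> [u lu Eu n|]; last by exists C.
have lf : in_l2 (fun n => Jop a u n - E * u n) := in_l2_Jshift R a aK E u lu.
have /(congr1 (fun w : l2 R => w n)) : L2 R u lu = 0 :> l2 R; last by [].
apply: ldot_eq0; apply/eqP; rewrite eq_le ldot_ge0 andbT.
apply: le_trans (HB _) _; rewrite (_ : B _ = 0); last by apply: l2_ext.
have -> : ldot R 0 0 = 0 by rewrite -(scale0r (0 : l2 R)) ldotZl mul0r.
by rewrite mulr0.
Qed.

Lemma l2norm2D_le u v : in_l2 u -> in_l2 v ->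
  l2norm2 (fun n => u n + v n) <= 2 * l2norm2 u + 2 * l2norm2 v.
Proof.
move=> /zbnd_l2norm2 hu /zbnd_l2norm2 hv; apply: l2norm2_le.
apply: zbnd_le (lexx _) (zbndD _ _ _ _ _ (zbndZ _ _ _ 2 _ hu) (zbndZ _ _ _ 2 _ hv)) => //.
by move=> n /=; have := sqr_ge0 (u n - v n); rewrite -subr_ge0 => h; rewrite -subr_ge0; lra.
Qed.

Lemma l2norm2_Jop a u K : in_l2 u -> (forall n, `|a n| <= K) ->
  l2norm2 (Jop a u) <= 4 * K ^+ 2 * l2norm2 u.
Proof. by move=> /zbnd_l2norm2 hu aK; apply: l2norm2_le; apply: zbnd_Jop. Qed.

Lemma l2norm2Z E u : in_l2 u -> l2norm2 (fun n => E * u n) = E ^+ 2 * l2norm2 u.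
Proof.
move=> lu; rewrite /l2norm2 -zsumZ//; congr zsum; apply: funext => n; exact: exprMn.
Qed.

(** The perturbation has squared norm at most [8 r^2 + 2 s^2]; the smallness condition lets it be
    absorbed into half of [l2norm2 u], which with one splitting of a square turns [C] into
    [4 * C]. *)
Lemma bounded_below_perturb a a' E E' r s C : zbounded R a -> 0 <= C ->
  (forall n, `|a n - a' n| <= r) -> `|E - E'| <= s -> 2 * C * (8 * r ^+ 2 + 2 * s ^+ 2) <= 2^-1 ->
  bounded_below a E C -> bounded_below a' E' (4 * C).
Proof.
move=> aK C0 aa' EE' small H u lu.
have dK : zbounded R (fun n => a n - a' n) by exists r.
have a'K : zbounded R a'.
  have [K hK] := aK; exists (K + r) => n.
  have := hK n; have := aa' n; have := ler_normB (a n) (a n - a' n).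
  by rewrite opprB addrC subrK; lra.
set f := fun n => Jop a' u n - E' * u n.
have lf : in_l2 f by exact: in_l2_Jshift.
pose d := fun n => Jop (fun n => a n - a' n) u n + (E' - E) * u n.
have lJ : in_l2 (Jop (fun n => a n - a' n) u) by exact: in_l2_Jop.
have lE : in_l2 (fun n => (E' - E) * u n) by exact: in_l2Z.
have ld : in_l2 d by exact: in_l2D.
have e1 : (fun n => Jop a u n - E * u n) = (fun n => f n + d n).
  by apply: funext => n; rewrite /f /d -JopB; ring.
have h1 := H u lu; rewrite e1 in h1.
have h2 := l2norm2D_le _ _ lf ld.
have h3 := l2norm2D_le _ _ lJ lE; rewrite -/d in h3.
have h4 := l2norm2_Jop _ _ _ lu aa'.
have h5 := l2norm2Z (E' - E) _ lu.
have h6 : (E' - E) ^+ 2 <= s ^+ 2.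
  rewrite -[leLHS]real_normK ?num_real// distrC lerXn2r ?nnegrE//.
  exact: le_trans (normr_ge0 _) EE'.
have u0 := l2norm2_ge0 _ lu.
have h7 : l2norm2 d <= (8 * r ^+ 2 + 2 * s ^+ 2) * l2norm2 u.
  by apply: le_trans h3 _; rewrite h5; nra.
have h8 : 2 * C * l2norm2 d <= 2^-1 * l2norm2 u.
  apply: (@le_trans _ _ (2 * C * (8 * r ^+ 2 + 2 * s ^+ 2) * l2norm2 u)).
    by rewrite -[leRHS]mulrA ler_wpM2l//; lra.
  by rewrite ler_wpM2r.
have : l2norm2 u <= 2 * C * l2norm2 f + 2 * C * l2norm2 d.
  apply: le_trans h1 _; have := ler_wpM2l C0 h2; lra.
lra.
Qed.

Lemma bounded_below_open a E C : zbounded R a -> 0 < C -> bounded_below a E C ->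
  exists2 r, 0 < r & forall a' E', (forall n, `|a n - a' n| <= r) -> `|E - E'| <= r ->
    bounded_below a' E' (4 * C).
Proof.
move=> aK C0 H.
(* With [r = s = x] the condition reads [20 * C * x^2 <= 1/2], and here [C * x <= 1/40] and
   [x <= 1]. *)
pose x := (40 * (1 + C))^-1.
have x0 : 0 < x by rewrite invr_gt0; lra.
have xC : 40 * (x + C * x) = 1 by rewrite /x; field; lra.
exists x => // a' E' h1 h2; apply: bounded_below_perturb h1 h2 _ H => //; first exact: ltW.
have : C * x <= 40^-1 by nra.
have : x <= 1 by nra.
by nra.
Qed.

(** Write [E u = J u - (J - E) u]: the square of [E] exceeds [8 K^2], twice the bound for the square
    of [J], by at least 1. *)
Lemma bounded_below_far a E K : (forall n, `|a n| <= K) -> 4 * K + 1 <= `|E| ->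
  bounded_below a E 2.
Proof.
move=> aK EK u lu.
have aB : zbounded R a by exists K.
have K0 : 0 <= K := le_trans (normr_ge0 _) (aK 0).
have lf : in_l2 (fun n => - (Jop a u n - E * u n)).
  have := in_l2Z _ (-1) _ (in_l2_Jshift R a aB E u lu).
  by congr in_l2; apply: funext => n; ring.
have h1 := l2norm2D_le _ _ (in_l2_Jop _ _ _ aB lu) lf.
have h2 := l2norm2_Jop _ _ _ lu aK.
have e1 : (fun n => Jop a u n - (Jop a u n - E * u n)) = (fun n => E * u n).
  by apply: funext => n; ring.
rewrite e1 l2norm2Z// in h1.
have e2 : l2norm2 (fun n => - (Jop a u n - E * u n)) = l2norm2 (fun n => Jop a u n - E * u n).
  by congr zsum; apply: funext => n; rewrite sqrrN.
rewrite e2 in h1.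
have h3 : (4 * K + 1) ^+ 2 <= E ^+ 2.
  by rewrite -[leRHS]real_normK ?num_real// lerXn2r ?nnegrE//; lra.
have := l2norm2_ge0 _ lu; nra.
Qed.

Lemma in_resolvent_open a E : zbounded R a -> in_resolvent a E ->
  exists2 r, 0 < r & forall E', `|E - E'| <= r -> in_resolvent a E'.
Proof.
move=> aK /(in_resolventP _ _ aK)[C C0 /(bounded_below_open _ _ _ aK C0)[r r0 Hr]].
exists r => // E' EE'; apply/in_resolventP => //; exists (4 * C); first lra.
by apply: Hr => // n; rewrite subrr normr0 ltW.
Qed.

Lemma spectrum_closed a : zbounded R a -> closed (spectrum a).
Proof.
move=> aK; rewrite -[spectrum a]setCK; apply: open_closedC.
rewrite openE => E /contrapT /(in_resolvent_open _ _ aK)[r r0 Hr].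
rewrite /interior -nbhs_ballE; exists r => //= E' EE'; apply; apply: Hr.
exact: ltW.
Qed.

Lemma spectrum_compact a : zbounded R a -> compact (spectrum a).
Proof.
move=> aB; have [K aK] := aB.
apply: (subclosed_compact (spectrum_closed _ aB) (@segment_compact _ (- (4 * K + 1)) (4 * K + 1))).
move=> E sE; rewrite /= in_itv /= -ler_norml leNgt; apply/negP => /ltW EK; apply: sE.
by apply/in_resolventP => //; exists 2 => //; exact: bounded_below_far aK _.
Qed.

(* Spectral gaps on both sides of [E] amount to invertibility of [(J - E)^2 - z] for small [z > 0]. *)
Lemma spectrum_not_isolated a E e : zbounded R a -> no_eigenvalue a E -> spectrum a E -> 0 < e ->
  exists2 y, spectrum a y & y != E /\ `|y - E| < e.
Proof.
move=> aK noE sE e0; apply: contrapT => none.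
have res y : y != E -> `|y - E| < e -> in_resolvent a y.
  by move=> yE ye; apply: contrapT => sy; apply: none; exists y.
apply: sE; apply/in_resolventP => //.
pose B : {linear l2 R -> l2 R} := Jshift R a aK E.
have [K K0 HK] := Jshift_bnd R a aK E.
pose b := (e / 2) ^+ 2.
have b0 : 0 < b by rewrite exprn_gt0// divr_gt0.
have ker0 (v : l2 R) : B v = 0 -> v = 0.
  move=> Bv; apply: l2_ext => n; apply: noE; first exact: l2P.
  by move=> k; have /(congr1 (fun w : l2 R => w k)) := Bv.
exists (4 / b) => [|u lu]; first by rewrite divr_gt0.
rewrite mulrAC ler_pdivlMr// mulrC !l2norm2E.
apply: (@gap_bounded_below R (l2 R) (ldot R) (@ldotC R) (@ldotDl R) (@ldotZl R)
    (@ldot_ge0 R) (@ldot_eq0 R) (@l2_complete R) B K K0 (@Jshift_sym R a aK E) HK b b0 ker0 _ (L2 R u lu)).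
move=> z /andP[z0 zb].
pose s := Num.sqrt z.
have s0 : 0 < s by rewrite sqrtr_gt0.
have se : s < e.
  have : s <= Num.sqrt b by exact: ler_wsqrtr.
  by rewrite sqrtr_sqr ger0_norm; lra.
have ss : s ^+ 2 = z by rewrite sqr_sqrtr// ltW.
have [C1 C10 H1] : exists2 C, 0 < C & bounded_below a (E + s) C.
  apply/in_resolventP => //; apply: res; first by rewrite -subr_eq0 addrC addKr gt_eqF.
  by rewrite addrC addKr ger0_norm// ltW.
have [C2 C20 H2] : exists2 C, 0 < C & bounded_below a (E - s) C.
  apply/in_resolventP => //; apply: res; first by rewrite -subr_eq0 addrC addKr oppr_eq0 gt_eqF.
  by rewrite addrC addKr normrN ger0_norm// ltW.
exists (C2 * C1) => [|v]; first exact: mulr_gt0.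
have := H2 v (l2P _ v); rewrite !l2norm2E => h2.
have := H1 (Jshift R a aK (E - s) v) (l2P _ _); rewrite !l2norm2E => h1.
apply: le_trans h2 _; rewrite -mulrA ler_pM2l//; apply: le_trans h1 _.
rewrite ler_pM2l//.
have -> : (fun n => Jop a (Jshift R a aK (E - s) v) n - (E + s) * Jshift R a aK (E - s) v n) =
          shifted_square R (l2 R) B z v.
  apply: funext => n; rewrite /shifted_square l2BE l2ZE -ss /= /Jop /=; rewrite /Jop.
  by ring.
exact: lexx.
Qed.

End Resolvent.

(** * Spectral measures *)

Section MeasureFacts.
Variables (R : realType) (mu : {measure set (measurableTypeR R) -> \bar R}).

Lemma integral_lin3 (g0 g1 g2 : R -> R) (c0 c1 c2 r0 r1 r2 : R) :
  mu.-integrable setT (EFin \o g0) -> mu.-integrable setT (EFin \o g1) ->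
  mu.-integrable setT (EFin \o g2) ->
  (\int[mu]_x (g0 x)%:E = r0%:E)%E -> (\int[mu]_x (g1 x)%:E = r1%:E)%E ->
  (\int[mu]_x (g2 x)%:E = r2%:E)%E ->
  mu.-integrable setT (fun x => (c0 * g0 x + c1 * g1 x + c2 * g2 x)%:E) /\
  (\int[mu]_x (c0 * g0 x + c1 * g1 x + c2 * g2 x)%:E = (c0 * r0 + c1 * r1 + c2 * r2)%:E)%E.
Proof.
move=> i0 i1 i2 e0 e1 e2.
have j0 := integrableZl measurableT c0 i0.
have j1 := integrableZl measurableT c1 i1.
have j2 := integrableZl measurableT c2 i2.
have j01 := integrableD measurableT j0 j1.
have j := integrableD measurableT j01 j2.
split; first by apply: eq_integrable j => // x _; rewrite /= !EFinD !EFinM.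
under eq_integral do rewrite !EFinD !EFinM.
rewrite integralD// integralD// !integralZl// e0 e1 e2.
by rewrite !EFinD !EFinM.
Qed.

Lemma measure_le_integral (g : R -> R) (A : set (measurableTypeR R)) (c r : R) :
  measurable A -> mu.-integrable setT (EFin \o g) -> (forall x, 0 <= g x) -> 0 <= c ->
  (forall x, A x -> c <= g x) -> (\int[mu]_x (g x)%:E = r%:E)%E ->
  (c%:E * mu A <= r%:E)%E.
Proof.
move=> mA ig g0 c0 cg <-.
have mg := measurable_int mu ig.
rewrite -integral_cst//.
apply: (@le_trans _ _ (\int[mu]_(x in A) (g x)%:E)%E).
  by apply: ge0_le_integral => //; apply: measurable_funS mg.
by apply: (ge0_subset_integral mu mA measurableT mg) => // x _; rewrite /= lee_fin.
Qed.

Lemma measurable_rball (x r : R) : measurable (ball x r : set (measurableTypeR R)).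
Proof. by rewrite ball_itv; exact: measurable_itv. Qed.

(** Lindelöf's argument: each point lies in a null ball with rational centre and radius
    [1 / (k + 1)], and [unpickle] enumerates these balls. *)
Lemma locally_null_null (U : set (measurableTypeR R)) : measurable U ->
  (forall x : R, U x -> exists2 r : R, 0 < r & mu (ball x r) = 0%E) -> mu U = 0%E.
Proof.
move=> mU loc.
pose W (i : nat) : set R := if unpickle i is Some (p, k) then
  if `[< mu (ball (ratr p : R) k.+1%:R^-1) = 0%E >] then ball (ratr p : R) k.+1%:R^-1 else set0
  else set0.
have W0 i : mu.-negligible (W i).
  rewrite /W; case: unpickle => [[p k]|]; last exact: negligible_set0.
  case: asboolP => [h|_]; last exact: negligible_set0.
  by apply/negligibleP => //; exact: measurable_rball.
apply: measure_negligible => //; apply: negligibleS (negligible_bigcup W0).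
move=> x /loc[r r0 xr].
have [k kr] : exists k : nat, k.+1%:R^-1 < r / 2.
  have : (r / 2)^-1 < (Num.truncn (r / 2)^-1).+1%:R by exact: truncnS_gt.
  move=> h; exists (Num.truncn (r / 2)^-1).
  by rewrite invf_plt ?posrE ?divr_gt0.
have k0 : 0 < k.+1%:R^-1 :> R by rewrite invr_gt0.
set d : R := k.+1%:R^-1 in kr k0 *.
have xk : x < x + d by rewrite ltrDl.
have [p] := rat_in_itvoo xk.
rewrite in_itv /= => /andP[xp px].
have xp_ball : ball (ratr p : R) d x.
  rewrite -ball_normE /ball_ /= ger0_norm ?subr_ge0 ?ltrBlDl//; exact: ltW.
exists (pickle (p, k)); first exact: I.
rewrite /W pickleK -/d; case: asboolP => [//|]; case.
 apply: (@subset_measure0 _ _ _ mu _ (ball x r)) => //; try exact: measurable_rball.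
move=> y; rewrite -!ball_normE /ball_ /= => yp.
have : `|x - y| <= `|ratr p - y| + `|x - ratr p|.
  by have := ler_normD (ratr p - y) (x - ratr p); rewrite addrC addrA subrK.
have : `|x - ratr p| <= d by rewrite ler_norml; lra.
lra.
Qed.

End MeasureFacts.

(** * Spectral measures tested against powers of [1 - (x - E)^2 / K] *)

Section SpectralMeasure.
Variables (R : realType) (a : zseq R) (aK : zbounded R a).
Variables (psi1 psi2 : l2 R) (mu : {measure set (measurableTypeR R) -> \bar R}).
Hypothesis mu_spec : is_spectral_measure a psi1 psi2 mu.

Let J (u : l2 R) : l2 R := L2 R _ (in_l2_Jop R _ _ aK (l2P R u)).

Let iterJE n (u : l2 R) : iter n (Jop a) u = iter n J u.
Proof. by elim: n => //= n ->. Qed.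

Section Point.
Variable E : R.
Let B : {linear l2 R -> l2 R} := Jshift R a aK E.
Variable K : R.
Local Notation Q := (richardson R (l2 R) B K).

(** One factor [1 - K^-1 (x - E)^2] is quadratic in [x], so step [m + 1] at [n] combines step [m] at
    [n], [n + 1] and [n + 2]. The extra power [x^n] is there to close this induction. *)
Lemma richardson_moments m n :
  mu.-integrable setT (fun x : R => ((1 - K^-1 * (x - E) ^+ 2) ^+ m * x ^+ n)%:E) /\
  (\int[mu]_x ((1 - K^-1 * ((x : R) - E) ^+ 2) ^+ m * x ^+ n)%:E =
    (ldot R psi1 (iter m Q (iter n J psi1)) + ldot R psi2 (iter m Q (iter n J psi2)))%:E)%E.
Proof.
elim: m n => [|m IH] n.
  have [_ /(_ n)[h1 h2]] := mu_spec; split.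
    by apply: eq_integrable h1 => // x _; rewrite expr0 mul1r.
  under eq_integral do rewrite expr0 mul1r.
  by rewrite h2 !iterJE.
have [i0 e0] := IH n; have [i1 e1] := IH n.+1; have [i2 e2] := IH n.+2.
have [] := @integral_lin3 R mu _ _ _ (1 - K^-1 * E ^+ 2) (2 * K^-1 * E) (- K^-1) _ _ _ i0 i1 i2 e0 e1 e2.
move=> h1 h2; split.
  by apply: eq_integrable h1 => // x _ /=; congr EFin; rewrite !exprS; ring.
have -> : ldot R psi1 (iter m.+1 Q (iter n J psi1)) + ldot R psi2 (iter m.+1 Q (iter n J psi2)) =
  (1 - K^-1 * E ^+ 2) * (ldot R psi1 (iter m Q (iter n J psi1)) + ldot R psi2 (iter m Q (iter n J psi2))) +
  (2 * K^-1 * E) * (ldot R psi1 (iter m Q (iter n.+1 J psi1)) + ldot R psi2 (iter m Q (iter n.+1 J psi2))) +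
  (- K^-1) * (ldot R psi1 (iter m Q (iter n.+2 J psi1)) + ldot R psi2 (iter m Q (iter n.+2 J psi2))).
  have QE w : Q w = (1 - K^-1 * E ^+ 2) *: w + (2 * K^-1 * E) *: J w + (- K^-1) *: J (J w).
    by apply: l2_ext => k; rewrite /richardson !l2BE !l2DE !l2ZE /= /Jop /= /Jop; ring.
  have step w z : ldot R z (iter m.+1 Q w) = (1 - K^-1 * E ^+ 2) * ldot R z (iter m Q w) +
      (2 * K^-1 * E) * ldot R z (iter m Q (J w)) + (- K^-1) * ldot R z (iter m Q (J (J w))).
    have iterZ c u : iter m Q (c *: u) = c *: iter m Q u.
      by elim: m {IH i0 i1 i2 e0 e1 e2 h1 h2} => //= k ->; rewrite richardsonZ.
    rewrite iterSr QE !iter_richardsonD !iterZ.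
    by rewrite ldotC !ldotDl !ldotZl !(ldotC R _ z).
  by rewrite !step -!iterS; ring.
by rewrite -h2; apply: eq_integral => x _; congr EFin; rewrite !exprS; ring.
Qed.

(** The even exponent serves twice: the integrand is nonnegative on the whole line, and symmetry of
    [Q] makes the integral a sum of squared norms. *)
Lemma richardson_integral m :
  mu.-integrable setT (fun x : R => ((1 - K^-1 * (x - E) ^+ 2) ^+ m.*2)%:E) /\
  (\int[mu]_x ((1 - K^-1 * ((x : R) - E) ^+ 2) ^+ m.*2)%:E =
    (ldot R (iter m Q psi1) (iter m Q psi1) + ldot R (iter m Q psi2) (iter m Q psi2))%:E)%E.
Proof.
have [h1 h2] := richardson_moments m.*2 0; split.
  by apply: eq_integrable h1 => // x _; rewrite expr0 mulr1.
have e u : ldot R (iter m Q u) (iter m Q u) = ldot R u (iter m.*2 Q u).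
  rewrite (iter_richardson_sym R (l2 R) (ldot R) (@ldotC R) (@ldotDl R) (@ldotZl R) B K (Jshift_sym R a aK E)).
  by rewrite -iterD addnn.
by rewrite !e -[in RHS]h2; apply: eq_integral => x _; rewrite expr0 mulr1.
Qed.

Lemma spectral_measure_le m (A : set R) c : measurable (A : set (measurableTypeR R)) -> 0 <= c ->
  (forall x, A x -> c <= (1 - K^-1 * (x - E) ^+ 2) ^+ m.*2) ->
  (c%:E * mu A <=
   (ldot R (iter m Q psi1) (iter m Q psi1) + ldot R (iter m Q psi2) (iter m Q psi2))%:E)%E.
Proof.
move=> mA c0 H; have [i e] := richardson_integral m.
apply: measure_le_integral i _ c0 H e => // x.
by rewrite -muln2 exprM sqr_ge0.
Qed.

End Point.

(** The polynomial equals 1 at [E], so the mass of the point is at most the squared norms of the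
    iterates [Q^m psi1] and [Q^m psi2], which tend to 0. *)
Lemma spectral_measure_atomless E : no_eigenvalue R a E -> mu [set E] = 0%E.
Proof.
move=> noE; have [K K0 HK] := Jshift_bnd R a aK E.
pose B : {linear l2 R -> l2 R} := Jshift R a aK E.
have ker0 (v : l2 R) : B v = 0 -> v = 0.
  move=> Bv; apply: l2_ext => n; apply: noE; first exact: l2P.
  by move=> k; have /(congr1 (fun w : l2 R => w k)) := Bv.
have Q0 u := @iter_richardson_lim0 R (l2 R) (ldot R) (@ldotC R) (@ldotDl R) (@ldotZl R)
    (@ldot_ge0 R) (@ldot_eq0 R) (@l2_complete R) B K K0 (@Jshift_sym R a aK E) HK u ker0.
apply/eqP; rewrite eq_le measure_ge0 andbT; apply/lee_addgt0Pr => e e0; rewrite add0e.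
have [N1 H1] := Q0 psi1 _ (divr_gt0 e0 (ltr0n _ 2)).
have [N2 H2] := Q0 psi2 _ (divr_gt0 e0 (ltr0n _ 2)).
have := @spectral_measure_le E K (maxn N1 N2) [set E] 1 (measurable_set1 _) ler01.
rewrite mul1e => H; apply: le_trans (H _) _.
  by move=> x /= ->; rewrite subrr expr0n mulr0 subr0 expr1n.
move: (H1 _ (leq_maxl N1 N2)) (H2 _ (leq_maxr N1 N2)); rewrite !subr0 => h1 h2.
by rewrite lee_fin (splitr e) lerD.
Qed.

(** The integral of the [2m]-th power decays like [(1 - t)^m], while on the ball the power is at
    least [(1 - t / 4)^(2m)]. Since [(1 - t / 4)^2 > 1 - t], the ratio [rho] is below 1 and the mass
    of the ball is 0. *)
Lemma spectral_measure_resolvent E : in_resolvent a E ->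
  exists2 r : R, 0 < r & mu (ball E r) = 0%E.
Proof.
move=> /(in_resolventP _ _ _ aK)[C' C'0 HC'].
have [K K0 HK] := Jshift_bnd R a aK E.
pose B : {linear l2 R -> l2 R} := Jshift R a aK E.
(* Enlarging the constant gives [C * K >= 2], hence [t <= 1/2], which keeps all bases positive. *)
pose C := C' + 2 / K.
have C0 : 0 < C by rewrite addr_gt0// divr_gt0.
have HB (v : l2 R) : ldot R v v <= C * ldot R (B v) (B v).
  have h : bounded_below R a E C by apply: bounded_below_leC HC' => //; rewrite lerDl divr_ge0// ltW.
  by have := h v (l2P _ v); rewrite !l2norm2E.
pose t := (C * K)^-1.
have CK : 2 <= C * K by rewrite /C mulrDl divfK ?gt_eqF// lerDr mulr_ge0// ltW.
have t0 : 0 < t by rewrite invr_gt0; lra.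
have t2 : t <= 2^-1 by rewrite lef_pV2 ?posrE//; lra.
exists (Num.sqrt (K * (t / 4))); first by rewrite sqrtr_gt0 mulr_gt0// divr_gt0.
set r := Num.sqrt _.
have r2 : r ^+ 2 = K * (t / 4) by rewrite sqr_sqrtr// mulr_ge0 ?divr_ge0// ltW.
have r0 : 0 <= r by exact: sqrtr_ge0.
pose rho := (1 - t) / (1 - t / 4) ^+ 2.
have q0 : 0 < (1 - t / 4) ^+ 2 by rewrite exprn_gt0//; lra.
have rho1 : `|rho| < 1.
  rewrite ger0_norm; last by rewrite divr_ge0//; lra.
  by rewrite ltr_pdivrMr// mul1r; nra.
apply/eqP; rewrite eq_le measure_ge0 andbT; apply/lee_addgt0Pr => e e0; rewrite add0e.
pose S := ldot R psi1 psi1 + ldot R psi2 psi2.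
have [m Hm] : exists m, rho ^+ m * S <= e.
  have /cvgrPdist_lt/(_ _ e0)[N _ /(_ N (leqnn _)) HN] :
    (fun n => rho ^+ n * S) @ \oo --> (0 * S : R).
    by apply: cvgM; [exact: cvg_expr | exact: cvg_cst].
  exists N; move: HN; rewrite mul0r sub0r normrN => /ltW; apply: le_trans; exact: ler_norm.
have c0 : 0 < (1 - t / 4) ^+ m.*2 by rewrite exprn_gt0//; lra.
have := @spectral_measure_le E K m (ball E r) _ (measurable_rball _ _ _) (ltW c0).
move=> /(_ _)-H; have {H} := H _.
rewrite -lee_pdivlMl// => H; apply: le_trans (H _) _.
  move=> x; rewrite /ball /= /ball_ /= distrC => xr.
  have h : K^-1 * (x - E) ^+ 2 <= t / 4.
    rewrite ler_pdivrMl// -r2 -[leLHS]real_normK ?num_real//.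
    by rewrite lerXn2r ?nnegrE// ltW.
  have h0 : 0 <= K^-1 * (x - E) ^+ 2 by rewrite mulr_ge0 ?sqr_ge0// invr_ge0 ltW.
  by rewrite lerXn2r ?nnegrE//; lra.
rewrite -EFinM lee_fin; apply: le_trans _ Hm.
have geom u := @iter_richardson_geom R (l2 R) (ldot R) (@ldotC R) (@ldotDl R) (@ldotZl R)
    (@ldot_ge0 R) B K K0 (@Jshift_sym R a aK E) HK C u m C0 HB.
have h1 := geom psi1; have h2 := geom psi2.
have e1 : (1 - t / 4) ^+ m.*2 * rho ^+ m = (1 - t) ^+ m.
  by rewrite /rho expr_div_n -exprM mul2n mulrC divfK ?gt_eqF.
by rewrite ler_pdivrMl// mulrA e1 /S mulrDr lerD.
Qed.

Lemma spectral_measure_supp : mu (~` spectrum a) = 0%E.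
Proof.
apply: (@locally_null_null R mu).
  exact: measurableC (closed_measurable (spectrum_closed R a aK)).
by move=> x; rewrite /= => /contrapT; apply: spectral_measure_resolvent.
Qed.

End SpectralMeasure.

Lemma purely_sc_of_null_spectrum (R : realType) (a : zseq R) : zbounded R a ->
  (forall E, no_eigenvalue R a E) -> lebesgue_measure (spectrum a) = 0%E -> purely_sc a.
Proof.
move=> aK noE null psi1 psi2 l1 l2 mu mu_spec; split.
  move=> x; exact: (@spectral_measure_atomless R a aK (L2 R _ l1) (L2 R _ l2) mu mu_spec).
exists (spectrum a); split; first exact: closed_measurable (spectrum_closed R a aK).
by split => //; exact: (@spectral_measure_supp R a aK (L2 R _ l1) (L2 R _ l2) mu mu_spec).
Qed.

(** * Transfer matrices *)

Section Matrices2.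
Variable R : realType.
Implicit Types A B : 'M[R]_2.

Lemma mulmx2E n A (B : 'M[R]_(2, n)) i j : (A *m B) i j = A i 0 * B 0 j + A i 1 * B 1 j.
Proof.
rewrite mxE !big_ord_recl big_ord0 addr0; congr (_ + A _ _ * B _ _); exact: val_inj.
Qed.

Lemma mxtrace2E A : \tr A = A 0 0 + A 1 1.
Proof.
rewrite /mxtrace !big_ord_recl big_ord0 addr0; congr (_ + A _ _); exact: val_inj.
Qed.

Lemma det2E A : \det A = A 0 0 * A 1 1 - A 0 1 * A 1 0.
Proof.
rewrite (expand_det_row _ 0) !big_ord_recl big_ord0 addr0 /cofactor.
have e0 : lift ord0 ord0 = 1 :> 'I_2 by apply: val_inj.
rewrite !e0 [row' _ _]mx11_scalar [X in _ + _ * (_ * \det X)]mx11_scalar !det_scalar1 !mxE /=.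
have e1 : lift 0 0 = 1 :> 'I_2 by apply: val_inj.
have e2 : lift 1 0 = 0 :> 'I_2 by apply: val_inj.
by rewrite e1 e2 expr0 expr1 mul1r mulN1r mulrN.
Qed.

Lemma ord2P (P : 'I_2 -> Prop) : P 0 -> P 1 -> forall i, P i.
Proof.
move=> P0 P1 [[|[|//]] h].
  by rewrite (_ : Ordinal h = 0)//; exact: val_inj.
by rewrite (_ : Ordinal h = 1)//; exact: val_inj.
Qed.

(* Cayley-Hamilton for determinant one, in the form [A^-1 = tr A - A]. *)
Lemma mulmx_det1 A : \det A = 1 -> A *m ((\tr A)%:M - A) = 1%:M.
Proof.
rewrite det2E => dA; apply/matrixP; apply: ord2P; apply: ord2P;
  by rewrite mulmx2E !mxE mxtrace2E /= ?mulr1n ?mulr0n ?subr0 ?sub0r; lra.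
Qed.

Lemma det1_mulmx A : \det A = 1 -> ((\tr A)%:M - A) *m A = 1%:M.
Proof. by move=> /mulmx_det1/mulmx1C. Qed.

Lemma sqr_det1 A : \det A = 1 -> A *m A = \tr A *: A - 1%:M.
Proof. by move=> /mulmx_det1 <-; rewrite mulmxBr mul_mx_scalar opprB addrCA subrr addr0. Qed.

End Matrices2.

Section Transfer.
Variable R : realType.
Implicit Types (a u f : zseq R) (E K M c : R) (n : int) (k p : nat).

(* One step of [a_n u_(n+1) = E u_n - a_(n-1) u_(n-1)] in the coordinates [(u_(n+1), a_n u_n)],
   which make it unimodular and dependent on the single coefficient [a_n]. *)
Definition tstep a E n : 'M[R]_2 := \matrix_(i, j)
  if i == 0 then if j == 0 then E / a n else - (a n)^-1
  else if j == 0 then a n else 0.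

Definition state a u n : 'cV[R]_2 := \matrix_(i, j) if i == 0 then u (n + 1) else a n * u n.

Definition source a f n : 'cV[R]_2 := \matrix_(i, j) if i == 0 then f n / a n else 0.

Fixpoint transfer a E n k : 'M[R]_2 :=
  if k is j.+1 then tstep a E (n + j.+1%:Z) *m transfer a E n j else 1%:M.

(** The Duhamel term: the state at [n + k] produced by the forcing [f] from the zero state at
    [n]. *)
Fixpoint response a E f n k : 'cV[R]_2 :=
  if k is j.+1 then tstep a E (n + j.+1%:Z) *m response a E f n j + source a f (n + j.+1%:Z)
  else 0.

Lemma det_tstep a E n : a n != 0 -> \det (tstep a E n) = 1.
Proof. by move=> an; rewrite det2E !mxE /=; field. Qed.

Lemma det_transfer a E n k : (forall n, a n != 0) -> \det (transfer a E n k) = 1.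
Proof.
move=> a0; elim: k => [|k IH] /=; first by rewrite det1.
by rewrite det_mulmx IH det_tstep// mulr1.
Qed.

Lemma state_step a E u n : a n != 0 ->
  state a u n = tstep a E n *m state a u (n - 1) + source a (fun n => Jop a u n - E * u n) n.
Proof.
move=> an; apply/matrixP; apply: ord2P => j; rewrite [RHS]mxE mulmx2E !mxE /=.
  by rewrite /Jop subrK; field.
by rewrite subrK; ring.
Qed.

Lemma state_transfer a E u n k : (forall n, a n != 0) ->
  state a u (n + k%:Z) = transfer a E n k *m state a u n +
    response a E (fun n => Jop a u n - E * u n) n k.
Proof.
move=> a0; elim: k => [|k IH] /=; first by rewrite addr0 mul1mx addr0.
rewrite (state_step _ E)// (_ : n + k.+1%:Z - 1 = n + k%:Z); last by lia.
by rewrite IH mulmxDr mulmxA addrA.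
Qed.

Lemma response0 a E f n k : (forall n, f n = 0) -> response a E f n k = 0.
Proof.
move=> f0; elim: k => //= k ->; rewrite mulmx0 add0r.
by apply/matrixP => i j; rewrite !mxE f0 mul0r; case: ifP.
Qed.

Lemma transfer_recr a E n k : transfer a E n k.+1 = transfer a E (n + 1) k *m tstep a E (n + 1).
Proof.
elim: k => [|k IH]; first by rewrite /= mulmx1 mul1mx.
rewrite [LHS]/= -/(transfer a E n k.+1) IH mulmxA /=; congr (tstep _ _ _ *m _ *m _); lia.
Qed.

Lemma eq_transfer a b E n m k : (forall i : nat, (0 < i <= k)%N -> a (n + i%:Z) = b (m + i%:Z)) ->
  transfer a E n k = transfer b E m k.
Proof.
elim: k => //= k IH H; rewrite IH => [|i ik]; last by apply: H; lia.
by congr (_ *m _); apply/matrixP => i j; rewrite !mxE (H k.+1) ?leqnn.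
Qed.

Lemma transferD a E n k l : transfer a E n (k + l) = transfer a E (n + k%:Z) l *m transfer a E n k.
Proof.
elim: l => [|l IH]; first by rewrite addn0 mul1mx.
by rewrite addnS /= IH mulmxA; congr (tstep _ _ _ *m _ *m _); lia.
Qed.

Definition period a p := forall n, a (n + p%:Z) = a n.

Lemma periodM a p k : period a p -> period a (k * p)%N.
Proof.
move=> ap n; elim: k => [|k IH]; first by rewrite mul0n addr0.
by rewrite mulSn (_ : n + _ = n + (k * p)%N%:Z + p%:Z); [rewrite ap IH | lia].
Qed.

Lemma period_opp a p n : period a p -> a (n - p%:Z) = a n.
Proof. by move=> ap; rewrite -[in RHS](subrK p%:Z n) ap. Qed.

Lemma transfer_period a p E n k : period a p -> transfer a E (n + p%:Z) k = transfer a E n k.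
Proof. by move=> ap; apply: eq_transfer => i _; rewrite addrAC ap. Qed.

Lemma transfer_periodM a p E n k : period a p ->
  transfer a E n (k * p) = transfer a E n p ^+ k.
Proof.
move=> ap; elim: k => [|k IH]; first by rewrite mul0n expr0.
rewrite mulSn addnC transferD IH exprS (transfer_period _ (k * p)%N)//.
exact: periodM.
Qed.

(** Moving the base point by one conjugates the transfer matrix over a period by a one-step
    matrix. *)
Lemma trace_transfer a p E n : (forall n, a n != 0) -> period a p ->
  \tr (transfer a E n p) = \tr (transfer a E 0 p).
Proof.
move=> a0 ap.
have step m : \tr (transfer a E (m + 1) p) = \tr (transfer a E m p).
  have h : transfer a E (m + 1) p *m tstep a E (m + 1) = tstep a E (m + 1) *m transfer a E m p.
    rewrite -transfer_recr /=; congr (_ *m _); apply/matrixP => i j; rewrite !mxE.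
    by rewrite (_ : m + p.+1%:Z = m + 1 + p%:Z) ?ap//; lia.
  have d1 := det_tstep a E (m + 1) (a0 _).
  have -> : transfer a E (m + 1) p = tstep a E (m + 1) *m transfer a E m p *m
      ((\tr (tstep a E (m + 1)))%:M - tstep a E (m + 1)).
    by rewrite -h -mulmxA mulmx_det1// mulmx1.
  by rewrite mxtrace_mulC mulmxA det1_mulmx// mul1mx.
elim/int_ind: n => // m <-; first by rewrite -(step m); congr (\tr (transfer _ _ _ _)); lia.
by rewrite -[LHS]step; congr (\tr (transfer _ _ _ _)); lia.
Qed.

Section Bounds.
Variables (M K : R).
Hypothesis M_gt1 : 1 < M.
Definition in_band a := forall n, M^-1 <= a n <= M.

Lemma in_band_gt0 a n : in_band a -> 0 < a n.
Proof.
move=> aM; have /andP[h _] := aM n; apply: lt_le_trans h; rewrite invr_gt0; move: M_gt1; lra.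
Qed.

Lemma in_band_neq0 a : in_band a -> forall n, a n != 0.
Proof. by move=> aM n; rewrite gt_eqF// in_band_gt0. Qed.

Lemma in_band_norm a n : in_band a -> `|a n| <= M.
Proof. by move=> aM; rewrite (ger0_norm (ltW (in_band_gt0 a n aM))); have /andP[] := aM n. Qed.

Lemma in_band_bounded a : in_band a -> zbounded R a.
Proof. by move=> aM; exists M => n; exact: in_band_norm. Qed.

Lemma in_band_norm_inv a n : in_band a -> `|(a n)^-1| <= M.
Proof.
move=> aM; have a0 := in_band_gt0 a n aM; rewrite ger0_norm ?invr_ge0 ?(ltW a0)//.
rewrite -[leRHS]invrK lef_pV2 ?posrE ?invr_gt0//; first by have /andP[] := aM n.
by move: M_gt1; lra.
Qed.

Definition tbound := (K + 1) * M.

Lemma tstep_bound a E n i j : in_band a -> `|E| <= K -> `|tstep a E n i j| <= tbound.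
Proof.
move=> aM EK; have h1 := in_band_norm_inv a n aM; have h2 := in_band_norm a n aM.
have K0 : 0 <= K := le_trans (normr_ge0 _) EK.
have M1 := M_gt1.
have hM : M <= tbound by rewrite /tbound; nra.
rewrite mxE; case: ifP => _; case: ifP => _.
- rewrite normrM (@le_trans _ _ (K * M))//; first by rewrite ler_pM.
  by rewrite /tbound; nra.
- by rewrite normrN (le_trans h1).
- exact: le_trans h2 hM.
- by rewrite normr0 (le_trans _ hM)//; lra.
Qed.

Lemma tbound_ge1 : 0 <= K -> 1 <= tbound.
Proof. by move=> K0; have := M_gt1; rewrite /tbound; nra. Qed.

Lemma transfer_bound a E n k i j : in_band a -> `|E| <= K ->
  `|transfer a E n k i j| <= (2 * tbound) ^+ k.
Proof.
move=> aM EK; have K0 : 0 <= K := le_trans (normr_ge0 _) EK.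
have t1 := tbound_ge1 K0.
elim: k i => [|k IH] i.
  rewrite /= mxE expr0; case: (i == j); first by rewrite normr1.
  by rewrite normr0.
rewrite /= mulmx2E exprS (le_trans (ler_normD _ _))// !normrM.
have h l m : `|tstep a E (n + k.+1%:Z) i l| * `|transfer a E n k m j| <=
   tbound * (2 * tbound) ^+ k by apply: ler_pM => //; exact: tstep_bound.
by have := h 0 0; have := h 1 1; lra.
Qed.

Lemma tstep_cont a b E n i j r : in_band a -> in_band b -> `|E| <= K ->
  `|a n - b n| <= r -> `|tstep a E n i j - tstep b E n i j| <= (K + 1) * M ^+ 2 * r.
Proof.
move=> aM bM EK ab.
have a0 := in_band_neq0 a aM n; have b0 := in_band_neq0 b bM n.
have K0 : 0 <= K := le_trans (normr_ge0 _) EK.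
have r0 : 0 <= r := le_trans (normr_ge0 _) ab.
have M1 := M_gt1.
have inv : `|(a n)^-1 - (b n)^-1| <= M ^+ 2 * r.
  have -> : (a n)^-1 - (b n)^-1 = (a n)^-1 * (b n)^-1 * (b n - a n) by field; rewrite a0 b0.
  rewrite !normrM expr2 distrC.
  by apply: ler_pM => //; apply: ler_pM => //; exact: in_band_norm_inv.
have c1 : 1 <= (K + 1) * M ^+ 2 by rewrite expr2; nra.
have c2 : M ^+ 2 * r <= (K + 1) * M ^+ 2 * r.
  by rewrite ler_wpM2r// ler_peMl ?sqr_ge0//; lra.
rewrite !mxE; case: ifP => _; case: ifP => _.
- rewrite -mulrBr normrM -mulrA mulrA; apply: (@le_trans _ _ (K * (M ^+ 2 * r))).
    by rewrite ler_pM.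
  by rewrite mulrA ler_wpM2r// ler_wpM2r ?sqr_ge0//; lra.
- by rewrite opprK addrC distrC (le_trans _ c2)// distrC.
- by apply: le_trans ab _; rewrite ler_peMl.
- by rewrite subrr normr0 mulr_ge0//; lra.
Qed.

Lemma transfer_cont k eta : 0 <= K -> 0 < eta -> exists2 r, 0 < r &
  forall a b E n i j, in_band a -> in_band b -> `|E| <= K -> (forall n, `|a n - b n| <= r) ->
  `|transfer a E n k i j - transfer b E n k i j| <= eta.
Proof.
move=> K0 ; have t1 := tbound_ge1 K0; have M1 := M_gt1.
elim: k eta => [|k IH] eta eta0.
  by exists 1 => // *; rewrite /= subrr normr0 ltW.
have [r r0 Hr] := IH (eta / (4 * tbound)) ltac:(rewrite divr_gt0//; lra).
pose L := (K + 1) * M ^+ 2.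
have L0 : 0 < L by rewrite /L mulr_gt0 ?exprn_gt0//; lra.
pose W := (2 * tbound) ^+ k.
have W0 : 0 < W by rewrite exprn_gt0//; lra.
(* Each entry of the product has two summands, and each summand splits into two errors; every one of
   the four is at most [eta / 4]. *)
pose s := eta / (4 * (L * W)).
have s0 : 0 < s by apply: divr_gt0 => //; apply: mulr_gt0 => //; exact: mulr_gt0.
exists (Num.min r s); first by rewrite lt_min r0 s0.
move=> a b E n i j aM bM EK ab.
have abr m : `|a m - b m| <= r by apply: le_trans (ab m) _; rewrite ge_min lexx.
have abs m : `|a m - b m| <= s by apply: le_trans (ab m) _; rewrite ge_min lexx orbT.
have term l m : `|tstep a E (n + k.+1%:Z) i l * transfer a E n k m j -
    tstep b E (n + k.+1%:Z) i l * transfer b E n k m j| <= eta / 2.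
  set x := tstep a _ _ _ _; set x' := tstep b _ _ _ _; set y := transfer a _ _ _ _ _.
  set y' := transfer b _ _ _ _ _.
  have -> : x * y - x' * y' = x * (y - y') + (x - x') * y' by ring.
  rewrite (le_trans (ler_normD _ _))// !normrM.
  have h1 : `|x| * `|y - y'| <= tbound * (eta / (4 * tbound)).
    by apply: ler_pM => //; [exact: tstep_bound | exact: Hr].
  have h2 : `|x - x'| * `|y'| <= (L * s) * W.
    by apply: ler_pM => //; [exact: tstep_cont | exact: transfer_bound].
  have e1 : tbound * (eta / (4 * tbound)) = eta / 4 by field; lra.
  have e2 : (L * s) * W = eta / 4 by rewrite /s; field; rewrite !gt_eqF.
  by rewrite e1 in h1; rewrite e2 in h2; lra.
rewrite /= !mulmx2E.
rewrite opprD addrACA (le_trans (ler_normD _ _))// (splitr eta).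
by apply: lerD; exact: term.
Qed.

End Bounds.
End Transfer.

(** * Gaps and eigenvalues of nearly periodic sequences *)

Section HyperbolicGap.
Variables (R : realType) (M K : R).
Hypothesis M_gt1 : 1 < M.
Implicit Types (a u f : zseq R) (E : R) (n : int) (k p : nat).

Lemma sqr_le_norm (x y : R) : `|x| <= y -> x ^+ 2 <= y ^+ 2.
Proof.
move=> xy; rewrite -[leLHS]real_normK ?num_real// lerXn2r ?nnegrE//.
exact: le_trans (normr_ge0 _) xy.
Qed.

Lemma sqrD3_le (x y z : R) : (x + y + z) ^+ 2 <= 3 * x ^+ 2 + 3 * y ^+ 2 + 3 * z ^+ 2.
Proof. by have := sqr_ge0 (x - y); have := sqr_ge0 (x - z); have := sqr_ge0 (y - z); nra. Qed.

Lemma sqrM_le (x y c : R) : `|x| <= c -> (x * y) ^+ 2 <= c ^+ 2 * y ^+ 2.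
Proof. by move=> /sqr_le_norm h; rewrite exprMn ler_wpM2r// sqr_ge0. Qed.

Lemma zbnd_response a E k : in_band R M a -> `|E| <= K -> exists2 C, 0 <= C &
  forall f c i, zbnd R (fun n => f n ^+ 2) c ->
    zbnd R (fun n => response R a E f n k i 0 ^+ 2) (C * c).
Proof.
move=> aM EK; elim: k => [|k [C C0 IH]].
  exists 0 => // f c i _; rewrite mul0r /=.
  by under [X in zbnd _ X]eq_fun do rewrite mxE expr0n; apply: zbnd_cst0.
set t := tbound R M K.
exists (6 * t ^+ 2 * C + 3 * M ^+ 2).
  by have := sqr_ge0 t; have := sqr_ge0 M; nra.
move=> f c i fc.
have t3 : 0 <= 3 * t ^+ 2 by have := sqr_ge0 t; lra.
have M3 : 0 <= 3 * M ^+ 2 by have := sqr_ge0 M; lra.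
have b0 := zbndZ _ _ _ _ t3 (IH f c 0 fc).
have b1 := zbndZ _ _ _ _ t3 (IH f c 1 fc).
have bf := zbndZ _ _ _ _ M3 (zbnd_shift _ _ _ k.+1%:Z (fun n => sqr_ge0 (f n)) fc).
apply: zbnd_le (zbndD _ _ _ _ _ (zbndD _ _ _ _ _ b0 b1) bf); last by lra.
move=> n; rewrite /= mxE mulmx2E.
apply: le_trans (sqrD3_le _ _ _) _.
have h0 := sqrM_le _ (response R a E f n k 0 0) _ (tstep_bound R M K M_gt1 a E (n + k.+1%:Z) i 0 aM EK).
have h1 := sqrM_le _ (response R a E f n k 1 0) _ (tstep_bound R M K M_gt1 a E (n + k.+1%:Z) i 1 aM EK).
have h2 : source R a f (n + k.+1%:Z) i 0 ^+ 2 <= M ^+ 2 * f (n + k.+1%:Z) ^+ 2.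
  rewrite mxE; case: ifP => _; last by rewrite expr0n mulr_ge0 ?sqr_ge0.
  by rewrite mulrC; apply: sqrM_le; apply: in_band_norm_inv.
rewrite -/t in h0 h1; lra.
Qed.

(* [u(n+p) + u(n-p) - tr(A) u(n)] is a bounded local combination of [(J - E) u], because
   [A + A^-1 = tr(A)]; a trace outside [-2, 2] then makes [J - E] bounded below. *)
Lemma hyperbolic_bounded_below a p E : in_band R M a -> period R a p -> `|E| <= K ->
  2 < `|\tr (transfer R a E 0 p)| -> exists2 C, 0 < C & bounded_below R a E C.
Proof.
move=> aM ap EK; set tau := \tr _ => tau2.
have [C C0 HC] := zbnd_response a E p aM EK.
have a0 := in_band_neq0 R M M_gt1 a aM.
pose W := `|tau| + (2 * tbound R M K) ^+ p.
have WT n (j : 'I_2) : `|(tau%:M - transfer R a E n p) 0 j| <= W.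
  rewrite mxE [X in X + _]mxE [X in _ + X]mxE.
  rewrite (le_trans (ler_normB _ _))// lerD//; last exact: transfer_bound.
  by case: (0 == j); rewrite ?mulr1n ?mulr0n ?normr0.
(* The two translates of [u] will contribute [4 * (1 + eps)] against [tau^2]; this choice spends
   half of the surplus [tau^2 - 4] and leaves the other half to divide by. *)
pose eps := (tau ^+ 2 - 4) / 8.
have tau4 : 4 < tau ^+ 2.
  rewrite -(real_normK (num_real tau)); move: tau2; move: `|tau| => x; nra.
have eps0 : 0 < eps by rewrite divr_gt0//; lra.
pose D := 3 * C + 3 * W ^+ 2 * C + 3 * W ^+ 2 * C.
have W0 := sqr_ge0 W.
have D0 : 0 <= D by rewrite /D; nra.
pose D' := (1 + eps^-1) * D + 1.
have ie0 : 0 < eps^-1 by rewrite invr_gt0.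
have D'0 : 0 < D' by rewrite /D'; nra.
exists (2 * D' / (tau ^+ 2 - 4)) => [|u lu]; first by rewrite divr_gt0 ?mulr_gt0//; lra.
set f := fun n => Jop a u n - E * u n.
have lf : in_l2 f by apply: in_l2_Jshift => //; exact: in_band_bounded aM.
set F := l2norm2 f; set N := l2norm2 u.
have bf : zbnd R (fun n => f n ^+ 2) F := zbnd_l2norm2 _ _ lf.
have bu : zbnd R (fun n => u n ^+ 2) N := zbnd_l2norm2 _ _ lu.
have F0 : 0 <= F := zbnd_ge0 _ _ _ bf.
pose h n := response R a E f n p 0 0 -
  ((tau%:M - transfer R a E n p) *m response R a E f (n - p%:Z) p) 0 0.
have bh : zbnd R (fun n => h n ^+ 2) (D * F).
  have b1 := zbndZ _ _ _ 3 ltac:(lra) (HC f F 0 bf).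
  have W3 : 0 <= 3 * W ^+ 2 by lra.
  have sq i := zbnd_shift _ _ _ (- p%:Z) (fun n => sqr_ge0 (response R a E f n p i 0)) (HC f F i bf).
  have b2 := zbndZ _ _ _ _ W3 (sq 0); have b3 := zbndZ _ _ _ _ W3 (sq 1).
  apply: zbnd_le (zbndD _ _ _ _ _ (zbndD _ _ _ _ _ b1 b2) b3); last by rewrite /D; lra.
  move=> n; rewrite /h mulmx2E /= opprD addrA.
  apply: le_trans (sqrD3_le _ _ _) _; rewrite !sqrrN.
  have := sqrM_le _ (response R a E f (n - p%:Z) p 0 0) _ (WT n 0).
  have := sqrM_le _ (response R a E f (n - p%:Z) p 1 0) _ (WT n 1).
  by lra.
(* The first coordinate of the state at [n] is [u (n + 1)], whence the offset of one, undone by the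
   shift by [-1] below. *)
have id n : tau * u (n + 1) = u (n + (1 + p%:Z)) + u (n + (1 - p%:Z)) - h n.
  have e1 := state_transfer R a E u n p a0.
  have e2 := state_transfer R a E u (n - p%:Z) p a0.
  rewrite subrK (_ : transfer R a E (n - p%:Z) p = transfer R a E n p) in e2; last first.
    by rewrite -(transfer_period R a p E (n - p%:Z))// subrK.
  have trn : \tr (transfer R a E n p) = tau by exact: trace_transfer.
  have dT : \det (transfer R a E n p) = 1 by exact: det_transfer.
  have e3 : (tau%:M - transfer R a E n p) *m state R a u n = state R a u (n - p%:Z) +
      (tau%:M - transfer R a E n p) *m response R a E f (n - p%:Z) p.
    by rewrite e2 mulmxDr mulmxA -trn det1_mulmx// mul1mx.
  have := congr1 (fun A : 'cV_2 => A 0 0) e1; have := congr1 (fun A : 'cV_2 => A 0 0) e3.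
  rewrite /= mulmxBl mul_scalar_mx.
  set g1 := response _ _ _ _ n p; set g2 := _ *m response _ _ _ _ _ p.
  set x := _ *m state R a u n => k1 k2.
  have hB (A B : 'cV[R]_2) : (A - B) 0 0 = A 0 0 - B 0 0 by rewrite !mxE.
  have hD (A B : 'cV[R]_2) : (A + B) 0 0 = A 0 0 + B 0 0 by rewrite mxE.
  have hZ (A : 'cV[R]_2) : (tau *: A) 0 0 = tau * A 0 0 by rewrite mxE.
  have hs m : state R a u m 0 0 = u (m + 1) by rewrite mxE.
  rewrite hB hD hZ !hs in k1; rewrite hD hs in k2.
  rewrite /h -/g1 -/g2 (_ : n + (1 + p%:Z) = n + p%:Z + 1); last by rewrite addrA addrAC.
  rewrite (_ : n + (1 - p%:Z) = n - p%:Z + 1); last by rewrite addrA addrAC.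
  by rewrite k2; lra.
have bt : zbnd R (fun n => tau ^+ 2 * u (n + 1) ^+ 2) (4 * (1 + eps) * N + (1 + eps^-1) * (D * F)).
  have s1 := zbnd_shift _ _ _ (1 + p%:Z) (fun n => sqr_ge0 (u n)) bu.
  have s2 := zbnd_shift _ _ _ (1 - p%:Z) (fun n => sqr_ge0 (u n)) bu.
  have e2 : 0 <= 2 * (1 + eps) by lra.
  have ei : 0 <= 1 + eps^-1 by lra.
  apply: zbnd_le (zbndD _ _ _ _ _ (zbndD _ _ _ _ _ (zbndZ _ _ _ _ e2 s1) (zbndZ _ _ _ _ e2 s2))
    (zbndZ _ _ _ _ ei bh)); last by lra.
  move=> n /=; rewrite -exprMn id.
  set x := u _; set y := u _; set z := h n.
  have : (x + y - z) ^+ 2 <= (1 + eps) * (x + y) ^+ 2 + (1 + eps^-1) * z ^+ 2.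
    rewrite -subr_ge0.
    have -> : (1 + eps) * (x + y) ^+ 2 + (1 + eps^-1) * z ^+ 2 - (x + y - z) ^+ 2 =
       eps^-1 * (eps * (x + y) + z) ^+ 2 by field; rewrite gt_eqF.
    by rewrite mulr_ge0 ?sqr_ge0// ltW.
  have := mulr_ge0 (ltW eps0) (sqr_ge0 (x - y)); have := sqr_ge0 (x - y); nra.
have {}bt := zbnd_shift _ _ _ (-1) (fun n => mulr_ge0 (sqr_ge0 tau) (sqr_ge0 (u (n + 1)))) bt.
have tN : tau ^+ 2 * N <= 4 * (1 + eps) * N + (1 + eps^-1) * (D * F).
  rewrite /N /l2norm2 -zsumZ//; apply: zsum_le; first by move=> n; rewrite mulr_ge0 ?sqr_ge0.
  by move: bt; congr zbnd; apply: funext => n; rewrite subrK.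
rewrite mulrAC ler_pdivlMr; last by lra.
have e8 : eps * 8 = tau ^+ 2 - 4 by rewrite /eps; field.
by rewrite /D'; nra.
Qed.

End HyperbolicGap.

(** * Gordon's three-block argument *)

Section Gordon.
Variables (R : realType) (M K : R).
Hypothesis M_gt1 : 1 < M.
Hypothesis K_ge0 : 0 <= K.
Implicit Types (a b u : zseq R) (E : R) (n : int) (k p q : nat).

Definition vnorm (x : 'cV[R]_2) : R := `|x 0 0| + `|x 1 0|.

Lemma vnorm_ge0 x : 0 <= vnorm x. Proof. by rewrite /vnorm addr_ge0. Qed.

Lemma vnormD x y : vnorm (x + y) <= vnorm x + vnorm y.
Proof.
have e i : (x + y) i 0 = x i 0 + y i 0 by rewrite mxE.
rewrite /vnorm !e.
by have := ler_normD (x 0 0) (y 0 0); have := ler_normD (x 1 0) (y 1 0); lra.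
Qed.

Lemma vnormZ c x : vnorm (c *: x) = `|c| * vnorm x.
Proof.
have e i : (c *: x) i 0 = c * x i 0 by rewrite mxE.
by rewrite /vnorm !e !normrM mulrDr.
Qed.

Lemma vnorm_mulmx (A : 'M[R]_2) c x : (forall i j, `|A i j| <= c) ->
  vnorm (A *m x) <= 2 * c * vnorm x.
Proof.
move=> Ac; rewrite /vnorm !mulmx2E.
have h i j : `|A i j * x j 0| <= c * `|x j 0| by rewrite normrM ler_wpM2r.
have := ler_normD (A 0 0 * x 0 0) (A 0 1 * x 1 0).
have := ler_normD (A 1 0 * x 0 0) (A 1 1 * x 1 0).
by have := h 0 0; have := h 0 1; have := h 1 0; have := h 1 1; lra.
Qed.

(** Here [\tr A - A] is [A^-1]. If [|\tr A| <= 1], use [x = tr(A) A x - A^2 x]; otherwise use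
    [tr(A) x = A x + A^-1 x]. *)
Lemma gordon_det1 (A : 'M[R]_2) x : \det A = 1 ->
  vnorm x <= vnorm (A *m x) + vnorm (A *m A *m x) + vnorm (((\tr A)%:M - A) *m x).
Proof.
move=> dA; set t := \tr A.
have a0 := vnorm_ge0 (A *m x); have a1 := vnorm_ge0 (A *m A *m x).
have a2 := vnorm_ge0 ((t%:M - A) *m x).
have [t1|t1] := leP `|t| 1.
  have e : x = t *: (A *m x) + (-1) *: (A *m A *m x).
    by rewrite sqr_det1// mulmxBl mul1mx -scalemxAl scaleN1r opprB addrCA subrr addr0.
  rewrite {1}e (le_trans (vnormD _ _))// !vnormZ normrN1 mul1r.
  by nra.
have e : t *: x = A *m x + (t%:M - A) *m x by rewrite mulmxBl mul_scalar_mx addrCA subrr addr0.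
have := vnormD (A *m x) ((t%:M - A) *m x); rewrite -e vnormZ.
by have := vnorm_ge0 x; nra.
Qed.

(** The estimate of [gordon_det1] with a factor 2 as room for perturbation, required for all bounded
    energies at once so that one neighbourhood of a periodic sequence serves them all. *)
Definition gordon a q := forall E u, `|E| <= K -> (forall n, Jop a u n - E * u n = 0) ->
  vnorm (state R a u 0) <= 2 * (vnorm (state R a u q%:Z) + vnorm (state R a u (q + q)%N%:Z) +
                               vnorm (state R a u (- q%:Z))).

Lemma periodic_gordon b q : in_band R M b -> period R b q -> exists2 r, 0 < r &
  forall a, in_band R M a -> (forall n, `|a n - b n| <= r) -> gordon a q.
Proof.
move=> bM bq.
(* The three comparisons cost [2/20], [2/20] and [6/20] of [vnorm x] (the backward one involves a
   trace), together one half; absorbing it gives the factor 2. *)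
have eta0 : 0 < 20^-1 :> R by [].
have [r1 r10 H1] := transfer_cont R M K M_gt1 q _ K_ge0 eta0.
have [r2 r20 H2] := transfer_cont R M K M_gt1 (q + q)%N _ K_ge0 eta0.
exists (Num.min r1 r2) => [|a aM ab E u EK Eu]; first by rewrite lt_min r10.
have ab1 n : `|a n - b n| <= r1 by apply: le_trans (ab n) _; rewrite ge_min lexx.
have ab2 n : `|a n - b n| <= r2 by apply: le_trans (ab n) _; rewrite ge_min lexx orbT.
have a0 := in_band_neq0 R M M_gt1 a aM; have b0 := in_band_neq0 R M M_gt1 b bM.
have st n k : state R a u (n + k%:Z) = transfer R a E n k *m state R a u n.
  by rewrite (state_transfer R a E)// response0// addr0.
set x := state R a u 0.
set A := transfer R b E 0 q.
have dA : \det A = 1 by exact: det_transfer.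
have x0 := vnorm_ge0 x.
have e1 : state R a u q%:Z = A *m x + (transfer R a E 0 q - A) *m x.
  by rewrite mulmxBl addrCA subrr addr0 -(st 0) add0r.
have e2 : state R a u (q + q)%N%:Z = A *m A *m x + (transfer R a E 0 (q + q) - A *m A) *m x.
  by rewrite mulmxBl addrCA subrr addr0 -(st 0) add0r.
set Tm := transfer R a E (- q%:Z) q.
have dTm : \det Tm = 1 by exact: det_transfer.
have e3 : state R a u (- q%:Z) = ((\tr A)%:M - A) *m x + (((\tr Tm)%:M - Tm) - ((\tr A)%:M - A)) *m x.
  have xE : x = Tm *m state R a u (- q%:Z) by rewrite -st addNr.
  by rewrite -mulmxDl [X in X *m x]addrC subrK {1}xE mulmxA det1_mulmx// mul1mx.
have d1 i j : `|(transfer R a E 0 q - A) i j| <= 20^-1 by rewrite !mxE H1.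
have AA : A *m A = transfer R b E 0 (q + q).
  by rewrite transferD transfer_period.
have d2 i j : `|(transfer R a E 0 (q + q) - A *m A) i j| <= 20^-1 by rewrite AA !mxE H2.
have bT : transfer R b E (- q%:Z) q = A by rewrite -(transfer_period R b q)// addNr.
have dT i j : `|Tm i j - A i j| <= 20^-1 by rewrite -bT H1.
have d3 i j : `|(((\tr Tm)%:M - Tm) - ((\tr A)%:M - A)) i j| <= 3 * 20^-1.
  rewrite !mxE !mxtrace2E.
  have h0 := dT 0 0; have h1 := dT 1 1; have h := dT i j.
  have -> : (Tm 0 0 + Tm 1 1) *+ (i == j) - Tm i j - ((A 0 0 + A 1 1) *+ (i == j) - A i j) =
     (Tm 0 0 - A 0 0) *+ (i == j) + (Tm 1 1 - A 1 1) *+ (i == j) - (Tm i j - A i j).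
    by case: (i == j); rewrite ?mulr1n ?mulr0n; ring.
  rewrite (le_trans (ler_normB _ _))//.
  have n0 : `|(Tm 0 0 - A 0 0) *+ (i == j) + (Tm 1 1 - A 1 1) *+ (i == j)| <= 2 * 20^-1.
    case: (i == j); last by rewrite !mulr0n addr0 normr0; lra.
    by rewrite !mulr1n (le_trans (ler_normD _ _))//; lra.
  lra.
have g := gordon_det1 A x dA.
have v1 : vnorm (A *m x) <= vnorm (state R a u q%:Z) + 2 * 20^-1 * vnorm x.
  rewrite (_ : A *m x = state R a u q%:Z + (-1) *: ((transfer R a E 0 q - A) *m x)); last first.
    by rewrite e1 scaleN1r addrK.
  rewrite (le_trans (vnormD _ _))// vnormZ normrN1 mul1r lerD2l.
  exact: vnorm_mulmx.
have v2 : vnorm (A *m A *m x) <= vnorm (state R a u (q + q)%N%:Z) + 2 * 20^-1 * vnorm x.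
  rewrite (_ : A *m A *m x = state R a u (q + q)%N%:Z +
     (-1) *: ((transfer R a E 0 (q + q) - A *m A) *m x)); last by rewrite e2 scaleN1r addrK.
  rewrite (le_trans (vnormD _ _))// vnormZ normrN1 mul1r lerD2l.
  exact: vnorm_mulmx.
have v3 : vnorm (((\tr A)%:M - A) *m x) <= vnorm (state R a u (- q%:Z)) + 2 * (3 * 20^-1) * vnorm x.
  rewrite (_ : ((\tr A)%:M - A) *m x = state R a u (- q%:Z) +
     (-1) *: ((((\tr Tm)%:M - Tm) - ((\tr A)%:M - A)) *m x)); last by rewrite e3 scaleN1r addrK.
  rewrite (le_trans (vnormD _ _))// vnormZ normrN1 mul1r lerD2l.
  exact: vnorm_mulmx.
lra.
Qed.

Lemma state_eq0 a E u : (forall n, a n != 0) -> (forall n, Jop a u n - E * u n = 0) ->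
  state R a u 0 = 0 -> forall n, u n = 0.
Proof.
move=> a0 Eu s0.
have st n k : state R a u (n + k%:Z) = transfer R a E n k *m state R a u n.
  by rewrite (state_transfer R a E)// response0// addr0.
have sn n : state R a u n = 0.
  case: (intP n) => [//|k|k].
    by rewrite -[k.+1%:Z]add0r st s0 mulmx0.
  have := st (- k.+1%:Z) k.+1; rewrite addNr s0 => /(congr1 (mulmx ((\tr (transfer R a E (- k.+1%:Z) k.+1))%:M - transfer R a E (- k.+1%:Z) k.+1))).
  by rewrite mulmx0 mulmxA det1_mulmx ?mul1mx//; apply: det_transfer.
move=> n; have := congr1 (fun A : 'cV_2 => A 0 0) (sn (n - 1)).
by rewrite !mxE /= subrK.
Qed.

(** For square summable [u] the states at [q], [2q] and [-q] become small as [q] grows, so the state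
    at 0 vanishes. Each of them is brought below [e / 6]: there are three, with a factor 2. *)
Lemma gordon_no_eigenvalue a E : in_band R M a -> `|E| <= K ->
  (forall k, exists2 q, (k <= q)%N & gordon a q) -> no_eigenvalue R a E.
Proof.
move=> aM EK Hg u lu Eu.
have a0 := in_band_neq0 R M M_gt1 a aM.
apply: (state_eq0 a E) => //.
suff v0 : vnorm (state R a u 0) = 0.
  apply/matrixP; apply: ord2P => j; rewrite (ord1 j) [RHS]mxE; apply/eqP; rewrite -normr_eq0 eq_le normr_ge0 andbT.
    by move: v0; rewrite /vnorm; have := normr_ge0 (state R a u 0 1 0); lra.
  by move: v0; rewrite /vnorm; have := normr_ge0 (state R a u 0 0 0); lra.
apply/eqP; rewrite eq_le vnorm_ge0 andbT; apply/ler_addgt0Pr => e e0; rewrite add0r.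
have M1 := M_gt1.
pose d := e / (6 * (1 + M)).
have d0 : 0 < d by rewrite divr_gt0//; lra.
have [N HN] := zpart_tail R (fun n => u n ^+ 2) (fun n => sqr_ge0 (u n)) lu (d ^+ 2) (exprn_gt0 _ d0).
have small n : (N.+1 <= `|n|)%N -> vnorm (state R a u n) <= e / 6.
  move=> Nn; rewrite /vnorm !mxE /=.
  have ud m : (N <= `|m|)%N -> `|u m| <= d.
    move=> /HN/ltW; rewrite -[leLHS]real_normK ?num_real// ler_pXn2r ?nnegrE//.
    exact: ltW.
  have h1 := ud (n + 1) ltac:(lia); have h2 := ud n ltac:(lia).
  rewrite normrM; have h3 := in_band_norm R M M_gt1 a n aM.
  have h4 : `|a n| * `|u n| <= M * d by apply: ler_pM.
  have e1 : (1 + M) * d = e / 6 by rewrite /d; field; lra.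
  lra.
have [q qN gq] := Hg N.+1; apply: le_trans (gq E u EK Eu) _.
have s1 := small q%:Z ltac:(lia); have s2 := small (q + q)%N%:Z ltac:(lia).
have s3 := small (- q%:Z) ltac:(lia).
lra.
Qed.

End Gordon.

(** * Opening gaps *)

Section OpeningGaps.
Variable R : realType.
Implicit Types (A : 'M[R]_2) (theta eta eps : R).

Lemma truncn_eq_dist (x y : R) : 0 <= x -> 0 <= y -> Num.truncn x = Num.truncn y -> `|x - y| < 1.
Proof.
move=> x0 y0 e.
have /andP[h1 h2] := truncn_itv x0; have /andP[h3 h4] := truncn_itv y0.
rewrite -natr1 in h2; rewrite -natr1 in h4; rewrite e in h1 h2.
by rewrite ltr_norml; lra.
Qed.

(** Dirichlet's pigeonhole on the points [(cos, sin)] of the multiples of [theta], in a grid of mesh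
    [1 / N]: two share a cell, and the difference of their indices serves. Points on the circle
    avoid reducing angles modulo a full turn. *)
Lemma sin_mul_small theta eta : 0 < eta ->
  exists2 k : nat, (0 < k)%N & `|sin (k%:R * theta)| <= eta.
Proof.
move=> eta0.
pose N := (Num.truncn (2 / eta)).+1.
have NN : 2 / eta < N%:R by exact: truncnS_gt.
have N0 : 0 < N%:R :> R by rewrite ltr0n.
pose c (k : nat) : R := N%:R * (cos (k%:R * theta) + 1).
pose s (k : nat) : R := N%:R * (sin (k%:R * theta) + 1).
have bnd (x : R) : -1 <= x <= 1 -> 0 <= N%:R * (x + 1) /\ (Num.truncn (N%:R * (x + 1)) < N.*2.+1)%N.
  move=> /andP[x1 x2]; have h0 : 0 <= N%:R * (x + 1) by rewrite mulr_ge0 ?(ltW N0)//; lra.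
  split => //; rewrite ltnS truncn_le_nat -natr1 -muln2 natrM.
  have : N%:R * (x + 1) <= N%:R * 2 :> R by rewrite ler_wpM2l ?(ltW N0)//; lra.
  by move: N0; lra.
have cb k := bnd (cos (k%:R * theta)) ltac:(by rewrite cos_geN1 cos_le1).
have sb k := bnd (sin (k%:R * theta)) ltac:(by rewrite sin_geN1 sin_le1).
pose L := N.*2.+1.
pose F (k : 'I_(L * L).+1) : 'I_L * 'I_L := (inord (Num.truncn (c k)), inord (Num.truncn (s k))).
have /injectivePn[i [j ij Fij]] : ~~ injectiveb F.
  apply/negP => /injectiveP/leq_card; rewrite card_prod !card_ord; lia.
wlog lt_ij : i j ij Fij / (i < j)%N.
  move=> H; have [h|h|h] := ltngtP i j; first exact: (H i j).
    by apply: (H j i) => //; rewrite eq_sym.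
  by move: ij; rewrite -val_eqE /= h eqxx.
exists (j - i)%N; first by rewrite subn_gt0.
have ec : Num.truncn (c i) = Num.truncn (c j).
  move: Fij => [] /(congr1 val) /=; rewrite !inordK //; [exact: proj2 (cb _) | exact: proj2 (cb _)].
have es : Num.truncn (s i) = Num.truncn (s j).
  move: Fij => [] _ /(congr1 val) /=; rewrite !inordK //; [exact: proj2 (sb _) | exact: proj2 (sb _)].
have dist (x y : R) : 0 <= N%:R * (x + 1) -> 0 <= N%:R * (y + 1) ->
    Num.truncn (N%:R * (x + 1)) = Num.truncn (N%:R * (y + 1)) -> N%:R * `|x - y| < 1.
  move=> x0 y0 xy; have := truncn_eq_dist _ _ x0 y0 xy.
  by rewrite -mulrBr normrM (ger0_norm (ltW N0)) opprD addrACA subrr addr0.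
have hc := dist _ _ (proj1 (cb i)) (proj1 (cb j)) ec.
have hs := dist _ _ (proj1 (sb i)) (proj1 (sb j)) es.
have -> : sin ((j - i)%:R * theta) =
    (sin (j%:R * theta) - sin (i%:R * theta)) * cos (i%:R * theta) -
    (cos (j%:R * theta) - cos (i%:R * theta)) * sin (i%:R * theta).
  by rewrite natrB 1?ltnW// mulrBl sinB; ring.
have c1 : `|cos (i%:R * theta)| <= 1 by rewrite ler_norml cos_geN1 cos_le1.
have s1 : `|sin (i%:R * theta)| <= 1 by rewrite ler_norml sin_geN1 sin_le1.
have small (x y : R) : N%:R * `|x - y| < 1 -> `|y - x| <= eta / 2.
  rewrite mulrC -ltr_pdivlMr// mul1r distrC => /ltW/le_trans; apply.
  rewrite -[leRHS]invrK lef_pV2 ?posrE ?invr_gt0 ?divr_gt0// invf_div.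
  exact: ltW.
have {}hc := small _ _ hc; have {}hs := small _ _ hs.
rewrite (le_trans (ler_normB _ _))// !normrM (splitr eta).
by apply: lerD; rewrite -[leRHS]mulr1; apply: ler_pM.
Qed.

(** The Chebyshev formula for powers in [SL_2], multiplied by [sin theta]; the induction is
    Cayley-Hamilton. *)
Lemma expr_elliptic A theta k : \det A = 1 -> \tr A = 2 * cos theta ->
  sin theta *: A ^+ k.+1 = sin (k.+1%:R * theta) *: A - (sin (k%:R * theta))%:M.
Proof.
move=> dA tA; elim: k => [|k IH].
  by rewrite expr1 mul1r mul0r sin0 raddf0 subr0.
have e : sin (k.+2%:R * theta) = 2 * cos theta * sin (k.+1%:R * theta) - sin (k%:R * theta).
  have -> : k.+2%:R * theta = k.+1%:R * theta + theta by rewrite -[in LHS]natr1 mulrDl mul1r.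
  have -> : k%:R * theta = k.+1%:R * theta - theta by rewrite -[in RHS]natr1 mulrDl mul1r addrK.
  by rewrite sinD sinB; ring.
rewrite exprS -[A * _]/(A *m _) scalemxAr IH mulmxBr -scalemxAr sqr_det1// tA mul_mx_scalar.
by rewrite e scalerBr scalerBl scalerA scale_scalar_mx mulr1 mulrC; rewrite addrAC.
Qed.

(* A long stretch of a nearly periodic elliptic cocycle returns close to [+-1], where
   inserting [diag(1/s, s)] makes it hyperbolic; a parabolic one is pushed out directly. *)
Lemma hyperbolic_kick A eps : \det A = 1 -> 0 < eps -> `|\tr A| <= 2 ->
  exists k, exists s, [/\ (0 < k)%N, 0 < s, `|s - 1| <= eps &
    2 < `|s^-1 * (A ^+ k) 0 0 + s * (A ^+ k) 1 1| ].
Proof.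
move=> dA eps0 trA.
have w_gt2 (s : R) : 0 < s -> s != 1 -> 2 < s + s^-1.
  move=> s0 s1; rewrite -subr_gt0.
  have -> : s + s^-1 - 2 = s^-1 * (s - 1) ^+ 2 by field; rewrite gt_eqF.
  by rewrite mulr_gt0 ?invr_gt0// exprn_even_gt0//= subr_eq0.
have [tr2|tr2] := eqVneq `|\tr A| 2.
  pose e := Num.min eps 2^-1.
  have e0 : 0 < e by rewrite lt_min eps0 /=.
  have e1 : e <= eps by rewrite ge_min lexx.
  have e2 : e <= 2^-1 by rewrite ge_min lexx orbT.
  have [y [y1 hy]] : exists y : R, (y = 1 \/ y = -1) /\ \tr A = 2 * y.
    move: tr2; have [t0|t0] := leP 0 (\tr A).
      by rewrite ger0_norm// => ->; exists 1; split; [left | rewrite mulr1].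
    by rewrite ltr0_norm// => h; exists (-1); split; [right | lra].
  rewrite mxtrace2E in hy.
  set al := A 0 0 in hy *; set de := A 1 1 in hy *.
  have y2 : y * y = 1 by case: y1 => ->; rewrite ?mulr1 ?mulrNN ?mulr1.
  have ny (x : R) : `|x| = `|y * x|.
    by rewrite normrM; case: y1 => ->; rewrite ?normrN1 ?normr1 mul1r.
  (* [s^-1 al + s de] splits into [(s^-1 + s)(al + de) / 2], already beyond 2 in modulus, and
     [(al - de)(s^-1 - s) / 2]. The sign of [cc] decides whether [s] goes below or above 1, so that
     the second part does not work against the first. *)
  pose cc := y * (al - de).
  have key (s : R) : 0 < s -> s != 1 -> 0 <= cc * (s^-1 - s) -> 2 < `|s^-1 * al + s * de|.
    move=> s0 s1 c0; have := w_gt2 s s0 s1; rewrite ny => h.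
    apply: lt_le_trans (ler_norm _).
    have -> : y * (s^-1 * al + s * de) =
       (s^-1 + s) * (y * (al + de)) / 2 + cc * (s^-1 - s) / 2 by rewrite /cc; field; rewrite gt_eqF.
    have yy : y * (2 * y) = 2 by rewrite mulrCA y2 mulr1.
    by rewrite hy yy; lra.
  exists 1%N; have [c0|c0] := leP 0 cc.
    exists (1 - e); split => //; [lra | by rewrite distrC opprB addrC subrK (ger0_norm (ltW e0)) |].
    apply: key; [lra | by rewrite lt_eqF//; lra |].
    rewrite mulr_ge0// subr_ge0 (@le_trans _ _ 1)//; first by lra.
    by rewrite -invr1 lef_pV2 ?posrE//; lra.
  exists (1 + e); split => //; [lra | by rewrite addrC addKr (ger0_norm (ltW e0)) |].
  apply: key; [lra | by rewrite gt_eqF//; lra |].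
  rewrite mulr_le0 ?(ltW c0)// subr_le0 (@le_trans _ _ 1)//; last by lra.
  by rewrite -[leRHS]invr1 lef_pV2 ?posrE//; lra.
have {}trA : `|\tr A| < 2 by rewrite lt_neqAle tr2.
have tb : -1 <= \tr A / 2 <= 1 by move: trA; rewrite ltr_norml; lra.
pose theta := acos (\tr A / 2).
have tc : \tr A = 2 * cos theta by rewrite /theta acosK//; field.
have ts : 0 < sin theta.
  rewrite /theta sin_acos// sqrtr_gt0 subr_gt0; move: trA; rewrite ltr_norml; nra.
pose s := 1 + eps.
have s0 : 0 < s by rewrite /s; lra.
pose w := s + s^-1.
have w2 : 2 < w by apply: w_gt2; rewrite // gt_eqF// /s; lra.
(* The kicked trace [X] will equal [w * ck + sk * G / sin theta]. With [|sk| <= eta] and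
   [|ck| >= 1 - eta] its modulus is at least [w - eta * (w + H)], and [eta] is chosen to make this
   [(w + 2) / 2]. *)
pose G := s^-1 * A 0 0 + s * A 1 1 - w * cos theta.
pose H := `|G| / sin theta.
have H0 : 0 <= H by rewrite divr_ge0// ltW.
pose eta := (w - 2) / (2 * (w + H)).
have eta0 : 0 < eta by rewrite divr_gt0//; lra.
have eta1 : eta * (w + H) = (w - 2) / 2 by rewrite /eta; field; lra.
have eta2 : eta <= 1 by rewrite ler_pdivrMr ?mul1r//; lra.
have [[//|k] _ hk] := sin_mul_small theta eta eta0.
exists k.+1, s; split => //; first by rewrite /s addrC addKr (ger0_norm (ltW eps0)).
set X := _ + _.
set sk := sin _ in hk.
pose ck := cos (k.+1%:R * theta).
have kE : sin (k%:R * theta) = sk * cos theta - ck * sin theta.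
  have -> : k%:R * theta = k.+1%:R * theta - theta by rewrite -[in RHS]natr1 mulrDl mul1r addrK.
  by rewrite sinB.
have pE := expr_elliptic A theta k dA tc.
have XE : sin theta * X = sk * G + w * ck * sin theta.
  have p0 := congr1 (fun B : 'M[R]_2 => B 0 0) pE; have p1 := congr1 (fun B : 'M[R]_2 => B 1 1) pE.
  rewrite /= in p0 p1.
  have eB i : (sk *: A - (sin (k%:R * theta))%:M) i i = sk * A i i - sin (k%:R * theta).
    by rewrite !mxE eqxx mulr1n.
  have eZ i : (sin theta *: A ^+ k.+1) i i = sin theta * (A ^+ k.+1) i i by rewrite mxE.
  rewrite eB eZ kE in p0; rewrite eB eZ kE in p1.
  rewrite /X mulrDr mulrCA p0 mulrCA p1 /G /w; ring.
have ck1 : 1 - eta <= `|ck|.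
  have e : ck ^+ 2 + sk ^+ 2 = 1 by exact: cos2Dsin2.
  have a1 : `|ck| <= 1 by rewrite ler_norml cos_geN1 cos_le1.
  have : ck ^+ 2 <= `|ck|.
    by rewrite -real_normK ?num_real// expr2 ler_piMl.
  have : sk ^+ 2 <= eta by rewrite -real_normK ?num_real// expr2; have := normr_ge0 sk; nra.
  lra.
have Xb : w * `|ck| - eta * H <= `|X|.
  have e : X = w * ck + sk * (G / sin theta).
    have tn : sin theta != 0 by rewrite gt_eqF.
    by apply: (mulfI tn); rewrite XE; field.
  have := ler_normB X (sk * (G / sin theta)); rewrite [in X in X <= _]e addrK normrM.
  rewrite (ger0_norm (_ : 0 <= w)); last by lra.
  have : `|sk * (G / sin theta)| <= eta * H.
    by rewrite normrM /H normrM normfV (ger0_norm (ltW ts)) ler_wpM2r// divr_ge0// ltW.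
  lra.
nra.
Qed.

End OpeningGaps.

(** * Finitely many perturbations whose gaps cover an interval *)

Section FiniteFamily.
Variables (R : realType) (M : R).
Hypothesis M_gt1 : 1 < M.
Implicit Types (a w : zseq R) (E delta : R) (p q : nat).

(** If the trace is not already outside [[-2, 2]], one coefficient in each stretch of [k] periods is
    multiplied by the [s] of [hyperbolic_kick]. The tolerance [delta / M] there keeps the change
    [|1 - s| * a n] within [delta]. *)
Lemma open_gap a p E delta : (0 < p)%N -> period R a p -> 0 < delta ->
  (forall n, M^-1 + delta <= a n <= M - delta) ->
  exists w q C, [/\ (0 < q)%N, period R w q, in_band R M w, forall n, `|a n - w n| <= delta &
    0 < C /\ bounded_below R w E C].
Proof.
move=> p0 ap d0 aM.
have aM' : in_band R M a by move=> n; have := aM n; move: d0; lra.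
have a0 := in_band_neq0 R M M_gt1 a aM'.
pose A := transfer R a E 0 p.
have dA : \det A = 1 by exact: det_transfer.
have [trA|trA] := ltP 2 `|\tr A|.
  have [C C0 HC] := hyperbolic_bounded_below R M `|E| M_gt1 a p E aM' ap (lexx _) trA.
  by exists a, p, C; split => // n; rewrite subrr normr0 ltW.
have M0 : 0 < M by move: M_gt1; lra.
have [k [s [k0 s0 s1 trk]]] := hyperbolic_kick R A (delta / M) dA (divr_gt0 d0 M0) trA.
pose q := (k * p)%N.
have q0 : (0 < q)%N by rewrite muln_gt0 k0.
pose w n := if (q%:Z %| n)%Z then s * a n else a n.
have aw n : `|a n - w n| <= delta.
  rewrite /w; case: ifP => _; last by rewrite subrr normr0 ltW.
  have -> : a n - s * a n = (1 - s) * a n by ring.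
  rewrite normrM distrC.
  have h := in_band_norm R M M_gt1 a n aM'.
  have Mn : M != 0 by rewrite gt_eqF.
  by rewrite -[leRHS](divfK Mn) ler_pM.
have wM : in_band R M w.
  by move=> n; have := aw n; have := aM n; rewrite ler_norml; lra.
have wq : period R w q.
  move=> n; rewrite /w rpredDr ?dvdzz//.
  by rewrite (periodM R a p k ap).
(* Only the last factor, at index [q], is altered, and replacing [a] by [s * a] in [tstep] amounts
   to multiplying on the left by [diag(s^-1, s)]. *)
have tE i : transfer R w E 0 q i i = (if i == 0 then s^-1 else s) * transfer R a E 0 q i i.
  case: q q0 @w {wq wM aw} => // m _ w.
  have h : transfer R w E 0 m = transfer R a E 0 m.
    apply: eq_transfer => j /andP[j0 jm]; rewrite /w add0r; case: ifP => // /dvdn_leq; lia.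
  have wm : w (0 + m.+1%:Z) = s * a (0 + m.+1%:Z) by rewrite /w add0r dvdzz.
  rewrite /= h !mulmx2E mulrDr !mulrA.
  by congr (_ * _ + _ * _); rewrite !mxE wm; case: ifP => _ //=; field; rewrite ?a0 ?gt_eqF//.
have [C C0 HC] : exists2 C, 0 < C & bounded_below R w E C.
  apply: (hyperbolic_bounded_below R M `|E| M_gt1 w q E wM wq (lexx _)).
  by rewrite mxtrace2E !tE /= /q transfer_periodM.
by exists w, q, C.
Qed.

(** Each gap persists on a ball of energies, and finitely many balls cover the segment. Multiplying
    the periods and adding the constants gives a common [Q] and [C]. *)
Lemma finite_gap_family a p delta K : (0 < p)%N -> period R a p -> 0 < delta ->
  (forall n, M^-1 + delta <= a n <= M - delta) ->
  exists N (w : nat -> zseq R) Q C, [/\ (0 < Q)%N, 0 < C,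
    forall t, [/\ period R (w t) Q, in_band R M (w t) & forall n, `|a n - w t n| <= delta] &
    forall E, `|E| <= K -> exists2 t, (t < N)%N & bounded_below R (w t) E C].
Proof.
move=> p0 ap d0 aM.
have aM' : in_band R M a by move=> n; have := aM n; move: d0; lra.
have gap E : exists x : zseq R * nat * R * R, [/\ (0 < x.1.1.2)%N, period R x.1.1.1 x.1.1.2,
    in_band R M x.1.1.1, forall n, `|a n - x.1.1.1 n| <= delta &
    [/\ 0 < x.1.2, 0 < x.2 &
    forall E', `|E - E'| < x.2 -> bounded_below R x.1.1.1 E' x.1.2]].
  have [w [q [C [q0 wq wM aw [C0 HC]]]]] := open_gap a p E delta p0 ap d0 aM.
  have [r r0 Hr] := bounded_below_open R w E C (in_band_bounded R M M_gt1 w wM) C0 HC.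
  exists (w, q, 4 * C, r); split => //=; split => //; first lra.
  by move=> E' EE'; apply: Hr; [move=> n; rewrite subrr normr0 ltW | exact: ltW].
have [g Hg] := choice gap.
have cover : cover_compact `[- K, K]%classic by rewrite -compact_cover; exact: segment_compact.
have [|//|D _ HD] := cover R [set: R] (fun E => ball E (g E).2).
- by move=> E _; exact: ball_open.
- move=> E _; exists E => //; apply: ballxx.
  by have [_ _ _ _ []] := Hg E.
have fam (l : seq R) : exists N (w : nat -> zseq R) Q C, [/\ (0 < Q)%N, 0 < C,
    forall t, [/\ period R (w t) Q, in_band R M (w t) & forall n, `|a n - w t n| <= delta] &
    forall E0 E, E0 \in l -> `|E0 - E| < (g E0).2 ->
      exists2 t, (t < N)%N & bounded_below R (w t) E C].
  elim: l => [|E0 l [N [w [Q [C [Q0 C0 Hw HE]]]]]].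
    exists 0%N, (fun=> a), p, 1; split => //.
    by move=> t; split => // n; rewrite subrr normr0 ltW.
  have [q0 vq vM av [C10 r0 Hr]] := Hg E0.
  set v := (g E0).1.1.1 in vq vM av Hr; set q := (g E0).1.1.2 in q0 vq.
  set C1 := (g E0).1.2 in C10 Hr.
  exists N.+1, (fun t => if (t < N)%N then w t else v), (q * Q)%N, (C + C1); split.
  - by rewrite muln_gt0 q0.
  - exact: addr_gt0.
  - move=> t; case: ifP => _; last by split => //; rewrite mulnC; exact: periodM.
    by have [h1 h2 h3] := Hw t; split => //; exact: periodM.
  - move=> E1 E; rewrite inE => /orP[/eqP->|E1l] EE.
      exists N => //; rewrite ltnn.
      by apply: bounded_below_leC (Hr E EE); [exact: in_band_bounded vM | lra].
    have [t tN Ht] := HE E1 E E1l EE.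
    exists t; rewrite ?tN//; first by rewrite ltnS ltnW.
    have [_ h2 _] := Hw t.
    by apply: bounded_below_leC Ht; [exact: in_band_bounded h2 | lra].
have [N [w [Q [C [Q0 C0 Hw HE]]]]] := fam (finmap.enum_fset D).
exists N, w, Q, C; split => // E EK.
have /HD[E0 E0D EE0] : `[- K, K]%classic E by rewrite /= in_itv /= -ler_norml.
exact: (HE E0 E).
Qed.

End FiniteFamily.

(** * Finite windows *)

Section Windows.
Variable R : realType.
Implicit Types (c x y g h : zseq R) (E delta s : R) (m : int) (P k : nat).

Lemma zpart_window g P N :
  zpart g (N * P)%N = zpart (fun k : int => \sum_(0 <= i < P) g (k * P%:Z + i%:Z)) N.
Proof.
have add (n : nat) : zpart g (n + P)%N = zpart g n +
    (\sum_(0 <= i < P) g (n%:Z + i%:Z) + \sum_(0 <= i < P) g (- (n + P)%N%:Z + i%:Z)).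
  elim: P => [|P IH]; first by rewrite addn0 !big_geq// !addr0.
  have e1 : \sum_(0 <= i < P.+1) g (- (n + P).+1%:Z + i%:Z) =
      g (- (n + P)%N%:Z - 1) + \sum_(0 <= i < P) g (- (n + P)%N%:Z + i%:Z).
    rewrite big_nat_recl//; congr (_ + _); first by congr g; lia.
    by apply: eq_bigr => i _; congr g; lia.
  by rewrite addnS zpartS IH e1 big_nat_recr//= -[(n + P)%N%:Z]/(n%:Z + P%:Z); ring.
elim: N => [|N IH]; first by rewrite mul0n !zpart0.
rewrite mulSn addnC add zpartS IH; congr (_ + (_ + _)).
by apply: eq_bigr => i _; congr g; lia.
Qed.

Lemma zbnd_windows g h m P d : (0 < P)%N -> (forall n, 0 <= g n) -> (forall n, 0 <= h n) ->
  (forall k : int, \sum_(0 <= i < P) g (m + k * P%:Z + i%:Z) <=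
                   \sum_(0 <= i < P) h (m + k * P%:Z + i%:Z)) ->
  zbnd R h d -> zbnd R g d.
Proof.
move=> P0 g0 h0 gh hd.
have bh := zbnd_shift R h d m h0 hd.
suff bg : zbnd R (fun n => g (n + m)) d.
  have := zbnd_shift R (fun n => g (n + m)) d (- m) (fun n => g0 _) bg.
  by congr zbnd; apply: funext => n; rewrite subrK.
move=> N; apply: (@le_trans _ _ (zpart (fun n => g (n + m)) (N * P)%N)).
  by apply: zpart_nd => //; rewrite leq_pmulr.
apply: le_trans (bh (N * P)%N); rewrite !zpart_window; apply: le_zpart => k.
have e f : \sum_(0 <= i < P) f (k * P%:Z + i%:Z + m) = \sum_(0 <= i < P) f (m + k * P%:Z + i%:Z) :> R.
  by apply: eq_bigr => i _; congr f; lia.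
by rewrite !e.
Qed.

Definition wdot m P x y := \sum_(0 <= i < P) x (m + i%:Z) * y (m + i%:Z).

Lemma wdotC m P x y : wdot m P x y = wdot m P y x.
Proof. by apply: eq_bigr => i _; rewrite mulrC. Qed.

(* The coefficients linking the window to its complement vanish, so summation by parts
   leaves no boundary term. *)
Lemma wdot_Jop_sym c x y m P : c (m - 1) = 0 -> c (m + P%:Z - 1) = 0 ->
  wdot m P (Jop c x) y = wdot m P x (Jop c y).
Proof.
move=> c0 c1; apply/eqP; rewrite -subr_eq0 /wdot -sumrB; apply/eqP.
pose W (i : nat) := c (m + i%:Z - 1) * (x (m + i%:Z) * y (m + i%:Z - 1) - x (m + i%:Z - 1) * y (m + i%:Z)).
rewrite (eq_bigr (fun i => W i.+1 - W i)); last first.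
  move=> i _; rewrite /W /Jop.
  have -> : m + i.+1%:Z - 1 = m + i%:Z by lia.
  have -> : m + i.+1%:Z = m + i%:Z + 1 by lia.
  by ring.
by rewrite telescope_sumr// /W c1 addr0 c0 !mul0r subrr.
Qed.

Lemma wdot_amgm m P x y t : 0 < t ->
  2 * `|wdot m P x y| <= t^-1 * wdot m P x x + t * wdot m P y y.
Proof.
move=> t0.
have key s : s ^+ 2 = 1 -> 2 * (s * wdot m P x y) <= t^-1 * wdot m P x x + t * wdot m P y y.
  move=> s1; rewrite /wdot !mulr_sumr -big_split /=; apply: ler_sum => i _.
  set a := x _; set b := y _; rewrite -subr_ge0.
  have -> : t^-1 * (a * a) + t * (b * b) - 2 * (s * (a * b)) =
    t^-1 * (a - s * (t * b)) ^+ 2 + (1 - s ^+ 2) * (t * b ^+ 2) by field; rewrite gt_eqF.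
  by rewrite s1 subrr mul0r addr0 mulr_ge0 ?sqr_ge0// invr_ge0 ltW.
have [w0|w0] := leP 0 (wdot m P x y).
  by rewrite ger0_norm//; have := key 1; rewrite expr1n mul1r; exact.
by rewrite ltr0_norm//; have := key (-1); rewrite sqrrN expr1n mulN1r; exact.
Qed.

Definition wshift c E x : zseq R := fun n => Jop c x n - E * x n.

(* [E] is a [delta]-approximate eigenvalue of the finite matrix cut out by the window. *)
Definition approx_eig c m P delta E := exists2 x, wdot m P x x = 1 &
  wdot m P (wshift c E x) (wshift c E x) < delta ^+ 2.

(** By symmetry [(E - E') <x, y> = <(J - E') y, x> - <(J - E) x, y>], and each term is at most
    [delta]. *)
Lemma approx_eig_orth c m P delta E E' x y : c (m - 1) = 0 -> c (m + P%:Z - 1) = 0 -> 0 < delta ->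
  wdot m P x x = 1 -> wdot m P y y = 1 ->
  wdot m P (wshift c E x) (wshift c E x) < delta ^+ 2 ->
  wdot m P (wshift c E' y) (wshift c E' y) < delta ^+ 2 ->
  `|E - E'| * `|wdot m P x y| <= 2 * delta.
Proof.
move=> c0 c1 d0 x1 y1 hx hy.
rewrite -normrM.
have e : (E - E') * wdot m P x y = wdot m P (wshift c E' y) x - wdot m P (wshift c E x) y.
  have ex z E0 v : wdot m P (wshift c E0 z) v = wdot m P (Jop c z) v - E0 * wdot m P z v.
    rewrite /wdot /wshift mulr_sumr -sumrB; apply: eq_bigr => i _; ring.
  rewrite !ex (wdotC _ _ (Jop c y)) -(wdot_Jop_sym c x y)// (wdotC _ _ y x); ring.
have bound z v E0 : wdot m P v v = 1 -> wdot m P (wshift c E0 z) (wshift c E0 z) < delta ^+ 2 ->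
    `|wdot m P (wshift c E0 z) v| <= delta.
  move=> v1 hz; have := wdot_amgm m P (wshift c E0 z) v delta d0.
  rewrite v1 mulr1.
  have : delta^-1 * wdot m P (wshift c E0 z) (wshift c E0 z) <= delta.
    by rewrite ler_pdivrMl// -expr2 ltW.
  lra.
rewrite e (le_trans (ler_normB _ _))//.
by have := bound _ _ _ x1 hy; have := bound _ _ _ y1 hx; lra.
Qed.

(* More than [P] unit vectors in dimension [P] are linearly dependent; approximate
   eigenvectors for well separated energies are nearly orthogonal, hence independent. *)
Lemma approx_eig_separated c m P delta (l : seq R) : (0 < P)%N -> 0 < delta ->
  c (m - 1) = 0 -> c (m + P%:Z - 1) = 0 ->
  (forall E, E \in l -> approx_eig c m P delta E) ->
  pairwise (fun E E' => 4 * P%:R * delta <= `|E - E'|) l -> (size l <= P)%N.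
Proof.
move=> P0 d0 c0 c1 lE sep; rewrite leqNgt; apply/negP => Pl.
have sepE (i j : nat) : (i < size l)%N -> (j < size l)%N -> i != j ->
    4 * P%:R * delta <= `|l`_i - l`_j|.
  wlog ij : i j / (i < j)%N => [H hi hj nij|hi hj _].
    have [h|h|h] := ltngtP i j; [exact: H | by rewrite distrC; apply: H; rewrite // eq_sym |].
    by rewrite h eqxx in nij.
  by move/pairwiseP: sep => /(_ 0 i j); apply.
have /choice[x Hx] : forall i : 'I_P.+1, exists x, wdot m P x x = 1 /\
    wdot m P (wshift c l`_i x) (wshift c l`_i x) < delta ^+ 2.
  move=> i; have [|x x1 hx] := lE l`_i; last by exists x.
  by apply: mem_nth; exact: leq_trans (ltn_ord i) Pl.
pose A : 'M[R]_(P.+1, P) := \matrix_(i, j) x i (m + (j : nat)%:Z).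
have : kermx A != 0.
  rewrite kermx_eq0 /row_free; apply/eqP => h.
  by have := rank_leq_col A; rewrite h ltnn.
move=> /rowV0Pn[v /sub_kermxP vA v0].
have dep (k : 'I_P.+1) : \sum_i v 0 i * wdot m P (x i) (x k) = 0.
  rewrite /wdot; under eq_bigr do rewrite mulr_sumr.
  rewrite exchange_big /=; apply: big1_seq => j /andP[_]; rewrite mem_index_iota => /andP[_ jP].
  under eq_bigr do rewrite mulrA.
  rewrite -mulr_suml.
  have := congr1 (fun B : 'rV[R]_P => B 0 (Ordinal jP)) vA.
  rewrite /= !mxE => h; rewrite (eq_bigr (fun i => v 0 i * A i (Ordinal jP))) ?h ?mul0r//.
  by move=> i _; rewrite !mxE.
(* The dependence is paired with the vector of largest coefficient. Separation makes every other
   inner product at most [1 / (2P)], and the [P] of them cannot cancel that coefficient. *)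
have [i0 _ imax] := @arg_maxP _ _ _ (ord0 : 'I_P.+1) xpredT (fun i => `|v 0 i|) isT.
have vi0 : 0 < `|v 0 i0|.
  rewrite lt_neqAle normr_ge0 andbT eq_sym; apply: contraNneq v0 => h.
  apply/eqP/rowP => j; rewrite mxE; apply/eqP.
  by rewrite -normr_eq0 eq_le normr_ge0 andbT -h; exact: imax.
have := dep i0; rewrite (bigD1 i0)//= (proj1 (Hx i0)) mulr1 => /eqP.
rewrite addr_eq0 => /eqP h.
have : `|v 0 i0| <= \sum_(i < P.+1 | i != i0) `|v 0 i0| * (2 * P%:R)^-1.
  rewrite {1}h normrN (le_trans (ler_norm_sum _ _ _))//; apply: ler_sum => i ii0.
  rewrite normrM; apply: ler_pM => //; first exact: imax.
  have [x1 hx] := Hx i; have [y1 hy] := Hx i0.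
  have := approx_eig_orth c m P delta _ _ _ _ c0 c1 d0 x1 y1 hx hy.
  have := sepE i i0 (leq_trans (ltn_ord i) Pl) (leq_trans (ltn_ord i0) Pl) ii0.
  move: (`|_ - _|) (`|wdot _ _ _ _|) (normr_ge0 (wdot m P (x i) (x i0))) => D w w0 hD hw.
  have Pr : 0 < P%:R :> R by rewrite ltr0n.
  rewrite -[leRHS]div1r ler_pdivlMr ?mulr_gt0//.
  have h1 : 4 * P%:R * delta * w <= 2 * delta by apply: le_trans hw; apply: ler_wpM2r.
  rewrite -(ler_pM2r (mulr_gt0 (ltr0n _ 2 : 0 < 2 :> R) d0)) mul1r; lra.
have Pr : P%:R != 0 :> R by rewrite pnatr_eq0; lia.
rewrite sumr_const cardC1 card_ord -[X in _ <= X]mulr_natr /= -mulrA.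
have -> : (2 * P%:R)^-1 * P%:R = 2^-1 :> R by field.
by lra.
Qed.

(** Greedy choice: take a point of [S] as a centre and continue with the points at distance at least
    [s] from it, whose separated lists are shorter by one. *)
Lemma separated_cover (S : set R) s k : 0 < s ->
  (forall l : seq R, (forall E, E \in l -> S E) ->
     pairwise (fun E E' => s <= `|E - E'|) l -> (size l <= k)%N) ->
  exists2 cs : seq R, (size cs <= k)%N & forall E, S E -> exists2 z, z \in cs & `|E - z| < s.
Proof.
move=> s0; elim: k S => [|k IH] S sep.
  exists [::] => // E SE; suff : (size [:: E] <= 0)%N by [].
  by apply: sep => // E0; rewrite inE => /eqP->.
have [[E0 SE0]|none] := pselect (exists E, S E); last first.
  by exists [::] => // E SE; exfalso; apply: none; exists E.
have [|cs csk Hcs] := IH [set E | S E /\ s <= `|E0 - E|].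
  move=> l lS pl.
  suff : (size (E0 :: l) <= k.+1)%N by [].
  apply: sep => [E|/=]; first by rewrite inE => /orP[/eqP-> //|/lS[]].
  by rewrite pl andbT; apply/allP => E /lS[].
exists (E0 :: cs) => // E SE.
have [h|h] := ltP `|E0 - E| s; first by exists E0; rewrite ?inE ?eqxx// distrC.
by have [z zc hz] := Hcs E (conj SE h); exists z; rewrite // inE zc orbT.
Qed.

Lemma approx_eig_cover c m P delta : (0 < P)%N -> 0 < delta ->
  c (m - 1) = 0 -> c (m + P%:Z - 1) = 0 ->
  exists2 cs : seq R, (size cs <= P)%N &
    forall E, approx_eig c m P delta E -> exists2 z, z \in cs & `|E - z| < 4 * P%:R * delta.
Proof.
move=> P0 d0 c0 c1; apply: separated_cover; first by rewrite !mulr_gt0// ltr0n.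
by move=> l lE sep; apply: approx_eig_separated lE sep.
Qed.

Lemma not_approx_eig c m P delta E x : ~ approx_eig c m P delta E ->
  delta ^+ 2 * wdot m P x x <= wdot m P (wshift c E x) (wshift c E x).
Proof.
move=> nE.
have w0 z : 0 <= wdot m P z z by apply: sumr_ge0 => i _; rewrite -expr2 sqr_ge0.
have := w0 x; rewrite le_eqVlt => /orP[/eqP<-|x0]; first by rewrite mulr0.
rewrite leNgt; apply/negP => h; apply: nE.
pose r := (Num.sqrt (wdot m P x x))^-1.
have r2 : r ^+ 2 = (wdot m P x x)^-1 by rewrite exprVn sqr_sqrtr// ltW.
have sc z : wdot m P (fun n => r * z n) (fun n => r * z n) = r ^+ 2 * wdot m P z z.
  by rewrite /wdot mulr_sumr; apply: eq_bigr => i _; ring.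
exists (fun n => r * x n); first by rewrite sc r2 mulVf// gt_eqF.
have -> : wshift c E (fun n => r * x n) = (fun n => r * wshift c E x n).
  by apply: funext => n; rewrite /wshift /Jop; ring.
by rewrite sc r2 ltr_pdivrMl// mulrC.
Qed.

(* By periodicity all translates of the window carry the same finite matrix. *)
Lemma window_bounded_below c m P delta E : (0 < P)%N -> 0 < delta -> period R c P ->
  zbounded R c -> ~ approx_eig c m P delta E -> bounded_below R c E (delta ^+ 2)^-1.
Proof.
move=> P0 d0 cP cb nE u lu.
have d2 : 0 < delta ^+ 2 by rewrite exprn_gt0.
set f := fun n => Jop c u n - E * u n.
have lf : in_l2 f by exact: in_l2_Jshift.
have perk (k : int) n : c (n + k * P%:Z) = c n.
  case: k => k; first by rewrite -PoszM; exact: periodM.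
  rewrite NegzE mulNr -PoszM; apply: period_opp; exact: periodM.
rewrite ler_pdivlMl// /l2norm2 -zsumZ//.
apply: zsum_le => [n|]; first by rewrite mulr_ge0 ?sqr_ge0 ?ltW.
apply: (zbnd_windows _ (fun n => f n ^+ 2) m P) => //.
- by move=> n; rewrite mulr_ge0 ?sqr_ge0 ?ltW.
- by move=> n; exact: sqr_ge0.
- move=> k; set x := fun n => u (n + k * P%:Z).
  have wfx : wshift c E x = fun n => f (n + k * P%:Z).
    apply: funext => n; rewrite /wshift /f /x /Jop (_ : n + k * P%:Z - 1 = n - 1 + k * P%:Z); last by lia.
    by rewrite (_ : n + k * P%:Z + 1 = n + 1 + k * P%:Z) ?perk//; lia.
  have := not_approx_eig c m P delta E x nE; rewrite wfx /wdot mulr_sumr.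
  congr (_ <= _); apply: eq_bigr => i _; rewrite -expr2; last by rewrite addrAC.
  by rewrite /x (addrAC m i%:Z).
- exact: zbnd_l2norm2.
Qed.

End Windows.

(** * Localization near a cut *)

Section Localization.
Variables (R : realType) (M : R).
Hypothesis M_gt1 : 1 < M.
Implicit Types (a b w u phi : zseq R) (E C kap eta : R) (n : int).

Lemma in_l2M1 phi u : (forall n, 0 <= phi n <= 1) -> in_l2 u -> in_l2 (fun n => phi n * u n).
Proof.
move=> h; apply: (in_l2M R 1) => n; have /andP[h0 h1] := h n.
by rewrite ger0_norm.
Qed.

Lemma sqrD5_le (x y z s t : R) : (x + y + z + s + t) ^+ 2 <=
  5 * x ^+ 2 + 5 * y ^+ 2 + 5 * z ^+ 2 + 5 * s ^+ 2 + 5 * t ^+ 2.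
Proof.
have := sqr_ge0 (x - y); have := sqr_ge0 (x - z); have := sqr_ge0 (x - s); have := sqr_ge0 (x - t).
have := sqr_ge0 (y - z); have := sqr_ge0 (y - s); have := sqr_ge0 (y - t).
by have := sqr_ge0 (z - s); have := sqr_ge0 (z - t); have := sqr_ge0 (s - t); lra.
Qed.

(* Combes-Thomas: conjugating by the slowly varying weight [phi] changes [J_w - E] by a
   small operator, and [phi] is tiny where [b] differs from [w]. *)
Lemma localized_bound w b phi u E C kap eta :
  in_band R M w -> in_band R M b -> 0 <= C -> bounded_below R w E C -> in_l2 u ->
  (forall n, 0 <= phi n <= 1) ->
  (forall n, `|phi (n + 1) - phi n| <= kap * phi n) ->
  (forall n, `|phi (n + 1) - phi n| <= kap * phi (n + 1)) ->
  (forall n, phi n * `|w n - b n| <= eta) ->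
  (forall n, phi (n + 1) * `|w n - b n| <= eta) ->
  20 * C * (M ^+ 2 * kap ^+ 2) <= 1 ->
  l2norm2 (fun n => phi n * u n) <=
    10 * C * l2norm2 (fun n => Jop b u n - E * u n) + 20 * C * eta ^+ 2 * l2norm2 u.
Proof.
move=> wM bM C0 HC lu phi01 k1 k2 e1 e2 small.
have lpu : in_l2 (fun n => phi n * u n) by exact: in_l2M1.
set v := fun n => phi n * u n in lpu *.
set f := fun n => Jop b u n - E * u n.
have lf : in_l2 f by apply: in_l2_Jshift => //; exact: in_band_bounded bM.
have bf := zbnd_l2norm2 _ _ lf; have bu := zbnd_l2norm2 _ _ lu; have bv := zbnd_l2norm2 _ _ lpu.
set F := l2norm2 f in bf *; set N := l2norm2 u in bu *; set W := l2norm2 v in bv *.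
have W0 := zbnd_ge0 _ _ _ bv.
have u0 n : 0 <= u n ^+ 2 := sqr_ge0 _; have v0 n : 0 <= v n ^+ 2 := sqr_ge0 _.
pose A := M ^+ 2 * kap ^+ 2.
have A0 : 0 <= 5 * A by rewrite mulr_ge0// mulr_ge0 ?sqr_ge0.
have B0 : 0 <= 5 * eta ^+ 2 by rewrite mulr_ge0// sqr_ge0.
have key : zbnd R (fun n => (Jop w v n - E * v n) ^+ 2) (5 * F + 10 * A * W + 10 * eta ^+ 2 * N).
  have z1 := zbndZ _ _ _ 5 ltac:(lra) bf.
  have z2 := zbndZ _ _ _ _ A0 (zbnd_shift _ _ _ (-1) v0 bv).
  have z3 := zbndZ _ _ _ _ A0 (zbnd_shift _ _ _ 1 v0 bv).
  have z4 := zbndZ _ _ _ _ B0 (zbnd_shift _ _ _ (-1) u0 bu).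
  have z5 := zbndZ _ _ _ _ B0 (zbnd_shift _ _ _ 1 u0 bu).
  apply: zbnd_le (zbndD _ _ _ _ _ (zbndD _ _ _ _ _ (zbndD _ _ _ _ _ (zbndD _ _ _ _ _ z1 z2) z3) z4) z5);
    last by lra.
  move=> n /=.
  (* The weighted equation, the two commutator terms from the drift of [phi], and the two terms from
     [w - b] damped by [phi]. *)
  have -> : Jop w v n - E * v n = phi n * f n + w (n - 1) * (phi (n - 1) - phi n) * u (n - 1) +
      w n * (phi (n + 1) - phi n) * u (n + 1) + phi n * (w (n - 1) - b (n - 1)) * u (n - 1) +
      phi n * (w n - b n) * u (n + 1).
    by rewrite /v /f /Jop; ring.
  apply: le_trans (sqrD5_le _ _ _ _ _) _.
  have t1 : (phi n * f n) ^+ 2 <= f n ^+ 2.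
    have /andP[p0 p1] := phi01 n.
    by have := sqrM_le _ (phi n) (f n) 1; rewrite expr1n mul1r; apply; rewrite ger0_norm.
  have drift m d : 0 <= phi m -> `|d| <= kap * phi m -> forall k,
      (w k * d * u m) ^+ 2 <= A * v m ^+ 2.
    move=> p0 dk k; rewrite /A /v.
    have -> : M ^+ 2 * kap ^+ 2 * (phi m * u m) ^+ 2 = (M * (kap * phi m)) ^+ 2 * u m ^+ 2 by ring.
    by apply: sqrM_le; rewrite normrM ler_pM// in_band_norm.
  have t2 := drift (n - 1) (phi (n - 1) - phi n).
  have t3 := drift (n + 1) (phi (n + 1) - phi n).
  have {}t2 : (w (n - 1) * (phi (n - 1) - phi n) * u (n - 1)) ^+ 2 <= A * v (n - 1) ^+ 2.
    apply: t2; first by have /andP[] := phi01 (n - 1).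
    by rewrite distrC; have := k1 (n - 1); rewrite subrK.
  have {}t3 : (w n * (phi (n + 1) - phi n) * u (n + 1)) ^+ 2 <= A * v (n + 1) ^+ 2.
    by apply: t3; first by have /andP[] := phi01 (n + 1).
  have diff m k x : phi m * `|w k - b k| <= eta -> (phi m * (w k - b k) * x) ^+ 2 <= eta ^+ 2 * x ^+ 2.
    move=> h; apply: sqrM_le; rewrite normrM ger0_norm//.
    by have /andP[] := phi01 m.
  have t4 := diff n (n - 1) (u (n - 1)).
  have {}t4 : (phi n * (w (n - 1) - b (n - 1)) * u (n - 1)) ^+ 2 <= eta ^+ 2 * u (n - 1) ^+ 2.
    by apply: t4; have := e2 (n - 1); rewrite subrK.
  have t5 := diff n n (u (n + 1)) (e1 n).
  lra.
have := HC v lpu; have := l2norm2_le _ _ _ key; rewrite -/W => h1 h2.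
have h3 := ler_wpM2l C0 h1.
have h4 : 20 * C * A * W <= 1 * W by rewrite ler_wpM2r.
lra.
Qed.

(** [b] and [c] differ only where [phi] is of order one, so the error [(b - c) u] is controlled by
    [phi u]. *)
Lemma cut_norm_le b c phi u E : in_band R M b -> zbounded R c -> in_l2 u ->
  (forall n, 0 <= phi n <= 1) ->
  (forall n, `|b n - c n| <= 2 * M * phi n) -> (forall n, `|b n - c n| <= 2 * M * phi (n + 1)) ->
  l2norm2 (fun n => Jop c u n - E * u n) <=
    3 * l2norm2 (fun n => Jop b u n - E * u n) + 24 * M ^+ 2 * l2norm2 (fun n => phi n * u n).
Proof.
move=> bM cB lu phi01 c1 c2.
have lpu : in_l2 (fun n => phi n * u n) by exact: in_l2M1.
set v := fun n => phi n * u n in lpu *.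
set f := fun n => Jop b u n - E * u n.
have lf : in_l2 f by apply: in_l2_Jshift => //; exact: in_band_bounded bM.
have bf := zbnd_l2norm2 _ _ lf; have bv := zbnd_l2norm2 _ _ lpu.
have v0 n : 0 <= v n ^+ 2 := sqr_ge0 _.
have M0 : 0 <= 12 * M ^+ 2 by rewrite mulr_ge0// sqr_ge0.
apply: l2norm2_le.
have z1 := zbndZ _ _ _ 3 ltac:(lra) bf.
have z2 := zbndZ _ _ _ _ M0 (zbnd_shift _ _ _ (-1) v0 bv).
have z3 := zbndZ _ _ _ _ M0 (zbnd_shift _ _ _ 1 v0 bv).
apply: zbnd_le (zbndD _ _ _ _ _ (zbndD _ _ _ _ _ z1 z2) z3); last by lra.
move=> n /=.
have -> : Jop c u n - E * u n = f n + - (b (n - 1) - c (n - 1)) * u (n - 1) + - (b n - c n) * u (n + 1).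
  by rewrite /f /Jop; ring.
apply: le_trans (sqrD3_le _ _ _ _) _.
have cut m k : `|b k - c k| <= 2 * M * phi m -> (- (b k - c k) * u m) ^+ 2 <= 4 * M ^+ 2 * v m ^+ 2.
  move=> h; rewrite /v.
  have -> : 4 * M ^+ 2 * (phi m * u m) ^+ 2 = (2 * M * phi m) ^+ 2 * u m ^+ 2 by ring.
  by apply: sqrM_le; rewrite normrN.
by have := cut _ _ (c1 (n - 1)); have := cut _ _ (c2 n); lra.
Qed.

(** Chain the bound for [c], [cut_norm_le] and [localized_bound]. The terms in [l2norm2 u] add up to
    [480 M^2 C eta^2], which the last hypothesis makes half of [delta^2], so they are absorbed. *)
Lemma cut_bounded_below w b c phi E C kap eta delta :
  in_band R M w -> in_band R M b -> zbounded R c -> 0 < C -> 0 < delta ->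
  bounded_below R w E C -> bounded_below R c E (delta ^+ 2)^-1 ->
  (forall n, 0 <= phi n <= 1) ->
  (forall n, `|phi (n + 1) - phi n| <= kap * phi n) ->
  (forall n, `|phi (n + 1) - phi n| <= kap * phi (n + 1)) ->
  (forall n, phi n * `|w n - b n| <= eta) ->
  (forall n, phi (n + 1) * `|w n - b n| <= eta) ->
  (forall n, `|b n - c n| <= 2 * M * phi n) -> (forall n, `|b n - c n| <= 2 * M * phi (n + 1)) ->
  20 * C * (M ^+ 2 * kap ^+ 2) <= 1 -> 960 * M ^+ 2 * C * eta ^+ 2 = delta ^+ 2 ->
  bounded_below R b E (2 * (3 + 240 * M ^+ 2 * C) / delta ^+ 2).
Proof.
move=> wM bM cB C0 d0 Hw Hc phi01 k1 k2 e1 e2 c1 c2 small de u lu.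
have d2 : 0 < delta ^+ 2 by rewrite exprn_gt0.
have h1 := localized_bound _ _ _ _ _ _ _ _ wM bM (ltW C0) Hw lu phi01 k1 k2 e1 e2 small.
have h2 := cut_norm_le _ _ _ _ E bM cB lu phi01 c1 c2.
have h3 := Hc u lu; rewrite ler_pdivlMl// in h3.
rewrite mulrAC ler_pdivlMr//.
have M0 : 0 <= 24 * M ^+ 2 by rewrite mulr_ge0// sqr_ge0.
have h4 := ler_wpM2l M0 h1.
rewrite -de in h3 *; lra.
Qed.

End Localization.

(** * Distance to the periodic set of cuts *)

Section CircularDistance.
Implicit Types (m n : int) (P h t N : nat).

(* Distance from [n] to [m + P Z]. *)
Definition cdist P m n : nat := let r := `|((n - m) %% P)%Z|%N in minn r (P - r).

Lemma modz_lt P n : (0 < P)%N -> exists2 r : nat, (r < P)%N & (n %% P)%Z = r%:Z.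
Proof.
move=> P0; have h0 : (0 <= (n %% P)%Z) by rewrite modz_ge0//; lia.
have h1 : (n %% P)%Z < P by rewrite ltz_pmod.
by exists `|(n %% P)%Z|%N; lia.
Qed.

Lemma modzS P n r : (r < P)%N -> (n %% P)%Z = r%:Z ->
  ((n + 1) %% P)%Z = (if r.+1 == P then 0%N else r.+1)%:Z.
Proof.
move=> rP nr; rewrite -modzDml nr; case: eqP => [<-|h].
  by rewrite (_ : r%:Z + 1 = r.+1%:Z) ?modzz//; lia.
by rewrite (_ : r%:Z + 1 = r.+1%:Z) ?modz_small//; lia.
Qed.

Lemma cdistS P m n : (0 < P)%N ->
  (cdist P m (n + 1) <= (cdist P m n).+1)%N /\ (cdist P m n <= (cdist P m (n + 1)).+1)%N.
Proof.
move=> P0; have [r rP nr] := modz_lt P (n - m) P0.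
have e : n + 1 - m = n - m + 1 by lia.
rewrite /cdist e (modzS P _ r)// nr; case: eqP => h /=; rewrite ?absz_nat; lia.
Qed.

Lemma cdist0 P m n : (P%:Z %| n - m)%Z -> cdist P m n = 0%N.
Proof. by rewrite /cdist => /dvdz_mod0P->; rewrite min0n. Qed.

(** The cut sits at the middle [(2t + 1) h] of the [t]-th block, which has length [2h]. *)
Lemma cdist_far N h t n : (0 < h)%N -> (t < N)%N ->
  (`|(n %% (N * (2 * h))%N)%Z| %/ (2 * h))%N != t ->
  (h <= cdist (N * (2 * h)) ((2 * t + 1) * h)%N n)%N.
Proof.
move=> h0 tN; set P := (N * (2 * h))%N.
have P0 : (0 < P)%N by rewrite !muln_gt0 h0; lia.
have [r rP nr] := modz_lt P n P0; rewrite nr absz_nat.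
set m := ((2 * t + 1) * h)%N.
have hP : ((2 * t + 2) * h <= P)%N.
  by rewrite /P mulnA leq_mul2r; apply/orP; right; lia.
have em : m = ((2 * t) * h + h)%N by rewrite /m mulnDl mul1n.
have eP : ((2 * t + 2) * h = (2 * t) * h + h + h)%N by lia.
rewrite /cdist -modzDml nr.
rewrite neq_ltn => /orP[lt|gt].
  have rt : (r < (2 * t) * h)%N by move: lt; rewrite ltn_divLR ?muln_gt0 ?h0//; lia.
  have -> : (r%:Z - m%:Z) = (-1) * P%:Z + (r + P - m)%N%:Z by lia.
  rewrite modzMDl modz_small; last by apply/andP; split; lia.
  by rewrite absz_nat; lia.
have rt : ((2 * t + 2) * h <= r)%N.
  by move: gt; rewrite leq_divRL ?muln_gt0 ?h0//; lia.
have -> : (r%:Z - m%:Z) = (r - m)%N%:Z by lia.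
rewrite modz_small; last by apply/andP; split; lia.
by rewrite absz_nat; lia.
Qed.

End CircularDistance.

(** * Periodic sequences with thin spectrum *)

Section ThinSpectrum.
Variables (R : realType) (M : R).
Hypothesis M_gt1 : 1 < M.
Implicit Types (a b w u : zseq R) (E C eps delta r : R) (n : int).

(** Off the intervals a uniform lower bound is required, not mere absence of spectrum: then the same
    intervals serve for all nearby sequences. *)
Definition thin_cover a eps := exists (cs : seq R) (s C : R), [/\ 0 < s, 0 < C,
  (size cs)%:R * (2 * s) <= eps &
  forall E, (forall z, z \in cs -> s <= `|E - z|) -> bounded_below R a E C].

(** [1 - r^L] is [1 - r] times a geometric sum of [L] terms, each at least [r^L]. *)
Lemma mul_expr_le (r : R) L : 0 <= r < 1 -> (1 - r) * (L%:R * r ^+ L) <= 1 - r ^+ L.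
Proof.
move=> /andP[r0 r1]; elim: L => [|L IH]; first by rewrite mul0r mulr0 expr0 subrr.
rewrite -natr1 exprS.
have q0 : 0 <= r ^+ L by exact: exprn_ge0.
have q1 : r ^+ L <= 1 by apply: exprn_ile1 => //; exact: ltW.
have h := ler_wpM2l r0 IH.
have rq : r * r ^+ L <= 1 by rewrite -exprS exprn_ile1// ltW.
have : r * r ^+ L * (1 - r) <= 1 * (1 - r) by rewrite ler_wpM2r// subr_ge0 ltW.
move: h; set q := r ^+ L; set l := L%:R; lra.
Qed.

(** Two of the three factors [r^L] compensate [L^2], and the third tends to 0. This is why the decay
    rate is later taken to be a cube. *)
Lemma sqr_mul_expr_small r c eps : 0 < r < 1 -> 0 <= c -> 0 < eps ->
  exists2 L : nat, (0 < L)%N & c * (L%:R ^+ 2 * (r ^+ 3) ^+ L) <= eps.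
Proof.
move=> /andP[r0 r1] c0 e0.
pose d := c / (1 - r) ^+ 2.
have q0 : 0 < (1 - r) ^+ 2 by rewrite exprn_gt0// subr_gt0.
have d0 : 0 <= d by rewrite divr_ge0// ltW.
have [N HN] : exists N, forall k, (N <= k)%N -> d * r ^+ k <= eps.
  have /cvgrPdist_lt/(_ _ e0)[N _ HN] : (fun k : nat => d * r ^+ k) @ \oo --> (d * 0 : R).
    apply: cvgM; first exact: cvg_cst.
    by apply: cvg_expr; rewrite ger0_norm// ltW.
  exists N => k Nk; move: (HN k Nk); rewrite mulr0 sub0r normrN => /ltW; apply: le_trans.
  exact: ler_norm.
exists N.+1 => //; apply: le_trans (HN N.+1 (leqnSn _)).
set L := N.+1.
have p0 : 0 <= r ^+ L by apply: exprn_ge0; exact: ltW.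
have h : (1 - r) * (L%:R * r ^+ L) <= 1.
  by apply: le_trans (mul_expr_le r L _) _; [rewrite (ltW r0) r1 | rewrite gerBl].
have h0 : 0 <= (1 - r) * (L%:R * r ^+ L).
  by apply: mulr_ge0; [rewrite subr_ge0 ltW | apply: mulr_ge0].
have h2 : ((1 - r) * (L%:R * r ^+ L)) ^+ 2 <= 1 by rewrite exprn_ile1.
have e1 : c * (L%:R ^+ 2 * (r ^+ 3) ^+ L) = d * r ^+ L * ((1 - r) * (L%:R * r ^+ L)) ^+ 2.
  rewrite -exprM mulnC exprM /d; field; lra.
by rewrite e1 ler_piMr// mulr_ge0.
Qed.

Lemma expr_drift (rho : R) (i j : nat) : 0 < rho <= 1 -> (i <= j.+1)%N -> (j <= i.+1)%N ->
  `|rho ^+ i - rho ^+ j| <= (rho^-1 - 1) * rho ^+ j.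
Proof.
move=> /andP[r0 r1] ij ji.
have q k : 0 < rho ^+ k by rewrite exprn_gt0.
have ri : 1 <= rho^-1 by rewrite -[leLHS]invr1 lef_pV2 ?posrE.
have [e|[e|e]] : i = j \/ i = j.+1 \/ j = i.+1 by lia.
- by rewrite e subrr normr0 mulr_ge0 ?(ltW (q _))// subr_ge0.
- rewrite e exprS -{2}(mul1r (rho ^+ j)) -mulrBl normrM (ger0_norm (ltW (q _))).
  rewrite ler_wpM2r ?(ltW (q _))// ler0_norm ?subr_le0// opprB.
  have : rho * rho^-1 = 1 by rewrite mulfV// gt_eqF.
  nra.
- rewrite e exprS mulrBl mul1r mulKf ?gt_eqF// ger0_norm ?subr_ge0//.
  by rewrite ler_piMl// ltW.
Qed.

Section Concatenation.
Variables (N : nat) (w : nat -> zseq R) (Q L : nat).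
Hypothesis wQ : forall t, period R (w t) Q.
Hypothesis wM : forall t, in_band R M (w t).

Let h := (L * Q)%N.
Let P := (N * (2 * h))%N.

(** The block index is read off the residue modulo [P], while [w] is evaluated at [n] itself; this
    is [P]-periodic because [P] is a multiple of [Q]. *)
Definition concat : zseq R := fun n => w (`|(n %% P)%Z| %/ (2 * h))%N n.

Lemma concat_period : period R concat P.
Proof.
move=> n; rewrite /concat modzDr; set t := (_ %/ _)%N.
have -> : P = ((N * 2 * L) * Q)%N by rewrite /P /h !mulnA.
exact: periodM.
Qed.

Lemma concat_band : in_band R M concat.
Proof. by move=> n; exact: wM. Qed.

(** With [m = (2t + 1) h], the vanishing coefficients have index [m - 1] modulo [P]: they are the
    bonds joining [m - 1] to [m] and their translates. *)
Definition cut_concat t : zseq R := fun n =>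
  if (P%:Z %| n - ((2 * t + 1) * h)%N%:Z + 1)%Z then 0 else concat n.

Lemma cut_concat_period t : period R (cut_concat t) P.
Proof.
move=> n; rewrite /cut_concat concat_period.
set m : int := ((2 * t + 1) * h)%N.
have -> : n + P%:Z - m + 1 = n - m + 1 + P%:Z by lia.
by rewrite rpredDr// dvdzz.
Qed.

Lemma cut_concat_bounded t : zbounded R (cut_concat t).
Proof.
exists M => n; rewrite /cut_concat; case: ifP => _.
  by rewrite normr0; move: M_gt1; lra.
exact: in_band_norm M_gt1 _ _ concat_band.
Qed.

Lemma cut_concatl t : cut_concat t (((2 * t + 1) * h)%N%:Z - 1) = 0.
Proof.
by rewrite /cut_concat addrAC addrK subrr dvdz0.
Qed.

Lemma cut_concatr t : cut_concat t (((2 * t + 1) * h)%N%:Z + P%:Z - 1) = 0.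
Proof.
set m : int := ((2 * t + 1) * h)%N.
have e : m + P%:Z - 1 - m + 1 = P%:Z by lia.
by rewrite /cut_concat -/m e dvdzz.
Qed.

Variable C : R.
Hypotheses (N0 : (0 < N)%N) (Q0 : (0 < Q)%N) (L0 : (0 < L)%N) (C0 : 0 < C).

Let h0 : (0 < h)%N. Proof. by rewrite muln_gt0 L0. Qed.
Let P0 : (0 < P)%N. Proof. by rewrite muln_gt0 N0 muln_gt0 h0. Qed.

(** The weight is [rho] to the power of the distance to the cuts: at least [rho >= 1/2] at both ends
    of a cut bond, and at most [rho^L] outside block [t], since [h >= L]. *)
Lemma concat_bounded_below t E rho delta : (t < N)%N -> 2^-1 <= rho -> rho < 1 ->
  20 * C * (M ^+ 2 * (rho^-1 - 1) ^+ 2) <= 1 -> 0 < delta ->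
  960 * M ^+ 2 * C * (2 * M * rho ^+ L) ^+ 2 = delta ^+ 2 ->
  bounded_below R (w t) E C ->
  ~ approx_eig R (cut_concat t) ((2 * t + 1) * h)%N P delta E ->
  bounded_below R concat E (2 * (3 + 240 * M ^+ 2 * C) / delta ^+ 2).
Proof.
move=> tN rho2 rho1 small d0 de Hw nE.
set m : int := ((2 * t + 1) * h)%N.
have r0 : 0 < rho by lra.
have r01 : 0 < rho <= 1 by rewrite r0 ltW.
have M0 : 0 < M by move: M_gt1; lra.
pose phi n : R := rho ^+ cdist P m n.
have phi01 n : 0 <= phi n <= 1.
  by rewrite /phi exprn_ge0 ?(ltW r0)// exprn_ile1 ?(ltW r0) ?(ltW rho1).
have Hc := window_bounded_below R (cut_concat t) m P delta E P0 d0 (cut_concat_period t)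
  (cut_concat_bounded t) nE.
have dcut n : `|concat n - cut_concat t n| <= M /\
    (concat n != cut_concat t n -> (P%:Z %| n + 1 - m)%Z).
  rewrite /cut_concat -/m (_ : n - m + 1 = n + 1 - m); last by lia.
  case: ifP => [_|_]; first by split => //; rewrite subr0; exact: in_band_norm M_gt1 _ _ concat_band.
  by rewrite subrr normr0 eqxx; split => //; exact: ltW.
have wdiff n : `|w t n - concat n| <= M.
  have /andP[x1 x2] := wM t n; have /andP[y1 y2] := concat_band n.
  have := in_band_gt0 R M M_gt1 _ n (wM t); have := in_band_gt0 R M M_gt1 _ n concat_band.
  by rewrite ler_norml; lra.
have far n : w t n != concat n -> (h <= cdist P m n)%N.
  move=> ne; apply: cdist_far => //; apply: contra_neq ne => e.
  by rewrite /concat e.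
have rL : 0 < rho ^+ L by rewrite exprn_gt0.
have hL : (L <= h)%N by rewrite leq_pmulr.
have decay k : (h <= k)%N -> rho ^+ k <= rho ^+ L.
  by move=> hk; apply: ler_wiXn2l; [exact: ltW | exact: ltW | exact: leq_trans hL hk].
apply: (@cut_bounded_below R M M_gt1 (w t) concat (cut_concat t) phi E C (rho^-1 - 1)
  (2 * M * rho ^+ L) delta) => //.
- exact: concat_band.
- exact: cut_concat_bounded.
- by move=> n; have [h1 h2] := cdistS P m n P0; apply: expr_drift.
- by move=> n; have [h1 h2] := cdistS P m n P0; rewrite distrC; apply: expr_drift.
- move=> n; have [->|ne] := eqVneq (w t n) (concat n).
    by rewrite subrr normr0 mulr0 !mulr_ge0 ?(ltW rL) ?(ltW M0).
  apply: (@le_trans _ _ (rho ^+ L * M)).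
    by apply: ler_pM => //; [rewrite exprn_ge0 ?(ltW r0) | exact/decay/far].
  by have := mulr_gt0 M0 rL; lra.
- move=> n; have [->|ne] := eqVneq (w t n) (concat n).
    by rewrite subrr normr0 mulr0 !mulr_ge0 ?(ltW rL) ?(ltW M0).
  (* The point [n + 1] may be one step nearer to the cut, which costs [rho^-1 <= 2]; hence the 2 in
     [2 * M * rho ^+ L]. *)
  have h1 : phi (n + 1) <= 2 * rho ^+ L.
    have [_ h2] := cdistS P m n P0.
    have h3 := far n ne.
    have h4 : rho * phi (n + 1) <= rho ^+ L by rewrite /phi -exprS; apply: decay; exact: leq_trans h3 h2.
    have /andP[h5 _] := phi01 (n + 1).
    nra.
  rewrite (_ : 2 * M * rho ^+ L = 2 * rho ^+ L * M); last by ring.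
  by apply: ler_pM => //; have /andP[] := phi01 (n + 1).
- move=> n; have [h1 h2] := dcut n; have [->|ne] := eqVneq (concat n) (cut_concat t n).
    by rewrite subrr normr0; have /andP[p0 _] := phi01 n; rewrite !mulr_ge0// ltW.
  have z := cdist0 _ _ _ (h2 ne); have [_ h3] := cdistS P m n P0; rewrite z in h3.
  apply: le_trans h1 _.
  (* Here [n + 1] lies on a cut, so [n] is at distance at most 1. *)
  have : rho <= phi n.
    rewrite -[leLHS]expr1 /phi; apply: ler_wiXn2l => //; exact: ltW.
  by nra.
- move=> n; have [h1 h2] := dcut n; have [->|ne] := eqVneq (concat n) (cut_concat t n).
    by rewrite subrr normr0; have /andP[p0 _] := phi01 (n + 1); rewrite !mulr_ge0// ltW.
  rewrite /phi (cdist0 _ _ _ (h2 ne)) expr0 mulr1; lra.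
Qed.

End Concatenation.

(** [N], [Q], [C], and with them the rate [rho], are fixed first. Only then is [L] taken large: the
    total length of the intervals is a constant times [L^2 rho^L]. *)
Lemma thin_density a p delta eps : (0 < p)%N -> period R a p -> 0 < delta ->
  (forall n, M^-1 + delta <= a n <= M - delta) -> 0 < eps ->
  exists b q, [/\ (0 < q)%N, period R b q, in_band R M b, forall n, `|a n - b n| <= delta &
    thin_cover b eps].
Proof.
move=> p0 ap d0 aM e0.
have M1 := M_gt1.
have [N [w [Q [C [Q0 C0 Hw HE]]]]] := finite_gap_family R M M_gt1 a p delta (4 * M + 1) p0 ap d0 aM.
have N0 : (0 < N)%N.
  have [|t tN _] := HE 0; first by rewrite normr0; lra.
  exact: leq_ltn_trans tN.
have wQ t : period R (w t) Q by have [] := Hw t.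
have wM t : in_band R M (w t) by have [] := Hw t.
have wa t n : `|a n - w t n| <= delta by have [_ _] := Hw t.
pose X := 20 * C * M ^+ 2.
have X0 : 0 < X by rewrite !mulr_gt0//; lra.
pose kap := (1 + X)^-1.
have kap0 : 0 < kap by rewrite invr_gt0; lra.
have kap1 : kap <= 1 by rewrite -invr1 lef_pV2 ?posrE//; lra.
have kapX : X * kap ^+ 2 <= 1.
  have e : kap * (1 + X) = 1 by rewrite /kap mulVf// gt_eqF//; lra.
  have h1 : X * kap <= 1 by nra.
  rewrite expr2 mulrA; nra.
pose r := 1 - kap / 6.
have r0 : 0 < r by rewrite /r; lra.
have r1 : r < 1 by rewrite /r; lra.
pose rho := r ^+ 3.
have rhok : 1 - kap / 2 <= rho by rewrite /rho /r; nra.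
have rho2 : 2^-1 <= rho by lra.
have rho1 : rho < 1 by rewrite /rho exprn_ilt1// ltW.
have rhoi : rho^-1 - 1 <= kap.
  have : rho * rho^-1 = 1 by rewrite mulfV// gt_eqF//; lra.
  have : 0 < rho^-1 by rewrite invr_gt0; lra.
  nra.
have rhoi0 : 0 <= rho^-1 - 1.
  by rewrite subr_ge0 -[leLHS]invr1 lef_pV2 ?posrE//; lra.
have small : 20 * C * (M ^+ 2 * (rho^-1 - 1) ^+ 2) <= 1.
  rewrite mulrA -/X; apply: le_trans kapX; rewrite ler_wpM2l ?(ltW X0)//.
  by rewrite lerXn2r ?nnegrE// ltW.
have [y y0 y2] : exists2 y : R, 0 < y & y ^+ 2 = 960 * M ^+ 2 * C.
  have Y0 : 0 < 960 * M ^+ 2 * C by move: X0; rewrite /X; lra.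
  by move: Y0; move: (960 * _ * _) => Y Y0; exists (Num.sqrt Y); rewrite ?sqrtr_gt0// sqr_sqrtr// ltW.
pose c1 := y * (2 * M).
have c10 : 0 < c1 by apply: mulr_gt0 => //; lra.
(* There are at most [N * P] intervals of length [8 * P * dl]; with [P = 2 N L Q] and
   [dl = c1 rho^L] the total is [c2 L^2 rho^L]. *)
pose c2 := 32 * (N%:R ^+ 3 * Q%:R ^+ 2) * c1.
have c20 : 0 <= c2.
  rewrite /c2; apply: mulr_ge0 (ltW c10); apply: mulr_ge0; first by [].
  by apply: mulr_ge0; exact: exprn_ge0.
have [L L0 HL] := sqr_mul_expr_small r c2 eps ltac:(by rewrite r0 r1) c20 e0.
pose dl := c1 * rho ^+ L.
have rho0 : 0 < rho by lra.
have dl0 : 0 < dl by rewrite /dl mulr_gt0// exprn_gt0.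
have de : 960 * M ^+ 2 * C * (2 * M * rho ^+ L) ^+ 2 = dl ^+ 2.
  by rewrite -y2 -exprMn /dl /c1 !mulrA.
pose b := concat N w Q L.
pose h := (L * Q)%N; pose P := (N * (2 * h))%N.
have P0 : (0 < P)%N by rewrite !muln_gt0 L0 Q0 N0.
have bM : in_band R M b by exact: concat_band.
exists b, P; split => //; [exact: concat_period | by move=> n; exact: wa |].
pose c t := cut_concat N w Q L t.
have /choice[cs Hcs] : forall t, exists cs : seq R, (size cs <= P)%N /\
    forall E, approx_eig R (c t) ((2 * t + 1) * h)%N P dl E ->
      exists2 z, z \in cs & `|E - z| < 4 * P%:R * dl.
  move=> t; have [cs cs1 cs2] := approx_eig_cover R (c t) ((2 * t + 1) * h)%N P dl P0 dl0
    (cut_concatl _ _ _ _ _) (cut_concatr _ _ _ _ _).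
  by exists cs.
(* The summand 2 serves the energies beyond [4 * M + 1], the other one those reached by the finite
   family. *)
pose C' := 2 + 2 * (3 + 240 * M ^+ 2 * C) / dl ^+ 2.
have D0 : 0 <= 2 * (3 + 240 * M ^+ 2 * C) / dl ^+ 2.
  by apply: divr_ge0; [have := X0; rewrite /X; lra | exact: sqr_ge0].
have Pr : 0 < P%:R :> R by rewrite ltr0n.
exists (flatten [seq cs t | t <- iota 0 N]), (4 * P%:R * dl), C'; split.
- by apply: mulr_gt0 => //; exact: mulr_gt0.
- by rewrite /C'; lra.
- apply: le_trans HL.
  have sz : (size (flatten [seq cs t | t <- iota 0 N]) <= N * P)%N.
    rewrite size_flatten /shape -map_comp sumnE big_map.
    apply: (@leq_trans (\sum_(j <- iota 0 N) P)); first by apply: leq_sum => t _; have [] := Hcs t.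
    by rewrite big_const_seq count_predT size_iota iter_addn_0 mulnC.
  have szr : (size (flatten [seq cs t | t <- iota 0 N]))%:R <= N%:R * P%:R :> R.
    by rewrite -natrM ler_nat.
  have s0 : 0 <= 2 * (4 * P%:R * dl).
    by apply: mulr_ge0 => //; apply: mulr_ge0 (ltW dl0); exact: mulr_ge0.
  apply: le_trans (ler_wpM2r s0 szr) _.
  rewrite /c2 /dl /P /h !natrM -/rho.
  rewrite le_eqVlt; apply/orP; left; apply/eqP; ring.
- move=> E HEz.
  have bB : zbounded R b := in_band_bounded R M M_gt1 b bM.
  have [EK|EK] := leP `|E| (4 * M + 1); last first.
    apply: (@bounded_below_leC R b E 2) => //; first by rewrite /C'; lra.
    apply: (bounded_below_far R b E M); last exact: ltW.
    by move=> n; exact: in_band_norm M_gt1 _ _ bM.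
  have [t tN Ht] := HE E EK.
  apply: (@bounded_below_leC R b E (2 * (3 + 240 * M ^+ 2 * C) / dl ^+ 2)) => //.
    by rewrite /C'; lra.
  apply: (@concat_bounded_below N w Q L wQ wM C N0 Q0 L0 C0 t E rho dl) => //.
  move=> /(proj2 (Hcs t))[z zc]; rewrite ltNge => /negP; apply; apply: HEz.
  by apply/flattenP; exists (cs t) => //; apply: map_f; rewrite mem_iota.
Qed.

End ThinSpectrum.

(** * Genericity *)

Section Baire.
Variable R : realType.
Implicit Types (X U : set (zseq R)) (a b : zseq R) (e r : R) (k : nat).

(** Taking the interior makes the sets open by construction; it then suffices to find interior
    points of [P] near every point of [X]. *)
Definition rel_interior X (P : zseq R -> Prop) : set (zseq R) := [set a | X a /\
  exists2 r, 0 < r & forall b, X b -> (forall n, `|a n - b n| <= r) -> P b].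

Lemma rel_interior_open X P : rel_open X (rel_interior X P).
Proof.
split=> [a [] //|a [Xa [r r0 Hr]]].
have r2 : 0 < r / 2 by rewrite divr_gt0.
exists (r / 2) => // b Xb ab; split => //; exists (r / 2) => // c Xc bc.
apply: Hr => // n; have := ler_normD (a n - b n) (b n - c n); rewrite addrA subrK.
by have := ab n; have := bc n; lra.
Qed.

Lemma rel_interior_sub X P a : rel_interior X P a -> P a.
Proof. by move=> [Xa [r r0]]; apply => // n; rewrite subrr normr0 ltW. Qed.

(** Nested closed balls with radii at least halved, where the ball built from stage [k] lies in
    [W k]. The centres converge uniformly, and closedness of [X] keeps the limit in [X]. *)
Lemma baire_uniform X (W : nat -> set (zseq R)) :
  (forall b, (forall e, 0 < e -> exists2 a, X a & forall n, `|a n - b n| <= e) -> X b) ->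
  (forall k, rel_open X (W k)) ->
  (forall k a, X a -> forall e, 0 < e -> exists2 b, W k b & forall n, `|a n - b n| <= e) ->
  rel_dense X (X `&` \bigcap_k W k).
Proof.
move=> Xclosed Wopen Wdense; split=> [a []//|a Xa e e0].
have step (s : nat * (zseq R * R)) : exists t : zseq R * R, X s.2.1 -> 0 < s.2.2 ->
    [/\ X t.1, 0 < t.2, t.2 <= s.2.2 / 2, forall n, `|s.2.1 n - t.1 n| <= s.2.2 / 2 &
     forall b, X b -> (forall n, `|t.1 n - b n| <= t.2) -> W s.1 b].
  case: s => k [c r] /=.
  have [Xc|nXc] := pselect (X c); last by exists (c, r) => /nXc.
  have [r0|r0] := ltP 0 r; last by exists (c, r).
  have [c' Wc' cc'] := Wdense k c Xc (r / 2) (divr_gt0 r0 (ltr0n _ 2)).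
  have [WX /(_ c' Wc')[r' r'0 Hr']] := Wopen k.
  exists (c', Num.min r' (r / 2)) => _ _; split => //=; first exact: WX.
  - by rewrite lt_min r'0 divr_gt0.
  - by rewrite ge_min lexx orbT.
  - by move=> b Xb h; apply: Hr' => // n; apply: le_trans (h n) _; rewrite ge_min lexx.
have [f Hf] := choice step.
pose x := fix x k := if k is j.+1 then f (j, x j) else (a, e).
have inv k : X (x k).1 /\ 0 < (x k).2.
  by elim: k => [//|k [h1 h2]]; have [] := Hf (k, x k) h1 h2.
have nxt k := Hf (k, x k) (proj1 (inv k)) (proj2 (inv k)).
have close k j n : `|(x k).1 n - (x (k + j)%N).1 n| <= (x k).2.
  elim: j k => [|j IH] k; first by rewrite addn0 subrr normr0 ltW// (proj2 (inv k)).
  have [_ _ h1 h2 _] := nxt k; have := IH k.+1; rewrite addSnnS.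
  have /= := h2 n; rewrite /= in h1.
  have := ler_normD ((x k).1 n - (x k.+1).1 n) ((x k.+1).1 n - (x (k + j.+1)%N).1 n).
  by rewrite addrA subrK /=; lra.
have rad k : (x k).2 <= e * 2^-1 ^+ k.
  elim: k => [|k IH]; first by rewrite expr0 mulr1.
  have [_ _ /= h1 _ _] := nxt k; apply: le_trans h1 _.
  by rewrite exprSr mulrA ler_pM2r.
have small d : 0 < d -> exists k, (x k).2 <= d.
  move=> d0.
  have /cvgrPdist_lt/(_ _ d0)[k _ Hk] : (fun k : nat => e * 2^-1 ^+ k) @ \oo --> (e * 0 : R).
    apply: cvgM; first exact: cvg_cst.
    by apply: cvg_expr; rewrite ger0_norm//; lra.
  exists k; apply: le_trans (rad k) _; move: (Hk k (leqnn k)).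
  by rewrite mulr0 sub0r normrN => /ltW; apply: le_trans; exact: ler_norm.
have cx n : cvgn (fun k => (x k).1 n).
  apply/cauchy_cvgP/cauchy_exP => d d0.
  have [k Hk] := small (d / 2) (divr_gt0 d0 (ltr0n _ 2)).
  exists ((x k).1 n); exists k => // j /= kj; rewrite -ball_normE /ball_ /=.
  by have := close k (j - k)%N n; rewrite subnKC//; lra.
pose b n := limn (fun k => (x k).1 n).
have xb k n : `|(x k).1 n - b n| <= (x k).2.
  have c : (fun j => `|(x k).1 n - (x j).1 n|) @ \oo --> `|(x k).1 n - b n|.
    by apply: cvg_norm; apply: cvgB; [exact: cvg_cst | exact: cx].
  rewrite -(cvg_lim _ c)//; apply: limr_le; first by apply/cvg_ex; eexists; exact: c.
  by exists k => // j /= kj; have := close k (j - k)%N n; rewrite subnKC.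
have Xb : X b.
  apply: Xclosed => d /small[k Hk]; exists (x k).1; first exact: proj1 (inv k).
  by move=> n; exact: le_trans (xb k n) Hk.
exists b; last by move=> n; exact: (xb 0%N n).
split => // k _; have [_ _ _ _] := nxt k; apply => // n.
exact: (xb k.+1 n).
Qed.

End Baire.

Section Generic.
Variables (R : realType) (M : R).
Hypothesis M_gt1 : 1 < M.
Implicit Types (a b : zseq R) (E e r : R) (k q : nat).

Local Notation K := (4 * M + 1).

Lemma LPplus_closed b :
  (forall e, 0 < e -> exists2 a, LPplus M a & forall n, `|a n - b n| <= e) -> LPplus M b.
Proof.
move=> H; split=> [e e0|n].
  have e2 : 0 < e / 2 by rewrite divr_gt0.
  have [a [alp _] ab] := H _ e2; have [c [cper ac]] := alp _ e2.
  exists c; split => // n; have := ler_normD (b n - a n) (a n - c n); rewrite addrA subrK.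
  by have := ac n; have := ab n; rewrite distrC; lra.
apply/andP; split; apply/ler_addgt0Pr => e e0; have [a [_ aM] ab] := H e e0.
  by have := aM n; have := ab n; rewrite ler_norml; lra.
by have := aM n; have := ab n; rewrite ler_norml; lra.
Qed.

Lemma thin_cover_open b e : zbounded R b -> thin_cover R b e ->
  exists2 r, 0 < r & forall a, (forall n, `|b n - a n| <= r) -> thin_cover R a e.
Proof.
move=> bB [cs [s [C [s0 C0 sz HC]]]].
pose r := (40 * (1 + C))^-1.
have r0 : 0 < r by rewrite invr_gt0; lra.
have rC : 40 * (r + C * r) = 1 by rewrite /r; field; lra.
exists r => // a ab; exists cs, s, (4 * C); split => //; first lra.
move=> E HE; apply: (bounded_below_perturb R b a E E r 0) (HC E HE) => //.
- exact: ltW.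
- by rewrite subrr normr0.
- have : C * r <= 40^-1 by nra.
  have : r <= 1 by nra.
  nra.
Qed.

Definition good_level k a :=
  (exists2 q, (k <= q)%N & gordon R K a q) /\ thin_cover R a k.+1%:R^-1.

(** Of the allowance [e], one third goes to periodic approximation, one to clamping away from the
    ends of the band, and one to [thin_density]. *)
Lemma good_level_dense k a : LPplus M a -> forall e, 0 < e ->
  exists2 b, rel_interior R (LPplus M) (good_level k) b & forall n, `|a n - b n| <= e.
Proof.
move=> [alp aM] e e0; have M1 := M_gt1.
have Mi : M^-1 < M by rewrite (@lt_trans _ _ 1)// invf_lt1//; lra.
have e3 : 0 < e / 3 by rewrite divr_gt0.
have [b0 [[p [p0 b0p]] ab0]] := alp _ e3.
pose d := Num.min (e / 3) ((M - M^-1) / 2).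
have d0 : 0 < d by rewrite lt_min e3 divr_gt0// subr_gt0.
have d1 : d <= e / 3 by rewrite ge_min lexx.
have d2 : d <= (M - M^-1) / 2 by rewrite ge_min lexx orbT.
(* Clamping preserves periodicity and leaves a margin [d] in the band for the perturbations to
   come. *)
pose b1 : zseq R := fun n => Num.max (M^-1 + d) (Num.min (M - d) (b0 n)).
have b1p : period R b1 p by move=> n; rewrite /b1 b0p.
have b1M n : M^-1 + d <= b1 n <= M - d.
  by rewrite /b1 le_max lexx /= ge_max ge_min lexx /= andbT; lra.
have ab1 n : `|a n - b1 n| <= e / 3 + d.
  have /andP[x1 x2] := aM n; have := ab0 n; rewrite /b1 !ler_norml => /andP[y1 y2].
  case: (leP (M - d) (b0 n)) => h1.
    by case: (leP (M^-1 + d) (M - d)) => h2; apply/andP; split; lra.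
  by case: (leP (M^-1 + d) (b0 n)) => h2; apply/andP; split; lra.
have i0 : 0 < k.+1%:R^-1 :> R by rewrite invr_gt0.
have [b [q [q0 bq bM b1b thin]]] := thin_density R M M_gt1 b1 p d _ p0 b1p d0 b1M i0.
exists b; last first.
  move=> n; have := ler_normD (a n - b1 n) (b1 n - b n); rewrite addrA subrK.
  by have := ab1 n; have := b1b n; lra.
have K0 : 0 <= K by lra.
(* A multiple of the period is again a period; the factor [k + 1] makes it at least [k], so Gordon's
   estimate is available at arbitrarily large scales. *)
have bkq : period R b (k.+1 * q) by exact: periodM.
have [r1 r10 H1] := periodic_gordon R M K M_gt1 K0 b _ bM bkq.
have [r2 r20 H2] := thin_cover_open b _ (in_band_bounded R M M_gt1 b bM) thin.
split.
  split=> // d' d'0; exists b; split; first by exists q.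
  by move=> n; rewrite subrr normr0 ltW.
exists (Num.min r1 r2); first by rewrite lt_min r10.
move=> a' [_ a'M] ba'; split.
  exists (k.+1 * q)%N; first by rewrite (leq_trans (leqnSn k))// leq_pmulr.
  by apply: H1 => // n; rewrite distrC (le_trans (ba' n))// ge_min lexx.
by apply: H2 => n; rewrite (le_trans (ba' n))// ge_min lexx orbT.
Qed.

Definition ball_union (cs : seq R) (s : R) : set R :=
  [set E | has (fun z => `|E - z| < s) cs].

Lemma measure_balls_le (cs : seq R) (s : R) : 0 < s ->
  measurable (ball_union cs s) /\
  (lebesgue_measure (ball_union cs s) <=
    ((size cs)%:R * (2 * s))%:E)%E.
Proof.
move=> s0; elim: cs => [|z cs [IH1 IH2]].
  rewrite (_ : ball_union _ _ = set0); last by apply/seteqP; split.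
  by split; [exact: measurable0 | rewrite measure0 mul0r].
have -> : ball_union (z :: cs) s = ball z s `|` ball_union cs s.
  apply/seteqP; split=> E /=; rewrite -ball_normE /ball_ /= distrC; first by move=> /orP.
  by move=> h; apply/orP.
have mb : measurable (ball z s) := measurable_rball R z s.
split; first exact: measurableU.
apply: le_trans (measureU2 (@lebesgue_measure R) mb IH1) _.
apply: (@le_trans _ _ ((s *+ 2)%:E + ((size cs)%:R * (2 * s))%:E)%E).
  apply: leeD; last exact: IH2.
  by have /eqP := lebesgue_measure_ball z (ltW s0); rewrite eq_le => /andP[].
by rewrite -EFinD lee_fin /= -natr1; lra.
Qed.

Lemma thin_null a : zbounded R a -> (forall k, thin_cover R a k.+1%:R^-1) ->
  lebesgue_measure (spectrum a) = 0%E.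
Proof.
move=> aB thin; apply/eqP; rewrite eq_le measure_ge0 andbT.
apply/lee_addgt0Pr => e e0; rewrite add0e.
have [k ke] : exists k : nat, k.+1%:R^-1 <= e.
  exists (Num.truncn e^-1); rewrite invf_ple ?posrE//.
  by apply: ltW; exact: truncnS_gt.
have [cs [s [C [s0 C0 sz HC]]]] := thin k.
have [mb hb] := measure_balls_le cs s s0.
apply: le_trans (le_trans hb _); last by rewrite lee_fin (le_trans sz).
apply: le_measure; rewrite ?inE//; first exact: closed_measurable (spectrum_closed R a aB).
move=> E sE /=; apply: contrapT => /negP; rewrite -all_predC => /allP nb; apply: sE.
apply/in_resolventP => //; exists C => //; apply: HC => z zc.
by have := nb z zc; rewrite /= -leNgt.
Qed.

Lemma null_interior (S : set R) : measurable S -> lebesgue_measure S = 0%E -> interior S = set0.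
Proof.
move=> mS S0; apply/seteqP; split => // x; rewrite /interior -nbhs_ballE => -[r /= r0 rS].
have : (lebesgue_measure (ball x r) <= lebesgue_measure S)%E.
  by apply: le_measure; rewrite ?inE//; exact: measurable_rball.
by rewrite S0 (lebesgue_measure_ball x (ltW r0)) lee_fin leNgt mulr2n addr_gt0.
Qed.

End Generic.

Theorem theorem1p5 (R : realType) (M : R) (hM : 1 < M) :
  exists G : set (zseq R),
    rel_Gdelta (LPplus M) G /\ rel_dense (LPplus M) G /\
    forall a, G a ->
      cantor_set (spectrum a) /\ (lebesgue_measure (spectrum a) = 0)%E /\
      purely_sc a.
Proof.
pose W k := rel_interior R (LPplus M) (good_level R M k).
have Wopen k : rel_open (LPplus M) (W k) by exact: rel_interior_open.
exists (LPplus M `&` \bigcap_k W k); split; first by exists W.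
split.
  apply: baire_uniform => //; first exact: LPplus_closed.
  by move=> k a; exact: good_level_dense.
move=> a [[_ aM] aW].
have good k : good_level R M k a by apply: rel_interior_sub (aW k I).
have aB : zbounded R a by exact: in_band_bounded hM _ aM.
have null : lebesgue_measure (spectrum a) = 0%E.
  by apply: thin_null => // k; case: (good k).
have noE E : no_eigenvalue R a E.
  (* The Gordon estimates cover [|E| <= 4 * M + 1]; larger energies are in the resolvent set. *)
  have [EK|EK] := leP `|E| (4 * M + 1).
    apply: (gordon_no_eigenvalue R M (4 * M + 1)) => //; first by lra.
    by move=> k; case: (good k).
  have [_ [+ _]] : in_resolvent a E; last by [].
  apply/in_resolventP => //; exists 2 => //.
  by apply: (bounded_below_far R a E M); [move=> n; exact: in_band_norm hM _ _ aM | exact: ltW].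
split; last by split => //; exact: purely_sc_of_null_spectrum.
split; first exact: spectrum_compact.
split; first by apply: null_interior => //; exact: closed_measurable (spectrum_closed R a aB).
by move=> x sx e e0; exact: spectrum_not_isolated.
Qed.
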